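(* We have $\mathcal{M}=\mathcal{D}\cap H^\infty(\mathbb{C}_+)$. Moreover, $\|m\|_{\mathcal{M}}=\|m\|_\infty$ holds for every $m\in\mathcal{M}$.
   Context: $\mathcal{H}$ is the Hilbert space of Dirichlet series $f(s)=\sum_{n=1}^\infty a_n n^{-s}$ with $\|f\|_{\mathcal{H}}^2=\sum_{n=1}^\infty|a_n|^2<+\infty$; its elements are analytic functions on the half-plane $\Re s>\frac12$. A multiplier is a holomorphic function $m$ on $\Re s>\frac12$ such that $mf\in\mathcal{H}$ whenever $f\in\mathcal{H}$; $\mathcal{M}$ is the set of all multipliers, and $\|m\|_{\mathcal{M}}$ is the operator norm of the (automatically bounded) operator $f\mapsto mf$ on $\mathcal{H}$. $\mathbb{C}_+=\{s\in\mathbb{C}:\Re s>0\}$, $H^\infty(\mathbb{C}_+)$ is the set of bounded analytic functions on $\mathbb{C}_+$, and $\|m\|_\infty=\sup_{s\in\mathbb{C}_+}|m(s)|$. $\mathcal{D}$ is the collection of functions which can be represented by a Dirichlet series $\sum_{n=1}^\infty a_n n^{-s}$ convergent in some half-plane $\sigma_c<\Re s<+\infty$. Functions analytic on different right half-planes are identified when they are analytic continuations of one another (so a function is in $\mathcal{D}\cap H^\infty(\mathbb{C}_+)$ if it is bounded and analytic on $\mathbb{C}_+$ and is given by a convergent Dirichlet series in some right half-plane). *)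

(* Defs.v *)
From Stdlib Require Import Reals ClassicalEpsilon.
From Coquelicot Require Import Coquelicot.

Open Scope R_scope.

Definition half_plane (sigma : R) (s : C) : Prop := sigma < Re s.

Definition holomorphic_on (D : C -> Prop) (f : C -> C) : Prop :=
  forall s : C, D s -> @ex_derive C_AbsRing C_NormedModule f s.

Definition Cexp (z : C) : C :=
  (exp (Re z) * cos (Im z), exp (Re z) * sin (Im z)).

(* n^{-s} = exp (- s log n), for n >= 1 *)
Definition nat_Cpow_opp (n : nat) (s : C) : C :=
  Cexp (- (s * RtoC (ln (INR n))))%C.

(* Coefficient sequences are indexed from 0: [a n] is the coefficient of
   (n+1)^{-s}. *)
Definition dirichlet_term (a : nat -> C) (s : C) (n : nat) : C :=
  (a n * nat_Cpow_opp (S n) s)%C.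

(* The series converges to [f s] at every s with Re s > sigma; convergence is
   not assumed to be absolute. *)
Definition dirichlet_on (sigma : R) (a : nat -> C) (f : C -> C) : Prop :=
  forall s : C, half_plane sigma s ->
    @is_series C_AbsRing C_NormedModule (dirichlet_term a s) (f s).

(** The Hilbert space H.  Its elements are functions on Re s > 1/2, encoded as
    total functions of which only the values on that half-plane matter. *)

Definition square_summable (a : nat -> C) : Prop :=
  ex_series (fun n => Cmod (a n) ^ 2).

Definition H_expansion (f : C -> C) (a : nat -> C) : Prop :=
  square_summable a /\ dirichlet_on (1 / 2) a f.

Definition in_H (f : C -> C) : Prop := exists a : nat -> C, H_expansion f a.

(* The coefficients of an element of H are unique, so the choice made by
   [epsilon] is immaterial on H. *)
Definition H_coeff (f : C -> C) : nat -> C :=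
  epsilon (inhabits (fun _ : nat => RtoC 0)) (H_expansion f).

Definition H_norm (f : C -> C) : R :=
  sqrt (Series (fun n => Cmod (H_coeff f n) ^ 2)).

Definition is_multiplier (m : C -> C) : Prop :=
  holomorphic_on (half_plane (1 / 2)) m /\
  forall f : C -> C, in_H f -> in_H (fun s => (m s * f s)%C).

(* Operator norm of f |-> m f on H, as an extended real: nothing is assumed
   about boundedness. *)
Definition multiplier_norm (m : C -> C) : Rbar :=
  Lub_Rbar (fun r : R => exists f : C -> C,
    in_H f /\ H_norm f <= 1 /\ r = H_norm (fun s => (m s * f s)%C)).

Definition is_Hinfty (g : C -> C) : Prop :=
  holomorphic_on (half_plane 0) g /\
  exists B : R, forall s : C, half_plane 0 s -> Cmod (g s) <= B.

Definition Hinfty_norm (g : C -> C) : Rbar :=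
  Lub_Rbar (fun r : R => exists s : C, half_plane 0 s /\ r = Cmod (g s)).

(** Analytic functions on right half-planes, up to analytic continuation. *)

Record rhp_function : Type := Rhp_function {
  abscissa : R;
  rhp_fun :> C -> C;
  rhp_fun_holomorphic : holomorphic_on (half_plane abscissa) rhp_fun
}.

(* The intersection of two right half-planes is a right half-plane, hence
   connected: analytic f on Re s > sigma and g on Re s > tau continue one
   another exactly when they agree on that intersection. *)
Definition identified (sigma : R) (f : C -> C) (tau : R) (g : C -> C) : Prop :=
  forall s : C, half_plane sigma s -> half_plane tau s -> f s = g s.

(* The following predicates on representatives are invariant under
   identification; they encode the sets M, D and H^infty(C_+) of classes. *)

Definition in_M (F : rhp_function) : Prop :=
  exists m : C -> C, is_multiplier m /\ identified (abscissa F) F (1 / 2) m.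

Definition in_D (F : rhp_function) : Prop :=
  exists (sigma : R) (a : nat -> C),
    abscissa F <= sigma /\ dirichlet_on sigma a F.

Definition in_Hinfty (F : rhp_function) : Prop :=
  exists g : C -> C, is_Hinfty g /\ identified (abscissa F) F 0 g.

(* Main.v *)
Require Import Defs.
From Stdlib Require Import Reals Lra Lia Psatz Classical ClassicalEpsilon Arith Znumtheory.
From Coquelicot Require Import Coquelicot.

(** A multiplier m lies in H because 1 does, so m is the sum of a Dirichlet series
    with coefficients a, and by uniqueness of coefficients it acts on H by Dirichlet
    convolution b |-> a * b on square-summable sequences.  Everything is expressed
    through the inequality [conv_bounded a B], that this convolution has norm at
    most B; the theorem says that its best constant is the supremum of |m| on
    Re s > 0.

    That a multiplier satisfies some such inequality is a closed-graph statement,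
    proved by a gliding hump ([conv_bounded_exists]): products by N^(-s) are
    isometries that commute with the convolution and push the humps apart.

    From bounded functions to convolutions ([bounded_conv_bounded]): let g be
    analytic and bounded by B on Re s > 0 and given by a Dirichlet series far to the
    right, and let f be a Dirichlet polynomial.  The coefficients of G = g f are
    the mean values of G(s) n^s over a vertical line of absolute convergence.  As
    G(s) n^s is bounded in vertical strips, Cauchy's theorem shows that these mean
    values are the same on every line Re s = x > 0.  Bessel's inequality on that
    line, together with |G| <= B |f|, bounds the coefficients of G weighted by
    n^(-x), and x tends to 0.

    From convolutions to bounded functions ([conv_bounded_extension]): testing the
    inequality against the vector with entries conj (k^(-s)) on the integers k all
    of whose prime factors are at most y bounds by B, for Re s > 0, the part of the
    series carried by these integers ([smooth_part_bound]); the point of the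
    restriction is that the finite Euler product makes the test vector
    square-summable for every such s.  When y grows, these parts converge for
    Re s > 1/2, and a Vitali argument ([dpoly_vitali]) yields convergence on
    Re s > 0 to an analytic function bounded by B.

    Analytic here means complex differentiable, so Cauchy's theorem is needed in
    Goursat's form ([goursat]); the identity theorem ([identity_theorem]) is deduced
    from it by a Gaussian weight, and no Cauchy integral formula is used.  Taylor
    expansions only occur for Dirichlet polynomials, where they come from the
    exponential series. *)

(** * Finite sums and convergence in the complex plane *)

Fixpoint csum (f : nat -> C) (N : nat) : C :=
  match N with O => 0%C | S n => (csum f n + f n)%C end.

Fixpoint rsum (f : nat -> R) (N : nat) : R :=
  match N with O => 0 | S n => rsum f n + f n end.

Lemma csum_S (f : nat -> C) (N : nat) : csum f (S N) = (csum f N + f N)%C.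
Proof. reflexivity. Qed.

Lemma rsum_S (f : nat -> R) (N : nat) : rsum f (S N) = rsum f N + f N.
Proof. reflexivity. Qed.

Lemma csum_ext (f g : nat -> C) (N : nat) :
  (forall n, (n < N)%nat -> f n = g n) -> csum f N = csum g N.
Proof.
  induction N as [|N IH]; intros H; simpl; [reflexivity|].
  rewrite IH, H; auto with arith.
Qed.

Lemma csum_plus (f g : nat -> C) (N : nat) :
  csum (fun n => f n + g n)%C N = (csum f N + csum g N)%C.
Proof. induction N as [|N IH]; simpl; [|rewrite IH]; ring. Qed.

Lemma csum_minus (f g : nat -> C) (N : nat) :
  csum (fun n => f n - g n)%C N = (csum f N - csum g N)%C.
Proof. induction N as [|N IH]; simpl; [|rewrite IH]; ring. Qed.

Lemma csum_scal (c : C) (f : nat -> C) (N : nat) :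
  csum (fun n => c * f n)%C N = (c * csum f N)%C.
Proof. induction N as [|N IH]; simpl; [|rewrite IH]; ring. Qed.

Lemma csum_zero (f : nat -> C) (N : nat) :
  (forall n, (n < N)%nat -> f n = 0%C) -> csum f N = 0%C.
Proof.
  induction N as [|N IH]; intros H; simpl; [reflexivity|].
  rewrite IH, H; auto with arith; ring.
Qed.

Lemma csum_single (f : nat -> C) (m N : nat) : (m < N)%nat ->
  (forall n, (n < N)%nat -> n <> m -> f n = 0%C) -> csum f N = f m.
Proof.
  induction N as [|N IH]; intros Hm H; [lia|]; simpl.
  destruct (Nat.eq_dec m N) as [->|Hne].
  - rewrite csum_zero; [ring|]. intros n Hn; apply H; lia.
  - rewrite IH, (H N); auto; [ring|lia].
Qed.

Lemma csum_select (c : nat -> C) (m N : nat) : (m < N)%nat ->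
  csum (fun n => c n * (if Nat.eq_dec n m then 1 else 0))%C N = c m.
Proof.
  intros Hm; rewrite (csum_single _ m N Hm).
  - destruct (Nat.eq_dec m m); [ring|congruence].
  - intros n _ Hn; destruct (Nat.eq_dec n m); [contradiction|ring].
Qed.

Lemma csum_exchange (F : nat -> nat -> C) (M N : nat) :
  csum (fun i => csum (fun j => F i j) M) N
  = csum (fun j => csum (fun i => F i j) N) M.
Proof.
  induction N as [|N IH]; simpl.
  - symmetry; apply csum_zero; reflexivity.
  - rewrite IH, <- csum_plus; reflexivity.
Qed.

Lemma csum_extend (f : nat -> C) (M N : nat) : (M <= N)%nat ->
  (forall n, (M <= n < N)%nat -> f n = 0%C) -> csum f N = csum f M.
Proof.
  induction N as [|N IH]; intros HMN H.
  - now replace M with 0%nat by lia.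
  - destruct (Nat.eq_dec M (S N)) as [->|Hne]; [reflexivity|].
    simpl; rewrite (H N), IH by (auto with arith; lia || (intros; apply H; lia)).
    ring.
Qed.

Lemma rsum_ext (f g : nat -> R) (N : nat) :
  (forall n, (n < N)%nat -> f n = g n) -> rsum f N = rsum g N.
Proof.
  induction N as [|N IH]; intros H; simpl; [reflexivity|].
  rewrite IH, H; auto with arith.
Qed.

Lemma rsum_scal (c : R) (f : nat -> R) (N : nat) :
  rsum (fun n => c * f n) N = c * rsum f N.
Proof. induction N as [|N IH]; simpl; [|rewrite IH]; ring. Qed.

Lemma rsum_plus (f g : nat -> R) (N : nat) :
  rsum (fun n => f n + g n) N = rsum f N + rsum g N.
Proof. induction N as [|N IH]; simpl; [|rewrite IH]; ring. Qed.

Lemma rsum_le (f g : nat -> R) (N : nat) :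
  (forall n, (n < N)%nat -> f n <= g n) -> rsum f N <= rsum g N.
Proof.
  induction N as [|N IH]; intros H; simpl; [lra|].
  apply Rplus_le_compat; auto with arith.
Qed.

Lemma rsum_nonneg (f : nat -> R) (N : nat) :
  (forall n, (n < N)%nat -> 0 <= f n) -> 0 <= rsum f N.
Proof.
  induction N as [|N IH]; intros H; simpl; [lra|].
  assert (0 <= f N) by auto with arith. assert (0 <= rsum f N) by auto with arith. lra.
Qed.

Lemma rsum_tail_le (u v : nat -> R) (c : R) (M N : nat) : (M <= N)%nat ->
  (forall n, u n <= c * v n) -> rsum u N - rsum u M <= c * (rsum v N - rsum v M).
Proof.
  intros HMN H; induction HMN as [|N HMN IH]; [lra|]. rewrite !rsum_S. specialize (H N); lra.
Qed.

Lemma rsum_mono (f : nat -> R) (M N : nat) :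
  (forall n, 0 <= f n) -> (M <= N)%nat -> rsum f M <= rsum f N.
Proof.
  intros Hf HMN; induction HMN as [|N HMN IH]; simpl; [lra|].
  specialize (Hf N); lra.
Qed.

Lemma rsum_extend (f : nat -> R) (M N : nat) : (M <= N)%nat ->
  (forall n, (M <= n < N)%nat -> f n = 0) -> rsum f N = rsum f M.
Proof.
  induction N as [|N IH]; intros HMN H.
  - now replace M with 0%nat by lia.
  - destruct (Nat.eq_dec M (S N)) as [->|Hne]; [reflexivity|].
    simpl; rewrite (H N), IH by (auto with arith; lia || (intros; apply H; lia)).
    ring.
Qed.

Lemma rsum_const (c : R) (N : nat) : rsum (fun _ => c) N = INR N * c.
Proof. induction N as [|N IH]; [simpl; ring|]. rewrite S_INR; simpl; rewrite IH; ring. Qed.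

Lemma csum_RtoC (f : nat -> R) (N : nat) :
  csum (fun n => RtoC (f n)) N = RtoC (rsum f N).
Proof.
  induction N as [|N IH]; simpl; [reflexivity|]. rewrite IH, <- RtoC_plus; reflexivity.
Qed.

Lemma Re_csum (f : nat -> C) (N : nat) : Re (csum f N) = rsum (fun n => Re (f n)) N.
Proof. induction N as [|N IH]; simpl; [reflexivity|]. rewrite <- IH; reflexivity. Qed.

Lemma Cmod_csum_le (f : nat -> C) (N : nat) :
  Cmod (csum f N) <= rsum (fun n => Cmod (f n)) N.
Proof.
  induction N as [|N IH]; simpl; [rewrite Cmod_0; lra|].
  eapply Rle_trans; [apply Cmod_triangle|lra].
Qed.

Lemma csum_tail_le (f : nat -> C) (M N : nat) : (M <= N)%nat ->
  Cmod (csum f N - csum f M)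
  <= rsum (fun n => Cmod (f n)) N - rsum (fun n => Cmod (f n)) M.
Proof.
  intros HMN; induction HMN as [|N HMN IH]; simpl.
  - replace (csum f M - csum f M)%C with (RtoC 0) by ring. rewrite Cmod_0; lra.
  - replace (csum f N + f N - csum f M)%C with ((csum f N - csum f M) + f N)%C by ring.
    eapply Rle_trans; [apply Cmod_triangle|lra].
Qed.

Lemma Cmod_minus_sym (x y : C) : Cmod (x - y) = Cmod (y - x).
Proof. rewrite <- Cmod_opp; f_equal; ring. Qed.

Lemma Cmod_triangle_3 (x y z : C) : Cmod (x - z) <= Cmod (x - y) + Cmod (y - z).
Proof. replace (x - z)%C with ((x - y) + (y - z))%C by ring. apply Cmod_triangle. Qed.

Lemma Cmod_le_small (x : C) : (forall e, 0 < e -> Cmod x <= e) -> x = 0%C.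
Proof.
  intros H; apply Cmod_eq_0.
  destruct (Rle_lt_or_eq_dec 0 (Cmod x) (Cmod_ge_0 x)) as [Hp|He]; [|auto].
  specialize (H (Cmod x / 2) ltac:(lra)); lra.
Qed.

Definition clim (u : nat -> C) (l : C) : Prop :=
  forall e, 0 < e -> exists N0, forall N, (N0 <= N)%nat -> Cmod (u N - l) <= e.

Definition cseries (f : nat -> C) (l : C) : Prop := clim (csum f) l.

(** Lets an estimate carry a constant, so that precisions need not be divided in
    advance. *)
Lemma clim_scaled (u : nat -> C) (l : C) (c : R) : 0 <= c ->
  (forall e, 0 < e -> exists N0, forall N, (N0 <= N)%nat -> Cmod (u N - l) <= c * e) ->
  clim u l.
Proof.
  intros Hc H e He.
  destruct (H (e / (c + 1))) as [N0 HN0].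
  { apply Rdiv_lt_0_compat; lra. }
  exists N0; intros N HN. eapply Rle_trans; [apply HN0, HN|].
  apply Rle_trans with ((c + 1) * (e / (c + 1))).
  - apply Rmult_le_compat_r; [apply Rlt_le, Rdiv_lt_0_compat|]; lra.
  - right; field; lra.
Qed.

Lemma clim_unique (u : nat -> C) (l l' : C) : clim u l -> clim u l' -> l = l'.
Proof.
  intros H H'.
  assert (E : (l - l')%C = 0%C).
  { apply Cmod_le_small; intros e He.
    destruct (H (e / 2) ltac:(lra)) as [N HN], (H' (e / 2) ltac:(lra)) as [N' HN'].
    specialize (HN (N + N')%nat ltac:(lia)); specialize (HN' (N + N')%nat ltac:(lia)).
    rewrite Cmod_minus_sym in HN.
    pose proof (Cmod_triangle_3 l (u (N + N')%nat) l'); lra. }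
  replace l with ((l - l') + l')%C by ring. rewrite E; ring.
Qed.

Lemma clim_ext (u v : nat -> C) (l : C) :
  (forall n, u n = v n) -> clim u l -> clim v l.
Proof.
  intros E H e He; destruct (H e He) as [N HN]; exists N; intros n Hn.
  rewrite <- E; auto.
Qed.

Lemma cseries_ext (f g : nat -> C) (l : C) :
  (forall n, f n = g n) -> cseries f l -> cseries g l.
Proof. intros E; apply clim_ext; intros n; apply csum_ext; auto. Qed.

Lemma clim_bounded_by (u : nat -> C) (l : C) (B : R) :
  clim u l -> (forall e, 0 < e -> exists N0, forall N, (N0 <= N)%nat -> Cmod (u N) <= B + e) ->
  Cmod l <= B.
Proof.
  intros H HB; apply Rnot_lt_le; intros Hlt.
  set (e := (Cmod l - B) / 3).
  destruct (H e) as [N HN]; [unfold e; lra|].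
  destruct (HB e) as [N' HN']; [unfold e; lra|].
  specialize (HN (N + N')%nat ltac:(lia)); specialize (HN' (N + N')%nat ltac:(lia)).
  rewrite Cmod_minus_sym in HN.
  pose proof (Cmod_triangle (l - u (N + N')%nat) (u (N + N')%nat)) as T.
  replace (l - u (N + N')%nat + u (N + N')%nat)%C with l in T by ring.
  unfold e in *; lra.
Qed.

Lemma clim_bounded (u : nat -> C) (l : C) : clim u l ->
  exists M, Cmod l <= M /\ forall n, Cmod (u n) <= M.
Proof.
  intros H; destruct (H 1 Rlt_0_1) as [N0 HN0].
  exists (Cmod l + 1 + rsum (fun n => Cmod (u n)) N0).
  assert (P : 0 <= rsum (fun n => Cmod (u n)) N0)
    by (apply rsum_nonneg; intros; apply Cmod_ge_0).
  split; [lra|]. intros n; destruct (le_lt_dec N0 n) as [Hn|Hn].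
  - pose proof (Cmod_triangle (u n - l) l) as T.
    replace (u n - l + l)%C with (u n) in T by ring. specialize (HN0 n Hn); lra.
  - pose proof (rsum_mono (fun n => Cmod (u n)) (S n) N0 (fun _ => Cmod_ge_0 _) ltac:(lia)) as T.
    simpl in T.
    assert (0 <= rsum (fun n => Cmod (u n)) n)
      by (apply rsum_nonneg; intros; apply Cmod_ge_0).
    pose proof (Cmod_ge_0 l); lra.
Qed.

Lemma sqrt_2_le : sqrt 2 <= 2.
Proof. rewrite <- (sqrt_Rsqr 2) at 2 by lra. apply sqrt_le_1; unfold Rsqr; lra. Qed.

Lemma ccauchy_clim (u : nat -> C) :
  (forall e, 0 < e -> exists N0, forall m n, (N0 <= m)%nat -> (N0 <= n)%nat ->
     Cmod (u m - u n) <= e) ->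
  exists l, clim u l.
Proof.
  intros H.
  assert (HR : Cauchy_crit (fun n => Re (u n))).
  { intros e He; destruct (H (e / 2) ltac:(lra)) as [N HN]; exists N; intros m n Hm Hn.
    unfold Rdist. specialize (HN m n Hm Hn).
    pose proof (re_le_Cmod (u m - u n)%C) as T. simpl in T.
    replace (Re (u m) - Re (u n)) with (fst (u m) + - fst (u n)) by reflexivity. lra. }
  assert (HI : Cauchy_crit (fun n => Im (u n))).
  { intros e He; destruct (H (e / 2) ltac:(lra)) as [N HN]; exists N; intros m n Hm Hn.
    unfold Rdist. specialize (HN m n Hm Hn).
    pose proof (Rmax_Cmod (u m - u n)%C) as T. simpl in T.
    pose proof (Rmax_r (Rabs (fst (u m) + - fst (u n))) (Rabs (snd (u m) + - snd (u n)))).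
    replace (Im (u m) - Im (u n)) with (snd (u m) + - snd (u n)) by reflexivity. lra. }
  destruct (Rcomplete.R_complete _ HR) as [x Hx], (Rcomplete.R_complete _ HI) as [y Hy].
  exists (x, y); apply clim_scaled with 2; [lra|]; intros e He.
  destruct (Hx e He) as [N1 HN1], (Hy e He) as [N2 HN2].
  exists (N1 + N2)%nat; intros n Hn.
  specialize (HN1 n ltac:(lia)); specialize (HN2 n ltac:(lia)); unfold Rdist in *.
  eapply Rle_trans; [apply Cmod_2Rmax|].
  pose proof sqrt_2_le as S2.
  apply Rmult_le_compat; try lra; [apply sqrt_pos| |].
  - eapply Rle_trans; [|apply Rmax_l]; apply Rabs_pos.
  - apply Rmax_lub; [apply Rlt_le, HN1|apply Rlt_le, HN2].
Qed.

(** ** Absolute convergence *)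

Definition summable (u : nat -> R) : Prop := exists M, forall N, rsum u N <= M.

Lemma summable_tail (u : nat -> R) : (forall n, 0 <= u n) -> summable u ->
  forall e, 0 < e -> exists N0, forall N, (N0 <= N)%nat -> rsum u N - rsum u N0 <= e.
Proof.
  intros Hu [M HM] e He.
  destruct (completeness (fun x => exists N, x = rsum u N)) as [l [Hl1 Hl2]].
  - exists M; intros x [N ->]; apply HM.
  - exists 0, 0%nat; reflexivity.
  - apply NNPP; intros Hn.
    assert (l <= l - e); [|lra].
    apply Hl2; intros x [N ->].
    apply Rnot_lt_le; intros Hlt; apply Hn; exists N; intros N' HN'.
    assert (rsum u N' <= l) by (apply Hl1; exists N'; reflexivity). lra.
Qed.

Lemma summable_le (u v : nat -> R) :
  (forall n, u n <= v n) -> summable v -> summable u.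
Proof.
  intros H [M HM]; exists M; intros N. eapply Rle_trans; [|apply (HM N)].
  apply rsum_le; auto.
Qed.

Lemma summable_scal (c : R) (u : nat -> R) :
  0 <= c -> summable u -> summable (fun n => c * u n).
Proof.
  intros Hc [M HM]; exists (c * M); intros N; rewrite rsum_scal.
  apply Rmult_le_compat_l; auto.
Qed.

Lemma summable_plus (u v : nat -> R) :
  summable u -> summable v -> summable (fun n => u n + v n).
Proof.
  intros [M HM] [M' HM']; exists (M + M'); intros N; rewrite rsum_plus.
  apply Rplus_le_compat; auto.
Qed.

Definition abs_summable (f : nat -> C) : Prop := summable (fun n => Cmod (f n)).

Lemma abs_summable_cseries (f : nat -> C) : abs_summable f -> exists l, cseries f l.
Proof.
  intros H; apply ccauchy_clim; intros e He.
  destruct (summable_tail _ (fun n => Cmod_ge_0 (f n)) H (e / 2) ltac:(lra)) as [N0 HN0].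
  exists N0; intros m n Hm Hn.
  eapply Rle_trans; [apply (Cmod_triangle_3 _ (csum f N0))|].
  rewrite (Cmod_minus_sym (csum f N0)).
  pose proof (csum_tail_le f N0 m Hm); pose proof (csum_tail_le f N0 n Hn).
  pose proof (HN0 m Hm); pose proof (HN0 n Hn); lra.
Qed.

Lemma cseries_tail_le (f : nat -> C) (l : C) (N0 : nat) (e : R) :
  cseries f l ->
  (forall N, (N0 <= N)%nat ->
     rsum (fun n => Cmod (f n)) N - rsum (fun n => Cmod (f n)) N0 <= e) ->
  Cmod (l - csum f N0) <= e.
Proof.
  intros Hl H; apply Rnot_lt_le; intros Hlt.
  destruct (Hl ((Cmod (l - csum f N0) - e) / 2) ltac:(lra)) as [N1 HN1].
  specialize (HN1 (N0 + N1)%nat ltac:(lia)).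
  specialize (H (N0 + N1)%nat ltac:(lia)).
  pose proof (csum_tail_le f N0 (N0 + N1)%nat ltac:(lia)).
  rewrite Cmod_minus_sym in HN1.
  pose proof (Cmod_triangle_3 l (csum f (N0 + N1)%nat) (csum f N0)); lra.
Qed.

(** ** Dirichlet convolution *)

(** Indices are shifted by one, as in [dirichlet_term]: the entry [n] belongs
    to the integer [n + 1], so the sum runs over the divisors [k + 1] of [n + 1]. *)
Definition conv (a b : nat -> C) (n : nat) : C :=
  csum (fun k => if (S n mod S k =? 0)%nat then a (S n / S k - 1)%nat * b k else 0)%C (S n).

Lemma div_step (N k : nat) :
  if (S N mod S k =? 0)%nat then (S N / S k = S (N / S k))%nat
  else (S N / S k = N / S k)%nat.
Proof.
  pose proof (Nat.div_mod_eq N (S k)) as E.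
  pose proof (Nat.mod_upper_bound N (S k) ltac:(lia)) as B.
  destruct (Nat.eqb_spec (S N mod S k) 0) as [H|H].
  - pose proof (Nat.div_mod_eq (S N) (S k)) as E'. rewrite H in E'.
    nia.
  - destruct (Nat.eq_dec (N mod S k) k) as [Hk|Hk].
    + exfalso; apply H.
      replace (S N) with ((S (N / S k)) * S k)%nat by nia. apply Nat.Div0.mod_mul.
    + symmetry; apply Nat.div_unique with (S (N mod S k)); nia.
Qed.

Lemma multiple_index (n k : nat) : (S n mod S k = 0)%nat ->
  n = (S (S n / S k - 1) * S k - 1)%nat.
Proof.
  intros H. pose proof (Nat.div_mod_eq (S n) (S k)) as E. rewrite H, Nat.add_0_r in E.
  assert (S n / S k <> 0)%nat by (intros E0; rewrite E0 in E; lia).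
  replace (S (S n / S k - 1))%nat with (S n / S k)%nat by lia. nia.
Qed.

Lemma csum_multiples (a : nat -> C) (k N : nat) :
  csum (fun n => if (S n mod S k =? 0)%nat then a (S n / S k - 1)%nat else 0%C) N
  = csum a (N / S k).
Proof.
  induction N as [|N IH]; [rewrite Nat.Div0.div_0_l; reflexivity|].
  rewrite csum_S, IH. pose proof (div_step N k) as D.
  destruct (S N mod S k =? 0)%nat; rewrite D.
  - rewrite csum_S; replace (S (N / S k) - 1)%nat with (N / S k)%nat by lia. reflexivity.
  - ring.
Qed.

(** A general term of the convolution splits over pairs (divisor, cofactor), and
    for a fixed divisor the cofactors below a bound form an initial segment. *)
Lemma csum_conv (a b : nat -> C) (N : nat) :
  csum (conv a b) N = csum (fun k => b k * csum a (N / S k))%C N.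
Proof.
  unfold conv.
  transitivity (csum (fun n => csum (fun k =>
     if (S n mod S k =? 0)%nat then a (S n / S k - 1)%nat * b k else 0)%C N) N).
  - apply csum_ext; intros n Hn; symmetry; apply csum_extend; [lia|].
    intros k Hk; rewrite Nat.mod_small by lia. reflexivity.
  - rewrite csum_exchange; apply csum_ext; intros k _.
    rewrite <- csum_multiples, <- csum_scal; apply csum_ext; intros n _.
    destruct (S n mod S k =? 0)%nat; ring.
Qed.

Lemma conv_ext (a b a' b' : nat -> C) (n : nat) :
  (forall k, (k <= n)%nat -> a k = a' k) -> (forall k, (k <= n)%nat -> b k = b' k) ->
  conv a b n = conv a' b' n.
Proof.
  intros Ha Hb; unfold conv; apply csum_ext; intros k Hk.
  destruct (S n mod S k =? 0)%nat; [|reflexivity].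
  rewrite Ha, Hb; [reflexivity|lia|].
  pose proof (Nat.Div0.div_le_upper_bound (S n) (S k) (S n) ltac:(nia)); lia.
Qed.

Lemma conv_plus_r (a b b' : nat -> C) (n : nat) :
  conv a (fun k => b k + b' k)%C n = (conv a b n + conv a b' n)%C.
Proof.
  unfold conv; rewrite <- csum_plus; apply csum_ext; intros k _.
  destruct (S n mod S k =? 0)%nat; ring.
Qed.

Lemma conv_scal_r (a b : nat -> C) (c : C) (n : nat) :
  conv a (fun k => c * b k)%C n = (c * conv a b n)%C.
Proof.
  unfold conv; rewrite <- csum_scal; apply csum_ext; intros k _.
  destruct (S n mod S k =? 0)%nat; ring.
Qed.

(** With [x n] the power (n+1)^(-s), this turns the convolution of the coefficients
    into that of the terms of the series. *)
Lemma conv_twist (x : nat -> C) (a b : nat -> C) (n : nat) :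
  (forall j k, x (S j * S k - 1)%nat = x j * x k)%C ->
  conv (fun k => a k * x k)%C (fun k => b k * x k)%C n = (conv a b n * x n)%C.
Proof.
  intros Hx; unfold conv; rewrite Cmult_comm, <- csum_scal; apply csum_ext; intros k Hk.
  destruct (Nat.eqb_spec (S n mod S k) 0) as [H|H]; [|ring].
  replace (x n) with (x (S n / S k - 1)%nat * x k)%C; [ring|].
  rewrite <- Hx; f_equal; symmetry; apply multiple_index, H.
Qed.

(** The first factor enters only through its partial sums [csum a (N / S k)],
    which converge and are bounded; the second is dominated by its absolute
    convergence. *)
Lemma cseries_conv (a b : nat -> C) (A B : C) :
  cseries a A -> abs_summable b -> cseries b B -> cseries (conv a b) (A * B)%C.
Proof.
  intros Ha Hb HB.
  destruct (clim_bounded _ _ Ha) as [M [HM1 HM2]].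
  destruct Hb as [K HK].
  assert (HM0 : 0 <= M) by (eapply Rle_trans; [apply Cmod_ge_0|apply HM1]).
  assert (HK0 : 0 <= K) by (apply (HK 0%nat)).
  apply clim_scaled with (K + 2 * M + M); [lra|]; intros e He.
  destruct (summable_tail _ (fun n => Cmod_ge_0 (b n)) (ex_intro _ K HK) e He) as [K0 HK0'].
  destruct (Ha e He) as [N1 HN1]. destruct (HB e He) as [N2 HN2].
  exists (S K0 * S N1 + N2)%nat; intros N HN.
  rewrite csum_conv.
  replace (csum (fun k => b k * csum a (N / S k)) N - A * B)%C with
    (csum (fun k => b k * (csum a (N / S k)%nat - A)) N + A * (csum b N - B))%C.
  2:{ rewrite (csum_ext (fun k => b k * (csum a (N / S k)%nat - A))%C
        (fun k => b k * csum a (N / S k)%nat - A * b k)%C) by (intros; ring).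
      rewrite csum_minus, csum_scal; ring. }
  eapply Rle_trans; [apply Cmod_triangle|].
  apply Rle_trans with ((K * e + 2 * M * e) + M * e); [|lra].
  apply Rplus_le_compat.
  2:{ rewrite Cmod_mult; apply Rmult_le_compat; try apply Cmod_ge_0; auto.
      apply HN2; lia. }
  set (w := fun k => Cmod (b k * (csum a (N / S k)%nat - A))%C).
  eapply Rle_trans; [apply Cmod_csum_le|]. change (rsum w N <= K * e + 2 * M * e).
  assert (H1 : rsum w K0 <= K * e).
  { apply Rle_trans with (rsum (fun k => e * Cmod (b k)) K0).
    - apply rsum_le; intros k Hk; unfold w; rewrite Cmod_mult, Rmult_comm.
      apply Rmult_le_compat_r; [apply Cmod_ge_0|]. apply HN1.
      apply Nat.div_le_lower_bound; [lia|].
      pose proof (Nat.mul_le_mono (S k) (S K0) N1 (S N1) ltac:(lia) ltac:(lia)) as Hm; lia.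
    - rewrite rsum_scal, Rmult_comm; apply Rmult_le_compat_r; [lra|apply HK]. }
  pose proof (Nat.mul_le_mono (S K0) (S K0) 1 (S N1) ltac:(lia) ltac:(lia)) as HKK.
  assert (H2 : rsum w N - rsum w K0 <= 2 * M * (rsum (fun n => Cmod (b n)) N
                - rsum (fun n => Cmod (b n)) K0)).
  { apply rsum_tail_le; [lia|]. intros k; unfold w; rewrite Cmod_mult, Rmult_comm.
    apply Rmult_le_compat_r; [apply Cmod_ge_0|].
    unfold Cminus; eapply Rle_trans; [apply Cmod_triangle|].
    rewrite Cmod_opp; specialize (HM2 (N / S k)%nat); lra. }
  assert (HN' : (K0 <= N)%nat) by lia. specialize (HK0' N HN').
  assert (2 * M * (rsum (fun n => Cmod (b n)) N - rsum (fun n => Cmod (b n)) K0) <= 2 * M * e)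
    by (apply Rmult_le_compat_l; lra).
  clearbody w; lra.
Qed.

Lemma Cmod_conv_le (a b : nat -> C) (n : nat) :
  Cmod (conv a b n)
  <= Re (conv (fun k => RtoC (Cmod (a k))) (fun k => RtoC (Cmod (b k))) n).
Proof.
  unfold conv; rewrite Re_csum; eapply Rle_trans; [apply Cmod_csum_le|].
  apply rsum_le; intros k _. destruct (S n mod S k =? 0)%nat.
  - rewrite Cmod_mult; simpl; lra.
  - rewrite Cmod_0; simpl; lra.
Qed.

Lemma abs_summable_conv (a b : nat -> C) :
  abs_summable a -> abs_summable b -> abs_summable (conv a b).
Proof.
  intros [M HM] [K HK]; exists (K * M); intros N.
  eapply Rle_trans; [apply rsum_le; intros; apply Cmod_conv_le|].
  rewrite <- Re_csum, csum_conv.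
  rewrite (csum_ext _ (fun k => RtoC (Cmod (b k) * rsum (fun n => Cmod (a n)) (N / S k)))).
  2:{ intros k _; rewrite csum_RtoC, RtoC_mult; reflexivity. }
  rewrite csum_RtoC; simpl.
  apply Rle_trans with (rsum (fun k => M * Cmod (b k)) N).
  - apply rsum_le; intros k _; rewrite Rmult_comm.
    apply Rmult_le_compat_r; [apply Cmod_ge_0|apply HM].
  - rewrite rsum_scal, Rmult_comm; apply Rmult_le_compat_r; [apply (HM 0%nat)|apply HK].
Qed.

(** * The complex exponential and the powers n^(-s) *)

Lemma C_eq (x y : C) : Re x = Re y -> Im x = Im y -> x = y.
Proof. destruct x, y; simpl; intros -> ->; reflexivity. Qed.

Lemma Cexp_plus (z w : C) : Cexp (z + w) = (Cexp z * Cexp w)%C.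
Proof.
  destruct z as [x y], w as [u v]; unfold Cexp; apply C_eq; simpl;
  rewrite exp_plus; [rewrite cos_plus|rewrite sin_plus]; ring.
Qed.

Lemma Cexp_0 : Cexp 0 = 1%C.
Proof. unfold Cexp; apply C_eq; simpl; rewrite exp_0, ?cos_0, ?sin_0; ring. Qed.

Lemma Cmod_Cexp (z : C) : Cmod (Cexp z) = exp (Re z).
Proof.
  unfold Cmod, Cexp; simpl.
  replace (_ + _) with (Rsqr (exp (Re z))).
  - apply sqrt_Rsqr, Rlt_le, exp_pos.
  - unfold Rsqr. pose proof (sin2_cos2 (Im z)) as H; unfold Rsqr in H.
    transitivity (exp (Re z) * exp (Re z) * (sin (Im z) * sin (Im z) + cos (Im z) * cos (Im z))).
    + rewrite H; ring.
    + ring.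
Qed.

Lemma Cconj_Cexp (z : C) : Cconj (Cexp z) = Cexp (Cconj z).
Proof.
  destruct z; unfold Cexp, Cconj; apply C_eq; simpl; rewrite ?cos_neg, ?sin_neg; ring.
Qed.

Definition freq (n : nat) : R := ln (INR (S n)).

Lemma INR_S_pos (n : nat) : 0 < INR (S n).
Proof. apply lt_0_INR; lia. Qed.

Lemma freq_nonneg (n : nat) : 0 <= freq n.
Proof.
  unfold freq; rewrite <- ln_1; apply ln_le; [lra|].
  rewrite S_INR; pose proof (pos_INR n); lra.
Qed.

Lemma freq_0 : freq 0 = 0.
Proof. unfold freq; simpl; apply ln_1. Qed.

Lemma freq_inj (m n : nat) : freq m = freq n -> m = n.
Proof.
  unfold freq; intros H; apply ln_inv in H; try apply INR_S_pos.
  apply INR_eq in H; lia.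
Qed.

Lemma freq_mult (j k : nat) : freq (S j * S k - 1) = freq j + freq k.
Proof.
  unfold freq; rewrite <- ln_mult, <- mult_INR by apply INR_S_pos.
  do 2 f_equal; nia.
Qed.

Definition npow (n : nat) (s : C) : C := nat_Cpow_opp (S n) s.

Lemma npow_Cexp (n : nat) (s : C) : npow n s = Cexp (- (s * RtoC (freq n)))%C.
Proof. reflexivity. Qed.

Lemma npow_mult (s : C) (j k : nat) : npow (S j * S k - 1) s = (npow j s * npow k s)%C.
Proof.
  rewrite !npow_Cexp, <- Cexp_plus, freq_mult, RtoC_plus; f_equal; ring.
Qed.

Lemma npow_plus (n : nat) (s w : C) : npow n (s + w) = (npow n s * npow n w)%C.
Proof. rewrite !npow_Cexp, <- Cexp_plus; f_equal; ring. Qed.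

Definition rpow (n : nat) (x : R) : R := exp (- (x * freq n)).

Lemma Cmod_npow (n : nat) (s : C) : Cmod (npow n s) = rpow n (Re s).
Proof.
  rewrite npow_Cexp, Cmod_Cexp; unfold rpow; f_equal; destruct s; simpl; ring.
Qed.

Lemma rpow_pos (n : nat) (x : R) : 0 < rpow n x.
Proof. apply exp_pos. Qed.

Lemma abs_term_nonneg (c : C) (n : nat) (x : R) : 0 <= Cmod c * rpow n x.
Proof. apply Rmult_le_pos; [apply Cmod_ge_0|apply Rlt_le, rpow_pos]. Qed.

Lemma rpow_antimono (n : nat) (x y : R) : x <= y -> rpow n y <= rpow n x.
Proof.
  intros H; unfold rpow. pose proof (freq_nonneg n) as Hf.
  destruct (Rle_lt_or_eq_dec (- (y * freq n)) (- (x * freq n))) as [Hl|He]; [nra| |].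
  - apply Rlt_le, exp_increasing, Hl.
  - rewrite He; lra.
Qed.

Lemma rpow_0 (n : nat) : rpow n 0 = 1.
Proof. unfold rpow; rewrite Rmult_0_l, Ropp_0; apply exp_0. Qed.

Lemma rpow_plus (n : nat) (x y : R) : rpow n (x + y) = rpow n x * rpow n y.
Proof. unfold rpow; rewrite <- exp_plus; f_equal; ring. Qed.

Lemma rpow_le_1 (n : nat) (x : R) : 0 <= x -> rpow n x <= 1.
Proof. intros H; rewrite <- (rpow_0 n); apply rpow_antimono, H. Qed.

(** Telescoping: (n+1)^(-x) is at most a multiple of the increment of
    -(n+1)^(1-x), by [exp u >= 1 + u] and [ln u <= u - 1]. *)
Lemma summable_rpow (x : R) : 1 < x -> summable (fun n => rpow n x).
Proof.
  intros Hx; set (d := x - 1). assert (Hd : 0 < d) by (unfold d; lra).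
  assert (step : forall n, d * rpow (S n) x <= rpow n d - rpow (S n) d).
  { intros n. replace x with (d + 1) by (unfold d; ring). rewrite rpow_plus.
    assert (E : rpow (S n) 1 = / INR (S (S n))).
    { unfold rpow, freq; rewrite Rmult_1_l, exp_Ropp, exp_ln; [reflexivity|apply INR_S_pos]. }
    assert (D : rpow (S n) 1 <= freq (S n) - freq n).
    { unfold freq at 1 2. pose proof (INR_S_pos n) as P1; pose proof (INR_S_pos (S n)) as P2.
      pose proof (exp_ineq1_le (ln (INR (S n) / INR (S (S n))))) as H.
      rewrite exp_ln in H by (apply Rdiv_lt_0_compat; auto).
      rewrite ln_div in H by auto. rewrite E.
      assert (/ INR (S (S n)) = 1 - INR (S n) / INR (S (S n))).
      { rewrite (S_INR (S n)); field; rewrite <- S_INR; lra. }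
      lra. }
    assert (F : rpow n d = rpow (S n) d * exp (d * (freq (S n) - freq n))).
    { unfold rpow; rewrite <- exp_plus; f_equal; ring. }
    rewrite F. pose proof (exp_ineq1_le (d * (freq (S n) - freq n))).
    pose proof (rpow_pos (S n) d).
    assert (rpow (S n) d * (d * rpow (S n) 1) <= rpow (S n) d * (exp (d * (freq (S n) - freq n)) - 1)).
    { apply Rmult_le_compat_l; [lra|]. nra. }
    lra. }
  exists (1 + / d). intros N.
  assert (Hb : forall n, d * rsum (fun n => rpow n x) (S n) <= d + 1 - rpow n d).
  { induction n as [|n IH].
    - simpl; unfold rpow; rewrite freq_0, !Rmult_0_r, Ropp_0, exp_0; lra.
    - rewrite rsum_S. specialize (step n). lra. }
  apply Rle_trans with (rsum (fun n => rpow n x) (S N)).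
  - rewrite rsum_S; pose proof (rpow_pos N x); lra.
  - specialize (Hb N). pose proof (rpow_pos N d).
    apply Rmult_le_reg_l with d; [lra|].
    replace (d * (1 + / d)) with (d + 1) by (field; lra). lra.
Qed.

(** * Integrals of complex-valued functions of a real variable *)

Definition cc_at (F : R -> C) (t : R) : Prop :=
  continuous (fun t => Re (F t)) t /\ continuous (fun t => Im (F t)) t.

Lemma cc_at_const (c : C) (t : R) : cc_at (fun _ => c) t.
Proof. split; apply continuous_const. Qed.

Lemma cc_at_ext (F G : R -> C) (t : R) : (forall t, F t = G t) -> cc_at F t -> cc_at G t.
Proof.
  intros E [H1 H2]; split.
  - apply continuous_ext with (2 := H1); intros; rewrite E; reflexivity.
  - apply continuous_ext with (2 := H2); intros; rewrite E; reflexivity.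
Qed.

Lemma cc_at_plus (F G : R -> C) (t : R) :
  cc_at F t -> cc_at G t -> cc_at (fun t => F t + G t)%C t.
Proof.
  intros [F1 F2] [G1 G2]; split; simpl;
  apply (continuous_plus (V := R_NormedModule)); assumption.
Qed.

Lemma cc_at_mult (F G : R -> C) (t : R) :
  cc_at F t -> cc_at G t -> cc_at (fun t => F t * G t)%C t.
Proof.
  intros [F1 F2] [G1 G2]; split; simpl.
  - apply (continuous_minus (V := R_NormedModule));
    apply (continuous_mult (K := R_AbsRing)); assumption.
  - apply (continuous_plus (V := R_NormedModule));
    apply (continuous_mult (K := R_AbsRing)); assumption.
Qed.

Lemma cc_at_eps (F : R -> C) (t : R) :
  (forall e, 0 < e -> exists d, 0 < d /\
     forall u, Rabs (u - t) < d -> Cmod (F u - F t) <= e) <-> cc_at F t.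
Proof.
  split.
  - intros H; split; apply filterlim_locally; intros e;
    destruct (H (e / 2)) as [d [Hd Hd']]; [destruct e; simpl; lra| |destruct e; simpl; lra|];
    exists (mkposreal d Hd); intros u Hu; specialize (Hd' u Hu);
    pose proof (Rmax_Cmod (F u - F t)%C) as T;
    pose proof (Rmax_l (Rabs (fst (F u - F t)%C)) (Rabs (snd (F u - F t)%C)));
    pose proof (Rmax_r (Rabs (fst (F u - F t)%C)) (Rabs (snd (F u - F t)%C)));
    pose proof (cond_pos e).
    + change (Rabs (Re (F u) - Re (F t)) < e).
      change (fst (F u - F t)%C) with (Re (F u) - Re (F t)) in *. lra.
    + change (Rabs (Im (F u) - Im (F t)) < e).
      change (snd (F u - F t)%C) with (Im (F u) - Im (F t)) in *. lra.
  - intros [H1 H2] e He.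
    assert (He2 : 0 < e / 2) by lra.
    apply filterlim_locally with (eps := mkposreal _ He2) in H1.
    apply filterlim_locally with (eps := mkposreal _ He2) in H2.
    destruct H1 as [d1 H1], H2 as [d2 H2].
    exists (Rmin d1 d2); split; [apply Rmin_pos; apply cond_pos|].
    intros u Hu.
    specialize (H1 u (Rlt_le_trans _ _ _ Hu (Rmin_l _ _))).
    specialize (H2 u (Rlt_le_trans _ _ _ Hu (Rmin_r _ _))).
    change (Rabs (Re (F u) - Re (F t)) < e / 2) in H1.
    change (Rabs (Im (F u) - Im (F t)) < e / 2) in H2.
    eapply Rle_trans; [apply Cmod_2Rmax|].
    pose proof sqrt_2_le as S2.
    replace e with (2 * (e / 2)) by field.
    apply Rmult_le_compat; try lra; [apply sqrt_pos| |].
    + eapply Rle_trans; [|apply Rmax_l]; apply Rabs_pos.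
    + apply Rmax_lub; apply Rlt_le; assumption.
Qed.

Definition CInt (F : R -> C) (a b : R) : C :=
  (RInt (fun t => Re (F t)) a b, RInt (fun t => Im (F t)) a b).

Definition cc_on (F : R -> C) (a b : R) : Prop := forall t, a <= t <= b -> cc_at F t.

Lemma cc_on_sub (F : R -> C) (a b a' b' : R) :
  a <= a' -> b' <= b -> cc_on F a b -> cc_on F a' b'.
Proof. intros Ha Hb H t Ht; apply H; lra. Qed.

Lemma cc_on_ex_RInt (F : R -> C) (a b : R) : a <= b -> cc_on F a b ->
  ex_RInt (fun t => Re (F t)) a b /\ ex_RInt (fun t => Im (F t)) a b.
Proof.
  intros Hab H; split; apply (ex_RInt_continuous (V := R_CompleteNormedModule));
  rewrite Rmin_left, Rmax_right by lra; intros t Ht; apply (H t Ht).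
Qed.

Lemma CInt_ext (F G : R -> C) (a b : R) : a <= b ->
  (forall t, a <= t <= b -> F t = G t) -> CInt F a b = CInt G a b.
Proof.
  intros Hab H; unfold CInt; f_equal; apply RInt_ext;
  rewrite Rmin_left, Rmax_right by lra; intros t Ht; rewrite H; lra || reflexivity.
Qed.

Lemma CInt_plus (F G : R -> C) (a b : R) : a <= b -> cc_on F a b -> cc_on G a b ->
  CInt (fun t => F t + G t)%C a b = (CInt F a b + CInt G a b)%C.
Proof.
  intros Hab HF HG.
  destruct (cc_on_ex_RInt F a b Hab HF), (cc_on_ex_RInt G a b Hab HG).
  apply C_eq; simpl.
  - apply (RInt_plus (V := R_CompleteNormedModule) (fun t => Re (F t)) (fun t => Re (G t)));
    assumption.
  - apply (RInt_plus (V := R_CompleteNormedModule) (fun t => Im (F t)) (fun t => Im (G t)));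
    assumption.
Qed.

Lemma CInt_scal (c : C) (F : R -> C) (a b : R) : a <= b -> cc_on F a b ->
  CInt (fun t => c * F t)%C a b = (c * CInt F a b)%C.
Proof.
  intros Hab HF. destruct (cc_on_ex_RInt F a b Hab HF) as [H1 H2].
  assert (Ex : forall (k : R) (f : R -> R), ex_RInt f a b -> ex_RInt (fun t => k * f t) a b)
    by (intros k f Hf; apply (ex_RInt_scal (V := R_NormedModule)); assumption).
  assert (Sc : forall (k : R) (f : R -> R), ex_RInt f a b ->
     RInt (fun t => k * f t) a b = k * RInt f a b)
    by (intros k f Hf; apply (RInt_scal (V := R_CompleteNormedModule)); assumption).
  apply C_eq; simpl.
  - rewrite (RInt_minus (V := R_CompleteNormedModule)
       (fun t => fst c * Re (F t)) (fun t => snd c * Im (F t))) by (apply Ex; assumption).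
    rewrite !Sc by assumption. reflexivity.
  - rewrite (RInt_plus (V := R_CompleteNormedModule)
       (fun t => fst c * Im (F t)) (fun t => snd c * Re (F t))) by (apply Ex; assumption).
    rewrite !Sc by assumption. reflexivity.
Qed.

Lemma CInt_Chasles (F : R -> C) (a b c : R) : a <= b -> b <= c -> cc_on F a c ->
  CInt F a c = (CInt F a b + CInt F b c)%C.
Proof.
  intros Hab Hbc HF.
  destruct (cc_on_ex_RInt F a b Hab) as [H1 H2]; [apply (cc_on_sub F a c); lra || auto|].
  destruct (cc_on_ex_RInt F b c Hbc) as [H3 H4]; [apply (cc_on_sub F a c); lra || auto|].
  symmetry; apply C_eq; simpl; apply (RInt_Chasles (V := R_CompleteNormedModule)); assumption.
Qed.

Lemma Re_CInt_le (F G : R -> C) (a b : R) : a <= b -> cc_on F a b -> cc_on G a b ->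
  (forall t, a <= t <= b -> Re (F t) <= Re (G t)) -> Re (CInt F a b) <= Re (CInt G a b).
Proof.
  intros Hab HF HG H; simpl. apply RInt_le; auto.
  - apply (cc_on_ex_RInt F a b); auto.
  - apply (cc_on_ex_RInt G a b); auto.
  - intros t Ht; apply H; lra.
Qed.

Lemma CInt_const (c : C) (a b : R) : CInt (fun _ => c) a b = (RtoC (b - a) * c)%C.
Proof.
  unfold CInt; destruct c; apply C_eq; simpl; rewrite RInt_const; unfold scal; simpl;
  unfold mult; simpl; ring.
Qed.

Lemma Re_Cconj_mult (c : C) : Re (Cconj c * c)%C = Cmod c ^ 2.
Proof. rewrite Cmod2_alt; destruct c; simpl; ring. Qed.

(** The real part of [conj I * F], for I the integral, is at most [|I| |F|]. *)
Lemma Cmod_CInt_le (F : R -> C) (a b M : R) : a <= b -> cc_on F a b ->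
  (forall t, a <= t <= b -> Cmod (F t) <= M) -> Cmod (CInt F a b) <= (b - a) * M.
Proof.
  intros Hab HF HM. set (J := CInt F a b).
  assert (HM0 : 0 <= M) by (eapply Rle_trans; [apply Cmod_ge_0|apply (HM a); lra]).
  destruct (Rle_lt_or_eq_dec 0 (Cmod J) (Cmod_ge_0 J)) as [Hp|He]; [|rewrite <- He; nra].
  assert (H : Cmod J ^ 2 <= (b - a) * (Cmod J * M)).
  { rewrite <- Re_Cconj_mult. unfold J at 2. rewrite <- CInt_scal by assumption.
    replace ((b - a) * (Cmod J * M)) with (Re (CInt (fun _ => RtoC (Cmod J * M)) a b))
      by (rewrite CInt_const; simpl; ring).
    apply Re_CInt_le; auto.
    - intros t Ht; apply cc_at_mult; [apply cc_at_const|apply HF, Ht].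
    - intros t Ht; apply cc_at_const.
    - intros t Ht. eapply Rle_trans; [eapply Rle_trans; [apply Rle_abs|apply re_le_Cmod]|].
      rewrite Cmod_mult, Cmod_conj. simpl. apply Rmult_le_compat_l; [lra|auto]. }
  apply Rmult_le_reg_l with (Cmod J); [assumption|].
  replace (Cmod J * Cmod J) with (Cmod J ^ 2) by ring. lra.
Qed.

(** * Mean values over the line *)

Definition mean (T : R) (F : R -> C) : C := (RtoC (/ (2 * T)) * CInt F (- T) T)%C.

Definition mean_lim (F : R -> C) (c : C) : Prop :=
  (forall t, cc_at F t) /\
  forall e, 0 < e -> exists T0, 0 < T0 /\ forall T, T0 <= T -> Cmod (mean T F - c) <= e.

Lemma cc_on_all (F : R -> C) (a b : R) : (forall t, cc_at F t) -> cc_on F a b.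
Proof. intros H t _; apply H. Qed.
Local Hint Resolve cc_on_all : core.

Lemma mean_plus (T : R) (F G : R -> C) : 0 < T ->
  (forall t, cc_at F t) -> (forall t, cc_at G t) ->
  mean T (fun t => F t + G t)%C = (mean T F + mean T G)%C.
Proof. intros; unfold mean; rewrite CInt_plus; auto; [ring|lra]. Qed.

Lemma mean_scal (T : R) (k : C) (F : R -> C) : 0 < T -> (forall t, cc_at F t) ->
  mean T (fun t => k * F t)%C = (k * mean T F)%C.
Proof. intros; unfold mean; rewrite CInt_scal; auto; [ring|lra]. Qed.

Lemma Cmod_mean_le (T B : R) (F : R -> C) : 0 < T -> (forall t, cc_at F t) ->
  (forall t, Cmod (F t) <= B) -> Cmod (mean T F) <= B.
Proof.
  intros HT HF HB; unfold mean. rewrite Cmod_mult, Cmod_R.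
  rewrite Rabs_pos_eq by (apply Rlt_le, Rinv_0_lt_compat; lra).
  apply Rmult_le_reg_l with (2 * T); [lra|].
  rewrite <- Rmult_assoc, Rinv_r, Rmult_1_l by lra.
  eapply Rle_trans; [apply (Cmod_CInt_le F (- T) T B); auto; lra|]. lra.
Qed.

Lemma mean_lim_ext (F G : R -> C) (c : C) :
  (forall t, F t = G t) -> mean_lim F c -> mean_lim G c.
Proof.
  intros E [HF H]; split.
  - intros t; apply cc_at_ext with (1 := E), HF.
  - intros e He; destruct (H e He) as [T0 [HT0 HT]]; exists T0; split; [assumption|].
    intros T HTT; specialize (HT T HTT). unfold mean in *.
    rewrite <- (CInt_ext F G); auto; lra.
Qed.

Lemma mean_lim_plus (F G : R -> C) (c d : C) :
  mean_lim F c -> mean_lim G d -> mean_lim (fun t => F t + G t)%C (c + d)%C.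
Proof.
  intros [HF H] [HG H']; split.
  - intros t; apply cc_at_plus; auto.
  - intros e He.
    destruct (H (e / 2) ltac:(lra)) as [T0 [HT0 HT]], (H' (e / 2) ltac:(lra)) as [T1 [HT1 HT']].
    exists (Rmax T0 T1). pose proof (Rmax_l T0 T1); pose proof (Rmax_r T0 T1).
    split; [lra|]. intros T HTT. rewrite mean_plus by (auto; lra).
    replace (mean T F + mean T G - (c + d))%C with ((mean T F - c) + (mean T G - d))%C by ring.
    eapply Rle_trans; [apply Cmod_triangle|].
    specialize (HT T ltac:(lra)); specialize (HT' T ltac:(lra)); lra.
Qed.

Lemma mean_lim_scal (k : C) (F : R -> C) (c : C) :
  mean_lim F c -> mean_lim (fun t => k * F t)%C (k * c)%C.
Proof.
  intros [HF H]; split.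
  - intros t; apply cc_at_mult; [apply cc_at_const|auto].
  - intros e He. pose proof (Cmod_ge_0 k).
    destruct (H (e / (Cmod k + 1))) as [T0 [HT0 HT]]; [apply Rdiv_lt_0_compat; lra|].
    exists T0; split; [assumption|]; intros T HTT.
    rewrite mean_scal by (auto; lra).
    replace (k * mean T F - k * c)%C with (k * (mean T F - c))%C by ring.
    rewrite Cmod_mult. apply Rle_trans with ((Cmod k + 1) * (e / (Cmod k + 1))).
    + apply Rmult_le_compat; try lra; [apply Cmod_ge_0|auto].
    + right; field; lra.
Qed.

Lemma mean_const (T : R) (c : C) : 0 < T -> mean T (fun _ => c) = c.
Proof.
  intros HT; unfold mean; rewrite CInt_const.
  rewrite Cmult_assoc, <- RtoC_mult. replace (/ (2 * T) * (T - - T)) with 1 by (field; lra).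
  ring.
Qed.

Lemma mean_lim_const (c : C) : mean_lim (fun _ => c) c.
Proof.
  split; [intros; apply cc_at_const|]. intros e He; exists 1; split; [lra|]. intros T HT.
  rewrite mean_const by lra. replace (c - c)%C with (RtoC 0) by ring. rewrite Cmod_0; lra.
Qed.

Lemma mean_lim_csum (F : nat -> R -> C) (c : nat -> C) (N : nat) :
  (forall n, (n < N)%nat -> mean_lim (F n) (c n)) ->
  mean_lim (fun t => csum (fun n => F n t) N) (csum c N).
Proof.
  induction N as [|N IH]; intros H; simpl; [apply mean_lim_const|].
  apply mean_lim_plus; auto.
Qed.

Lemma cc_at_uniform (F : R -> C) (t : R) :
  (forall e, 0 < e -> exists G, cc_at G t /\ forall u, Cmod (F u - G u) <= e) -> cc_at F t.
Proof.
  intros H; apply cc_at_eps; intros e He.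
  destruct (H (e / 3) ltac:(lra)) as [G [HG HFG]].
  destruct (proj2 (cc_at_eps G t) HG (e / 3) ltac:(lra)) as [d [Hd Hd']].
  exists d; split; [assumption|]; intros u Hu.
  pose proof (Cmod_triangle_3 (F u) (G u) (F t)).
  pose proof (Cmod_triangle_3 (G u) (G t) (F t)).
  pose proof (HFG u); pose proof (HFG t) as HFt; rewrite Cmod_minus_sym in HFt.
  specialize (Hd' u Hu); lra.
Qed.

(** Transfers mean values from finite trigonometric sums to uniform limits. *)
Lemma mean_lim_uniform (F : R -> C) (c : C) :
  (forall e, 0 < e -> exists G d, mean_lim G d /\
     (forall t, Cmod (F t - G t) <= e) /\ Cmod (d - c) <= e) ->
  mean_lim F c.
Proof.
  intros H.
  assert (HF : forall t, cc_at F t).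
  { intros t; apply cc_at_uniform; intros e He.
    destruct (H e He) as [G [d [[HG _] [HFG _]]]]; exists G; auto. }
  split; [assumption|]. intros e He.
  destruct (H (e / 3) ltac:(lra)) as [G [d [[HG HT] [HFG Hd]]]].
  destruct (HT (e / 3) ltac:(lra)) as [T0 [HT0 HT']].
  exists T0; split; [assumption|]; intros T HTT.
  specialize (HT' T HTT).
  assert (E : Cmod (mean T F - mean T G) <= e / 3).
  { replace (mean T F - mean T G)%C with (mean T (fun t => F t + (-1) * G t))%C.
    - apply Cmod_mean_le; [lra| |].
      + intros t; apply cc_at_plus; [auto|apply cc_at_mult; [apply cc_at_const|auto]].
      + intros t; replace (F t + (-1) * G t)%C with (F t - G t)%C by ring; auto.
    - rewrite mean_plus, mean_scal; auto; try lra; [ring|].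
      intros t; apply cc_at_mult; [apply cc_at_const|auto]. }
  pose proof (Cmod_triangle_3 (mean T F) (mean T G) c).
  pose proof (Cmod_triangle_3 (mean T G) d c). lra.
Qed.

Lemma mean_lim_bound (F : R -> C) (c : C) (B : R) :
  mean_lim F c -> (forall t, Cmod (F t) <= B) -> Cmod c <= B.
Proof.
  intros [HF H] HB; apply Rnot_lt_le; intros Hlt.
  destruct (H ((Cmod c - B) / 2) ltac:(lra)) as [T [HT HT']].
  specialize (HT' T ltac:(lra)).
  pose proof (Cmod_mean_le T B F HT HF HB).
  rewrite Cmod_minus_sym in HT'.
  pose proof (Cmod_triangle (c - mean T F) (mean T F)) as Tr.
  replace (c - mean T F + mean T F)%C with c in Tr by ring. lra.
Qed.

Lemma mean_lim_Re_nonneg (F : R -> C) (c : C) :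
  mean_lim F c -> (forall t, 0 <= Re (F t)) -> 0 <= Re c.
Proof.
  intros [HF H] HB; apply Rnot_lt_le; intros Hlt.
  destruct (H (- Re c / 2) ltac:(lra)) as [T [HT HT']].
  specialize (HT' T ltac:(lra)).
  assert (0 <= Re (mean T F)).
  { unfold mean. rewrite re_scal_l. apply Rmult_le_pos; [apply Rlt_le, Rinv_0_lt_compat; lra|].
    replace 0 with (Re (CInt (fun _ => 0%C) (- T) T)) by (rewrite CInt_const; simpl; ring).
    apply Re_CInt_le; [lra| | |]; auto. apply cc_on_all; intros; apply cc_at_const. }
  pose proof (re_le_Cmod (mean T F - c)%C) as Tr. 
  change (Re (mean T F - c)%C) with (Re (mean T F) - Re c) in Tr.
  pose proof (Rle_abs (Re (mean T F) - Re c)). lra.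
Qed.

Lemma mean_lim_unique (F : R -> C) (c d : C) : mean_lim F c -> mean_lim F d -> c = d.
Proof.
  intros H H'.
  assert (E : mean_lim (fun _ => 0%C) (c + (-1) * d)%C).
  { apply mean_lim_ext with (fun t => F t + (-1) * F t)%C; [intros; ring|].
    apply mean_lim_plus; [assumption|apply mean_lim_scal, H']. }
  apply (fun h => mean_lim_bound _ _ 0 h) in E; [|intros; rewrite Cmod_0; lra].
  assert (E0 : (c + (-1) * d = 0)%C).
  { apply Cmod_eq_0, Rle_antisym; [assumption|apply Cmod_ge_0]. }
  replace c with ((c + (-1) * d) + d)%C by ring. rewrite E0; ring.
Qed.

Definition char (l t : R) : C := (cos (l * t), sin (l * t)).

Lemma char_Cexp (l t : R) : char l t = Cexp (0, l * t).
Proof. unfold char, Cexp; simpl; rewrite exp_0; f_equal; ring. Qed.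

Lemma Cmod_char (l t : R) : Cmod (char l t) = 1.
Proof. rewrite char_Cexp, Cmod_Cexp; simpl; apply exp_0. Qed.

Lemma cc_at_char (l t : R) : cc_at (char l) t.
Proof.
  split; simpl;
  apply (ex_derive_continuous (K := R_AbsRing) (V := R_NormedModule)); auto_derive; auto.
Qed.

Lemma CInt_char (l T : R) : l <> 0 -> CInt (char l) (- T) T = RtoC (2 * sin (l * T) / l).
Proof.
  intros Hl; unfold CInt; simpl.
  assert (H1 : is_RInt (fun t => cos (l * t)) (- T) T
            (minus (sin (l * T) / l) (sin (l * - T) / l))).
  { apply (is_RInt_derive (V := R_CompleteNormedModule) (fun t => sin (l * t) / l)).
    - intros; auto_derive; [auto|field; auto].
    - intros x _; apply (proj1 (cc_at_char l x)). }
  assert (H2 : is_RInt (fun t => sin (l * t)) (- T) T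
            (minus (- cos (l * T) / l) (- cos (l * - T) / l))).
  { apply (is_RInt_derive (V := R_CompleteNormedModule) (fun t => - cos (l * t) / l)).
    - intros; auto_derive; [auto|field; auto].
    - intros x _; apply (proj2 (cc_at_char l x)). }
  rewrite (is_RInt_unique _ _ _ _ H1), (is_RInt_unique _ _ _ _ H2).
  unfold minus, plus, opp; simpl.
  replace (l * - T) with (- (l * T)) by ring. rewrite sin_neg, cos_neg.
  apply C_eq; simpl; field; auto.
Qed.

(** The integrals of a nontrivial character stay bounded. *)
Lemma mean_lim_char (l : R) : l <> 0 -> mean_lim (char l) 0%C.
Proof.
  intros Hl; split; [apply cc_at_char|]; intros e He.
  assert (Ha : 0 < Rabs l) by (apply Rabs_pos_lt; auto).
  exists (/ (Rabs l * e)); split; [apply Rinv_0_lt_compat, Rmult_lt_0_compat; auto|].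
  intros T HT.
  assert (HT0 : 0 < T)
    by (eapply Rlt_le_trans; [|apply HT]; apply Rinv_0_lt_compat, Rmult_lt_0_compat; auto).
  unfold mean; rewrite CInt_char, <- RtoC_mult by assumption.
  replace (RtoC (/ (2 * T) * (2 * sin (l * T) / l)) - 0)%C
    with (RtoC (sin (l * T) * / (l * T))).
  2:{ replace (/ (2 * T) * (2 * sin (l * T) / l)) with (sin (l * T) * / (l * T))
        by (field; split; auto; lra). ring. }
  rewrite Cmod_R, Rabs_mult, Rabs_inv, Rabs_mult, (Rabs_pos_eq T) by lra.
  assert (Rabs (sin (l * T)) <= 1) by (apply Rabs_le, SIN_bound).
  apply Rmult_le_reg_r with (Rabs l * T); [apply Rmult_lt_0_compat; auto|].
  rewrite Rmult_assoc, Rinv_l, Rmult_1_r by (apply Rgt_not_eq, Rmult_lt_0_compat; auto).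
  assert (1 <= (Rabs l * e) * T).
  { rewrite <- (Rinv_r (Rabs l * e)).
    - apply Rmult_le_compat_l; [apply Rlt_le, Rmult_lt_0_compat|]; auto.
    - apply Rgt_not_eq, Rmult_lt_0_compat; auto. }
  lra.
Qed.

Lemma char_0 (t : R) : char 0 t = 1%C.
Proof. unfold char; rewrite Rmult_0_l, cos_0, sin_0; reflexivity. Qed.

(** * Coefficients of Dirichlet series as mean values *)

Lemma npow_line (n : nat) (x t : R) : npow n (x, t) = (RtoC (rpow n x) * char (- freq n) t)%C.
Proof.
  rewrite npow_Cexp, char_Cexp.
  replace (RtoC (rpow n x)) with (Cexp (RtoC (- (x * freq n)))).
  - rewrite <- Cexp_plus; f_equal; apply C_eq; simpl; ring.
  - unfold Cexp, rpow; apply C_eq; simpl; rewrite ?cos_0, ?sin_0; ring.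
Qed.

(** On a vertical line of absolute convergence, the product by (m+1)^s is a
    uniform limit of sums of characters, whose only non-oscillating term is
    the m-th one. *)
Lemma mean_lim_coeff (a : nat -> C) (x : R) (f : C -> C) (m : nat) :
  summable (fun n => Cmod (a n) * rpow n x) ->
  (forall t, cseries (dirichlet_term a (x, t)) (f (x, t))) ->
  mean_lim (fun t => f (x, t) * npow m (- (x, t)))%C (a m).
Proof.
  intros Hs Hf; apply mean_lim_uniform; intros e He.
  assert (Hr : 0 < rpow m (- x)) by apply rpow_pos.
  destruct (summable_tail _ (fun n => abs_term_nonneg (a n) n x)
              Hs (e / rpow m (- x))) as [K0 HK0]; [apply Rdiv_lt_0_compat; auto|].
  assert (Hmod : forall s n, Re s = x -> Cmod (dirichlet_term a s n) = Cmod (a n) * rpow n x).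
  { intros s n <-; unfold dirichlet_term; rewrite Cmod_mult; f_equal. apply Cmod_npow. }
  exists (fun t => csum (fun n => a n * (npow n (x, t) * npow m (- (x, t))))%C (K0 + S m)), (a m).
  split; [|split].
  - assert (E : csum (fun n => a n * (if Nat.eq_dec n m then 1 else 0))%C (K0 + S m) = a m).
    { apply csum_select; lia. }
    rewrite <- E at 1.
    apply mean_lim_csum; intros n Hn; apply mean_lim_scal.
    apply mean_lim_ext with
        (fun t => RtoC (rpow n x * rpow m (- x)) * char (freq m - freq n) t)%C.
    + intros t. rewrite npow_line.
        replace (npow m (- (x, t))) with (RtoC (rpow m (- x)) * char (freq m) t)%C.
        2:{ replace (- (x, t))%C with (- x, - t) by reflexivity. rewrite npow_line. f_equal.
            rewrite !char_Cexp; f_equal; apply C_eq; simpl; ring. }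
        rewrite RtoC_mult. unfold Rminus.
        replace (char (freq m + - freq n) t) with (char (freq m) t * char (- freq n) t)%C; [ring|].
        rewrite !char_Cexp, <- Cexp_plus; f_equal; apply C_eq; simpl; ring.
    + destruct (Nat.eq_dec n m) as [->|Hnm].
        -- apply mean_lim_ext with (fun _ => 1%C); [|apply mean_lim_const].
           intros t. unfold Rminus; rewrite Rplus_opp_r, char_0, <- rpow_plus, Rplus_opp_r, rpow_0.
           ring.
        -- replace (RtoC 0) with (RtoC (rpow n x * rpow m (- x)) * 0)%C by ring.
           apply mean_lim_scal, mean_lim_char.
           intros Ef; apply Hnm, freq_inj; lra.
  - intros t.
    replace (f (x, t) * npow m (- (x, t))
             - csum (fun n => a n * (npow n (x, t) * npow m (- (x, t)))) (K0 + S m))%C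
      with (npow m (- (x, t)) * (f (x, t) - csum (dirichlet_term a (x, t)) (K0 + S m)))%C.
    2:{ rewrite (csum_ext (fun n => a n * (npow n (x, t) * npow m (- (x, t))))%C
          (fun n => npow m (- (x, t)) * dirichlet_term a (x, t) n)%C).
        - rewrite csum_scal; ring.
        - intros n _; unfold dirichlet_term; fold (npow n (x, t)); ring. }
    rewrite Cmod_mult, Cmod_npow. simpl Re.
    replace e with (rpow m (- x) * (e / rpow m (- x))) by (field; lra).
    apply Rmult_le_compat_l; [lra|].
    apply cseries_tail_le; [apply Hf|]. intros N HN.
    rewrite !(rsum_ext (fun n => Cmod (dirichlet_term a (x, t) n)) (fun n => Cmod (a n) * rpow n x)) by (intros; apply Hmod; reflexivity).
    specialize (HK0 N ltac:(lia)).
    pose proof (rsum_mono (fun n => Cmod (a n) * rpow n x) K0 (K0 + S m)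
      (fun n => abs_term_nonneg (a n) n x) ltac:(lia)).
    lra.
  - replace (a m - a m)%C with (RtoC 0) by ring. rewrite Cmod_0; lra.
Qed.

Lemma dirichlet_coeff_unique (a b : nat -> C) (x : R) (f : C -> C) :
  summable (fun n => Cmod (a n) * rpow n x) ->
  summable (fun n => Cmod (b n) * rpow n x) ->
  (forall t, cseries (dirichlet_term a (x, t)) (f (x, t))) ->
  (forall t, cseries (dirichlet_term b (x, t)) (f (x, t))) ->
  forall n, a n = b n.
Proof.
  intros Ha Hb Hfa Hfb n.
  eapply mean_lim_unique; [apply (mean_lim_coeff a x f n)|apply (mean_lim_coeff b x f n)];
  assumption.
Qed.

(** * Taylor's formula for the exponential *)

Lemma Cpow_S (z : C) (k : nat) : (z ^ S k = z * z ^ k)%C.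
Proof. reflexivity. Qed.

Lemma Derive_n_Re_Cexp (v z : C) (k : nat) (t : R) :
  ex_derive_n (fun t => Re (v * Cexp (RtoC t * z))%C) k t /\
  Derive_n (fun t => Re (v * Cexp (RtoC t * z))%C) k t
  = Re (v * z ^ k * Cexp (RtoC t * z))%C.
Proof.
  assert (D : forall w t, is_derive (fun t => Re (w * Cexp (RtoC t * z))%C) t
                 (Re (w * z * Cexp (RtoC t * z))%C)).
  { intros [w1 w2] u; destruct z as [x y]; simpl. auto_derive; [auto|].
    unfold Rminus. ring. }
  assert (E : forall k t, Derive_n (fun t => Re (v * Cexp (RtoC t * z))%C) k t
                          = Re (v * z ^ k * Cexp (RtoC t * z))%C).
  { induction k0 as [|k0 IH]; intros u; [replace (v * z ^ 0)%C with v by (simpl; ring); reflexivity|].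
    simpl Derive_n. rewrite (Derive_ext _ _ _ IH).
    rewrite Cpow_S. replace (v * (z * z ^ k0))%C with (v * z ^ k0 * z)%C by ring.
    apply is_derive_unique, D. }
  split; [|apply E].
  destruct k as [|k]; [exact I|]. simpl.
  apply ex_derive_ext with (fun t => Re (v * z ^ k * Cexp (RtoC t * z))%C).
  - intros u; symmetry; apply E.
  - eexists; apply D.
Qed.

Definition exp_term (z : C) (k : nat) : C := (RtoC (/ INR (fact k)) * z ^ k)%C.

Lemma sum_f_R0_rsum (f : nat -> R) (n : nat) : sum_f_R0 f n = rsum f (S n).
Proof. induction n as [|n IH]; simpl in *; [ring|rewrite IH; ring]. Qed.

Lemma exp_le_exp (x y : R) : x <= y -> exp x <= exp y.
Proof. intros [H| ->]; [apply Rlt_le, exp_increasing, H|lra]. Qed.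

(** Lagrange's remainder for the real functions [Re (v Cexp (t z))], with [v]
    the conjugate of the remainder itself. *)
Lemma Cexp_taylor (z : C) (J : nat) :
  Cmod (Cexp z - csum (exp_term z) J) <= Cmod z ^ J / INR (fact J) * exp (Cmod z).
Proof.
  pose proof (Cmod_ge_0 z) as Hz0.
  assert (Hexp : forall t, 0 <= t <= 1 -> Cmod (Cexp (RtoC t * z)) <= exp (Cmod z)).
  { intros t Ht; rewrite Cmod_Cexp; apply exp_le_exp.
    replace (Re (RtoC t * z)) with (t * Re z) by (destruct z; simpl; ring).
    pose proof (re_le_Cmod z); pose proof (Rle_abs (Re z)).
    destruct (Rle_dec 0 (Re z)); nra. }
  destruct J as [|n].
  { simpl. replace (Cexp z - 0)%C with (Cexp (RtoC 1 * z))
      by (replace (RtoC 1 * z)%C with z by ring; ring).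
    eapply Rle_trans; [apply Hexp; lra|]. right; field. }
  set (w := (Cexp z - csum (exp_term z) (S n))%C). set (v := Cconj w).
  destruct (Taylor_Lagrange (fun t => Re (v * Cexp (RtoC t * z))%C) n 0 1 Rlt_0_1) as [u [Hu E]].
  { intros t _ k _; apply Derive_n_Re_Cexp. }
  rewrite sum_f_R0_rsum in E.
  rewrite (proj2 (Derive_n_Re_Cexp v z (S n) u)) in E.
  replace (RtoC 1 * z)%C with z in E by ring.
  rewrite (rsum_ext _ (fun m => Re (v * exp_term z m)%C)) in E.
  2:{ intros m _. rewrite (proj2 (Derive_n_Re_Cexp v z m 0)).
      replace (RtoC 0 * z)%C with (RtoC 0) by ring. rewrite Cexp_0.
      replace (v * z ^ m * 1)%C with (v * z ^ m)%C by ring.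
      unfold exp_term. replace (v * (RtoC (/ INR (fact m)) * z ^ m))%C
        with (RtoC (/ INR (fact m)) * (v * z ^ m))%C by ring.
      rewrite re_scal_l. replace (1 - 0) with 1 by ring. rewrite pow1. unfold Rdiv; ring. }
  rewrite <- Re_csum, csum_scal in E.
  assert (Hw : Cmod w ^ 2 <= Cmod w * (Cmod z ^ S n / INR (fact (S n)) * exp (Cmod z))).
  { rewrite <- Re_Cconj_mult. fold v.
    replace (v * w)%C with (v * Cexp z - v * csum (exp_term z) (S n))%C by (unfold w; ring).
    change (Re (v * Cexp z - v * csum (exp_term z) (S n)))
      with (Re (v * Cexp z) - Re (v * csum (exp_term z) (S n))).
    rewrite E. replace (1 - 0) with 1 by ring. rewrite pow1.
    assert (Re (v * z ^ S n * Cexp (RtoC u * z)) <= Cmod w * Cmod z ^ S n * exp (Cmod z)).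
    { eapply Rle_trans; [eapply Rle_trans; [apply Rle_abs|apply re_le_Cmod]|].
      rewrite !Cmod_mult, Cmod_pow. unfold v; rewrite Cmod_conj.
      apply Rmult_le_compat_l; [|apply Hexp; lra].
      apply Rmult_le_pos; [apply Cmod_ge_0|apply pow_le, Hz0]. }
    pose proof (INR_fact_lt_0 (S n)) as Hf.
    apply Rmult_le_reg_l with (INR (fact (S n))); [assumption|].
    field_simplify; lra. }
  destruct (Rle_lt_or_eq_dec 0 (Cmod w) (Cmod_ge_0 w)) as [Hp|He].
  - apply Rmult_le_reg_l with (Cmod w); [assumption|]. simpl in Hw |- *; lra.
  - rewrite <- He. apply Rmult_le_pos; [|apply Rlt_le, exp_pos].
    apply Rmult_le_pos; [apply pow_le, Hz0|]. apply Rlt_le, Rinv_0_lt_compat, INR_fact_lt_0.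
Qed.

(** * Complex derivatives *)

Definition cdiff (f : C -> C) (s l : C) : Prop :=
  forall e, 0 < e -> exists d, 0 < d /\ forall z, Cmod (z - s) < d ->
    Cmod (f z - f s - l * (z - s)) <= e * Cmod (z - s).

(** [C_NormedModule] and the normed module underlying [C_AbsRing] carry different
    uniform structures but the same norm, and the derivative only sees the norm. *)
Lemma cdiff_is_derive (f : C -> C) (s l : C) :
  (cdiff f s l <-> @is_derive C_AbsRing C_NormedModule f s l) /\
  (cdiff f s l <-> @is_derive C_AbsRing (AbsRing_NormedModule C_AbsRing) f s l).
Proof.
  split; (split;
  [ intros H; split; [apply is_linear_scal_l|];
    intros x Hx e;
    apply (is_filter_lim_locally_unique (V := AbsRing_NormedModule C_AbsRing) s x) in Hx;
    rewrite <- Hx; destruct (H e (cond_pos e)) as [d [Hd Hd']];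
    exists (mkposreal d Hd); intros z Hz; specialize (Hd' z Hz);
    rewrite Cmult_comm in Hd'; exact Hd'
  | intros [_ H] e He; destruct (H s (fun P h => h) (mkposreal e He)) as [d Hd];
    exists d; split; [apply cond_pos|]; intros z Hz;
    specialize (Hd z Hz); rewrite Cmult_comm; exact Hd ]).
Qed.

Lemma ex_derive_cdiff (f : C -> C) (s : C) :
  @ex_derive C_AbsRing C_NormedModule f s <-> exists l, cdiff f s l.
Proof. split; intros [l H]; exists l; apply (proj1 (cdiff_is_derive f s l)), H. Qed.

Lemma cdiff_mult (f g : C -> C) (s l k : C) :
  cdiff f s l -> cdiff g s k -> cdiff (fun z => f z * g z)%C s (l * g s + f s * k)%C.
Proof.
  intros Hf Hg; apply (proj2 (cdiff_is_derive _ _ _)); apply (proj2 (cdiff_is_derive _ _ _)) in Hf, Hg.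
  apply (is_derive_mult f g s l k Hf Hg Cmult_comm).
Qed.

Lemma cdiff_plus (f g : C -> C) (s l k : C) :
  cdiff f s l -> cdiff g s k -> cdiff (fun z => f z + g z)%C s (l + k)%C.
Proof.
  intros Hf Hg; apply (proj2 (cdiff_is_derive _ _ _)); apply (proj2 (cdiff_is_derive _ _ _)) in Hf, Hg.
  apply (is_derive_plus (V := AbsRing_NormedModule C_AbsRing) f g s l k Hf Hg).
Qed.

Lemma cdiff_comp (f g : C -> C) (s l k : C) :
  cdiff f (g s) l -> cdiff g s k -> cdiff (fun z => f (g z)) s (k * l)%C.
Proof.
  intros Hf Hg; apply (proj2 (cdiff_is_derive _ _ _)); apply (proj2 (cdiff_is_derive _ _ _)) in Hf, Hg.
  apply (is_derive_comp (V := AbsRing_NormedModule C_AbsRing) f g s l k Hf Hg).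
Qed.

Lemma cdiff_const (c s : C) : cdiff (fun _ => c) s 0%C.
Proof.
  intros e He; exists 1; split; [lra|]; intros z _.
  replace (c - c - 0 * (z - s))%C with (RtoC 0) by ring. rewrite Cmod_0.
  apply Rmult_le_pos; [lra|apply Cmod_ge_0].
Qed.

Lemma cdiff_id (s : C) : cdiff (fun z => z) s 1%C.
Proof.
  intros e He; exists 1; split; [lra|]; intros z _.
  replace (z - s - 1 * (z - s))%C with (RtoC 0) by ring. rewrite Cmod_0.
  apply Rmult_le_pos; [lra|apply Cmod_ge_0].
Qed.

Lemma cdiff_Cexp (s : C) : cdiff Cexp s (Cexp s).
Proof.
  intros e He.
  set (K := exp (Re s) * exp 1). assert (HK : 0 < K) by (apply Rmult_lt_0_compat; apply exp_pos).
  exists (Rmin 1 (e / K)); split; [apply Rmin_pos; [lra|apply Rdiv_lt_0_compat; lra]|].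
  intros z Hz.
  assert (Hz1 : Cmod (z - s) < 1) by (eapply Rlt_le_trans; [apply Hz|apply Rmin_l]).
  assert (Hz2 : Cmod (z - s) < e / K) by (eapply Rlt_le_trans; [apply Hz|apply Rmin_r]).
  pose proof (Cmod_ge_0 (z - s)) as H0.
  replace (Cexp z - Cexp s - Cexp s * (z - s))%C
    with (Cexp s * (Cexp (z - s) - csum (exp_term (z - s)) 2))%C.
  2:{ unfold exp_term; simpl. rewrite Rinv_1.
      replace (Cexp z) with (Cexp s * Cexp (z - s))%C
        by (rewrite <- Cexp_plus; f_equal; ring). ring. }
  rewrite Cmod_mult, Cmod_Cexp.
  pose proof (Cexp_taylor (z - s) 2) as T. simpl in T.
  pose proof (exp_le_exp (Cmod (z - s)) 1 ltac:(lra)) as Ex.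
  pose proof (exp_pos (Re s)); pose proof (exp_pos (Cmod (z - s))).
  set (r := Cmod (z - s)) in *.
  assert (T' : r * (r * 1) / (1 + 1) * exp r <= r * r * exp 1).
  { apply Rle_trans with (r * r * exp r); [|apply Rmult_le_compat_l; [nra|assumption]].
    apply Rmult_le_compat_r; [lra|]. nra. }
  apply Rle_trans with (exp (Re s) * (r * r * exp 1)).
  - apply Rmult_le_compat_l; [lra|]. eapply Rle_trans; [apply T|assumption].
  - replace (exp (Re s) * (r * r * exp 1)) with (K * r * r) by (unfold K; ring).
    apply Rmult_le_compat_r; [assumption|].
    apply Rle_trans with (K * (e / K)); [apply Rmult_le_compat_l; lra|right; field; lra].
Qed.

Lemma cdiff_continuous (f : C -> C) (s l : C) : cdiff f s l ->
  forall e, 0 < e -> exists d, 0 < d /\ forall z, Cmod (z - s) < d -> Cmod (f z - f s) <= e.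
Proof.
  intros H e He. pose proof (Cmod_ge_0 l) as Hl.
  destruct (H 1 Rlt_0_1) as [d [Hd Hd']].
  exists (Rmin d (e / (Cmod l + 1))); split.
  { apply Rmin_pos; [assumption|apply Rdiv_lt_0_compat; lra]. }
  intros z Hz.
  specialize (Hd' z (Rlt_le_trans _ _ _ Hz (Rmin_l _ _))).
  assert (Hz2 : Cmod (z - s) < e / (Cmod l + 1)) by (eapply Rlt_le_trans; [apply Hz|apply Rmin_r]).
  replace (f z - f s)%C with ((f z - f s - l * (z - s)) + l * (z - s))%C by ring.
  eapply Rle_trans; [apply Cmod_triangle|]. rewrite Cmod_mult.
  apply Rle_trans with ((Cmod l + 1) * Cmod (z - s)); [lra|].
  apply Rle_trans with ((Cmod l + 1) * (e / (Cmod l + 1))); [|right; field; lra].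
  apply Rmult_le_compat_l; lra.
Qed.

Lemma Cmod_horizontal (x x' y : R) : Cmod ((x, y) - (x', y)) = Rabs (x - x').
Proof.
  replace ((x, y) - (x', y))%C with (RtoC (x - x')) by (apply C_eq; simpl; ring).
  apply Cmod_R.
Qed.

Lemma Cmod_vertical (x y y' : R) : Cmod ((x, y) - (x, y')) = Rabs (y - y').
Proof.
  replace ((x, y) - (x, y'))%C with (Ci * RtoC (y - y'))%C by (apply C_eq; simpl; ring).
  rewrite Cmod_mult, Cmod_Ci, Cmod_R; ring.
Qed.

Lemma cc_at_horizontal (f : C -> C) (x y : R) (l : C) :
  cdiff f (x, y) l -> cc_at (fun x => f (x, y)) x.
Proof.
  intros H; apply cc_at_eps; intros e He.
  destruct (cdiff_continuous f _ l H e He) as [d [Hd Hd']]; exists d; split; [assumption|].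
  intros u Hu; apply Hd'. rewrite Cmod_horizontal; assumption.
Qed.

Lemma cc_at_vertical (f : C -> C) (x y : R) (l : C) :
  cdiff f (x, y) l -> cc_at (fun y => f (x, y)) y.
Proof.
  intros H; apply cc_at_eps; intros e He.
  destruct (cdiff_continuous f _ l H e He) as [d [Hd Hd']]; exists d; split; [assumption|].
  intros u Hu; apply Hd'. rewrite Cmod_vertical; assumption.
Qed.

(** * Goursat's theorem for rectangles *)

Definition boundary (f : C -> C) (a b c d : R) : C :=
  (CInt (fun x => f (x, c)) a b - CInt (fun x => f (x, d)) a b
   + Ci * (CInt (fun y => f (b, y)) c d - CInt (fun y => f (a, y)) c d))%C.

Definition in_rect (a b c d : R) (z : C) : Prop := a <= Re z <= b /\ c <= Im z <= d.

Definition diff_on_rect (f : C -> C) (a b c d : R) : Prop :=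
  forall z, in_rect a b c d z -> exists l, cdiff f z l.

Lemma diff_on_rect_sub (f : C -> C) (a b c d a' b' c' d' : R) :
  a <= a' -> b' <= b -> c <= c' -> d' <= d ->
  diff_on_rect f a b c d -> diff_on_rect f a' b' c' d'.
Proof. intros; intros z [H4 H5]; apply H3; split; lra. Qed.

Lemma cc_on_horizontal (f : C -> C) (a b c d y : R) :
  diff_on_rect f a b c d -> c <= y <= d -> cc_on (fun x => f (x, y)) a b.
Proof.
  intros H Hy x Hx. destruct (H (x, y)) as [l Hl]; [split; simpl; lra|].
  apply cc_at_horizontal with l, Hl.
Qed.

Lemma cc_on_vertical (f : C -> C) (a b c d x : R) :
  diff_on_rect f a b c d -> a <= x <= b -> cc_on (fun y => f (x, y)) c d.
Proof.
  intros H Hx y Hy. destruct (H (x, y)) as [l Hl]; [split; simpl; lra|].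
  apply cc_at_vertical with l, Hl.
Qed.

Lemma boundary_plus (f g : C -> C) (a b c d : R) : a <= b -> c <= d ->
  diff_on_rect f a b c d -> diff_on_rect g a b c d ->
  boundary (fun z => f z + g z)%C a b c d = (boundary f a b c d + boundary g a b c d)%C.
Proof.
  intros Hab Hcd Hf Hg; unfold boundary.
  rewrite !CInt_plus; try assumption;
  try (eapply cc_on_horizontal; [eassumption|lra]);
  try (eapply cc_on_vertical; [eassumption|lra]). ring.
Qed.

Lemma CInt_coord (a b k : R) :
  CInt (fun x => (x, k)) a b = ((b ^ 2 - a ^ 2) / 2, k * (b - a)) /\
  CInt (fun x => (k, x)) a b = (k * (b - a), (b ^ 2 - a ^ 2) / 2).
Proof.
  assert (H : RInt (fun x => x) a b = (b ^ 2 - a ^ 2) / 2).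
  { apply is_RInt_unique.
    replace ((b ^ 2 - a ^ 2) / 2) with (minus (b ^ 2 / 2) (a ^ 2 / 2))
      by (unfold minus, plus, opp; simpl; field).
    apply (is_RInt_derive (V := R_CompleteNormedModule) (fun x => x ^ 2 / 2)).
    - intros; auto_derive; [auto|field].
    - intros; apply continuous_id. }
  assert (H' : RInt (fun _ : R => k) a b = k * (b - a))
    by (rewrite RInt_const; unfold scal; simpl; unfold mult; simpl; ring).
  unfold CInt; simpl. rewrite H, H'; auto.
Qed.

Lemma boundary_affine (k l : C) (a b c d : R) : a <= b -> c <= d ->
  boundary (fun z => k + l * z)%C a b c d = 0%C.
Proof.
  intros Hab Hcd.
  assert (Did : diff_on_rect (fun z => z) a b c d) by (intros z _; eexists; apply cdiff_id).
  assert (Dc : forall q, diff_on_rect (fun _ => q) a b c d) by (intros q z _; eexists; apply cdiff_const).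
  assert (Dl : diff_on_rect (fun z => l * z)%C a b c d)
    by (intros z _; eexists; apply (cdiff_mult (fun _ => l) (fun z => z));
        [apply cdiff_const|apply cdiff_id]).
  rewrite (boundary_plus (fun _ => k) (fun z => l * z)%C) by auto.
  unfold boundary. rewrite !CInt_const.
  rewrite !CInt_scal; try assumption;
  try (eapply (cc_on_horizontal (fun z => z)); [eassumption|lra]);
  try (eapply (cc_on_vertical (fun z => z)); [eassumption|lra]).
  rewrite !(proj1 (CInt_coord _ _ _)), !(proj2 (CInt_coord _ _ _)).
  destruct k, l; apply C_eq; simpl; field.
Qed.

Lemma Cmod_boundary_le (f : C -> C) (a b c d M : R) : a <= b -> c <= d ->
  diff_on_rect f a b c d -> (forall z, in_rect a b c d z -> Cmod (f z) <= M) ->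
  Cmod (boundary f a b c d) <= 2 * ((b - a) + (d - c)) * M.
Proof.
  intros Hab Hcd Hf HM; unfold boundary.
  assert (H1 : forall y, c <= y <= d -> Cmod (CInt (fun x => f (x, y)) a b) <= (b - a) * M).
  { intros y Hy; apply Cmod_CInt_le; [assumption|eapply cc_on_horizontal; eassumption|].
    intros t Ht; apply HM; split; simpl; lra. }
  assert (H2 : forall x, a <= x <= b -> Cmod (CInt (fun y => f (x, y)) c d) <= (d - c) * M).
  { intros x Hx; apply Cmod_CInt_le; [assumption|eapply cc_on_vertical; eassumption|].
    intros t Ht; apply HM; split; simpl; lra. }
  eapply Rle_trans; [apply Cmod_triangle|]. rewrite Cmod_mult, Cmod_Ci.
  unfold Cminus.
  pose proof (Cmod_triangle (CInt (fun x => f (x, c)) a b) (- CInt (fun x => f (x, d)) a b)) as T1.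
  pose proof (Cmod_triangle (CInt (fun y => f (b, y)) c d) (- CInt (fun y => f (a, y)) c d)) as T2.
  rewrite Cmod_opp in T1, T2.
  pose proof (H1 c ltac:(lra)); pose proof (H1 d ltac:(lra)).
  pose proof (H2 a ltac:(lra)); pose proof (H2 b ltac:(lra)). lra.
Qed.

Lemma boundary_quarters (f : C -> C) (a b c d m n : R) :
  a <= m <= b -> c <= n <= d -> diff_on_rect f a b c d ->
  boundary f a b c d = (boundary f a m c n + boundary f m b c n
                        + (boundary f a m n d + boundary f m b n d))%C.
Proof.
  intros Hm Hn Hf; unfold boundary.
  rewrite (CInt_Chasles (fun x => f (x, c)) a m b); try lra;
    [|eapply cc_on_horizontal; [eassumption|lra]].
  rewrite (CInt_Chasles (fun x => f (x, d)) a m b); try lra;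
    [|eapply cc_on_horizontal; [eassumption|lra]].
  rewrite (CInt_Chasles (fun y => f (a, y)) c n d); try lra;
    [|eapply cc_on_vertical; [eassumption|lra]].
  rewrite (CInt_Chasles (fun y => f (b, y)) c n d); try lra;
    [|eapply cc_on_vertical; [eassumption|lra]].
  ring.
Qed.

(** Otherwise [P] fails along a sequence of nested quarters, which shrinks to a
    point and so ends up among the small rectangles around that point. *)
Lemma rect_subdivision (P : R -> R -> R -> R -> Prop) (a b c d : R) :
  a <= b -> c <= d ->
  (forall x1 x2 y1 y2, a <= x1 <= x2 -> x2 <= b -> c <= y1 <= y2 -> y2 <= d ->
     let m := (x1 + x2) / 2 in let n := (y1 + y2) / 2 in
     P x1 m y1 n -> P m x2 y1 n -> P x1 m n y2 -> P m x2 n y2 -> P x1 x2 y1 y2) ->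
  (forall u v, a <= u <= b -> c <= v <= d -> exists e, 0 < e /\
     forall x1 x2 y1 y2, a <= x1 <= u -> u <= x2 <= b -> c <= y1 <= v -> v <= y2 <= d ->
       x2 - x1 < e -> y2 - y1 < e -> P x1 x2 y1 y2) ->
  P a b c d.
Proof.
  intros Hab Hcd Hdiv Hloc. apply NNPP; intros Hneg.
  set (good := fun q : R * R * R * R => let '(x1, x2, y1, y2) := q in
     (a <= x1 <= x2 /\ x2 <= b /\ c <= y1 <= y2 /\ y2 <= d) /\ ~ P x1 x2 y1 y2).
  set (sub := fun q q' : R * R * R * R => let '(x1, x2, y1, y2) := q in
     let '(x1', x2', y1', y2') := q' in
     (x1 <= x1' /\ x2' <= x2 /\ y1 <= y1' /\ y2' <= y2) /\
     x2' - x1' = (x2 - x1) / 2 /\ y2' - y1' = (y2 - y1) / 2).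
  assert (Step : forall q : {q | good q}, exists q' : {q | good q}, sub (proj1_sig q) (proj1_sig q')).
  { intros [[[[x1 x2] y1] y2] [Hin Hn]]; simpl.
    set (m := (x1 + x2) / 2). set (n := (y1 + y2) / 2).
    assert (Hq : ~ P x1 m y1 n \/ ~ P m x2 y1 n \/ ~ P x1 m n y2 \/ ~ P m x2 n y2).
    { apply NNPP; intros Hc; apply Hn, Hdiv; try lra; apply NNPP; intros Hc'; apply Hc; auto. }
    assert (Hmn : x1 <= m <= x2 /\ y1 <= n <= y2) by (unfold m, n; lra).
    destruct Hq as [Hq|[Hq|[Hq|Hq]]].
    - assert (G : good (x1, m, y1, n)) by (split; [lra|assumption]).
      exists (exist _ _ G); simpl; unfold m, n in *; lra.
    - assert (G : good (m, x2, y1, n)) by (split; [lra|assumption]).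
      exists (exist _ _ G); simpl; unfold m, n in *; lra.
    - assert (G : good (x1, m, n, y2)) by (split; [lra|assumption]).
      exists (exist _ _ G); simpl; unfold m, n in *; lra.
    - assert (G : good (m, x2, n, y2)) by (split; [lra|assumption]).
      exists (exist _ _ G); simpl; unfold m, n in *; lra. }
  set (next := fun q => proj1_sig (constructive_indefinite_description _ (Step q))).
  assert (Hnext : forall q, sub (proj1_sig q) (proj1_sig (next q)))
    by (intros q; apply (proj2_sig (constructive_indefinite_description _ (Step q)))).
  assert (G0 : good (a, b, c, d)) by (split; [lra|assumption]).
  set (Q := fun k => Nat.iter k next (exist _ _ G0)).
  set (X1 := fun k => fst (fst (fst (proj1_sig (Q k))))).
  set (X2 := fun k => snd (fst (fst (proj1_sig (Q k))))).
  set (Y1 := fun k => snd (fst (proj1_sig (Q k)))).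
  set (Y2 := fun k => snd (proj1_sig (Q k))).
  assert (HG : forall k, (a <= X1 k <= X2 k /\ X2 k <= b /\ c <= Y1 k <= Y2 k /\ Y2 k <= d)
                         /\ ~ P (X1 k) (X2 k) (Y1 k) (Y2 k)).
  { intros k; unfold X1, X2, Y1, Y2. destruct (Q k) as [[[[x1 x2] y1] y2] Hq]; exact Hq. }
  assert (HS : forall k, (X1 k <= X1 (S k) /\ X2 (S k) <= X2 k /\ Y1 k <= Y1 (S k) /\ Y2 (S k) <= Y2 k)
     /\ X2 (S k) - X1 (S k) = (X2 k - X1 k) / 2 /\ Y2 (S k) - Y1 (S k) = (Y2 k - Y1 k) / 2).
  { intros k; unfold X1, X2, Y1, Y2. change (Q (S k)) with (next (Q k)).
    pose proof (Hnext (Q k)) as Hs.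
    destruct (Q k) as [[[[x1 x2] y1] y2] Hq].
    destruct (next _) as [[[[x1' x2'] y1'] y2'] Hq']; exact Hs. }
  assert (Hmon : forall k j, X1 k <= X1 (k + j)%nat /\ X2 (k + j)%nat <= X2 k /\
                             Y1 k <= Y1 (k + j)%nat /\ Y2 (k + j)%nat <= Y2 k).
  { intros k j; induction j as [|j IH]; [rewrite Nat.add_0_r; lra|].
    rewrite Nat.add_succ_r. pose proof (HS (k + j)%nat); lra. }
  assert (Hsize : forall k, X2 k - X1 k = (b - a) * (/ 2) ^ k /\ Y2 k - Y1 k = (d - c) * (/ 2) ^ k).
  { induction k as [|k IH]; [simpl; unfold X1, X2, Y1, Y2; simpl; lra|].
    destruct (HS k) as [_ [-> ->]]. destruct IH as [-> ->]. simpl; lra. }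
  assert (Hcross : forall k j, X1 k <= X2 j /\ Y1 k <= Y2 j).
  { intros k j; pose proof (Hmon k j); pose proof (Hmon j k) as H'.
    rewrite (Nat.add_comm j k) in H'. pose proof (HG (k + j)%nat). lra. }
  destruct (completeness (fun x => exists k, x = X1 k)) as [u [Hu1 Hu2]].
  { exists b; intros x [k ->]; pose proof (HG k); lra. }
  { exists (X1 0%nat), 0%nat; reflexivity. }
  destruct (completeness (fun y => exists k, y = Y1 k)) as [v [Hv1 Hv2]].
  { exists d; intros y [k ->]; pose proof (HG k); lra. }
  { exists (Y1 0%nat), 0%nat; reflexivity. }
  assert (Hu : forall k, X1 k <= u <= X2 k).
  { intros k; split; [apply Hu1; exists k; reflexivity|].
    apply Hu2; intros x [j ->]; apply Hcross. }
  assert (Hv : forall k, Y1 k <= v <= Y2 k).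
  { intros k; split; [apply Hv1; exists k; reflexivity|].
    apply Hv2; intros x [j ->]; apply Hcross. }
  destruct (Hloc u v) as [e [He Hloc']].
  { pose proof (HG 0%nat); pose proof (Hu 0%nat); lra. }
  { pose proof (HG 0%nat); pose proof (Hv 0%nat); lra. }
  set (L := (b - a) + (d - c) + 1). assert (HL : 0 < L) by (unfold L; lra).
  destruct (pow_lt_1_zero (/ 2)) with (y := e / L) as [k Hk].
  { rewrite Rabs_pos_eq; lra. }
  { apply Rdiv_lt_0_compat; lra. }
  specialize (Hk k (le_n k)).
  assert (Hp : 0 < (/ 2) ^ k) by (apply pow_lt; lra).
  rewrite Rabs_pos_eq in Hk by lra.
  assert (Hk' : L * (/ 2) ^ k < e).
  { replace e with (L * (e / L)) by (field; lra). apply Rmult_lt_compat_l; assumption. }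
  destruct (HG k) as [Hin Hbad]. destruct (Hsize k) as [Sx Sy].
  apply Hbad, Hloc'; try (pose proof (Hu k); pose proof (Hv k); lra).
  - rewrite Sx. eapply Rle_lt_trans; [|apply Hk']. apply Rmult_le_compat_r; unfold L; lra.
  - rewrite Sy. eapply Rle_lt_trans; [|apply Hk']. apply Rmult_le_compat_r; unfold L; lra.
Qed.

Lemma Cmod_le_sum (z : C) : Cmod z <= Rabs (Re z) + Rabs (Im z).
Proof.
  replace z with (RtoC (Re z) + Ci * RtoC (Im z))%C at 1
    by (destruct z; apply C_eq; simpl; ring).
  eapply Rle_trans; [apply Cmod_triangle|]. rewrite Cmod_mult, Cmod_Ci, !Cmod_R; lra.
Qed.

(** Affine functions integrate to zero, so near a point the boundary integral
    is bounded by a small multiple of the square of the perimeter, and the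
    squared perimeter is additive under division into quarters. *)
Lemma goursat (f : C -> C) (a b c d : R) : a <= b -> c <= d ->
  diff_on_rect f a b c d -> boundary f a b c d = 0%C.
Proof.
  intros Hab Hcd Hf.
  assert (Key : forall e, 0 < e -> Cmod (boundary f a b c d) <= e * ((b - a) + (d - c)) ^ 2).
  { intros e He.
    apply (rect_subdivision (fun x1 x2 y1 y2 =>
       Cmod (boundary f x1 x2 y1 y2) <= e * ((x2 - x1) + (y2 - y1)) ^ 2)); try assumption.
    - intros x1 x2 y1 y2 Hx Hxb Hy Hyd m n P1 P2 P3 P4.
      rewrite (boundary_quarters f x1 x2 y1 y2 m n);
        [|unfold m; lra|unfold n; lra|apply (diff_on_rect_sub f a b c d); auto; lra].
      eapply Rle_trans; [apply Cmod_triangle|].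
      pose proof (Cmod_triangle (boundary f x1 m y1 n) (boundary f m x2 y1 n)).
      pose proof (Cmod_triangle (boundary f x1 m n y2) (boundary f m x2 n y2)).
      replace (e * (x2 - x1 + (y2 - y1)) ^ 2) with
        (e * (m - x1 + (n - y1)) ^ 2 + e * (x2 - m + (n - y1)) ^ 2
         + (e * (m - x1 + (y2 - n)) ^ 2 + e * (x2 - m + (y2 - n)) ^ 2))
        by (unfold m, n; field).
      lra.
    - intros u v Hu Hv. destruct (Hf (u, v)) as [l Hl]; [split; simpl; lra|].
      destruct (Hl (e / 2) ltac:(lra)) as [r [Hr Hr']].
      exists (r / 2); split; [lra|]. intros x1 x2 y1 y2 Hx1 Hx2 Hy1 Hy2 Hw Hh.
      set (k := (- (f (u, v) - l * (u, v)))%C).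
      assert (Hsub : diff_on_rect f x1 x2 y1 y2) by (apply (diff_on_rect_sub f a b c d); auto; lra).
      assert (Haff : diff_on_rect (fun z => k + (- l) * z)%C x1 x2 y1 y2).
      { intros z _; eexists. apply cdiff_plus; [apply cdiff_const|].
        apply (cdiff_mult (fun _ => (- l)%C) (fun z => z)); [apply cdiff_const|apply cdiff_id]. }
      replace (boundary f x1 x2 y1 y2)
        with (boundary (fun z => f z + (k + (- l) * z))%C x1 x2 y1 y2).
      2:{ rewrite boundary_plus by (auto; lra). rewrite boundary_affine by lra. ring. }
      eapply Rle_trans; [apply Cmod_boundary_le with (M := e / 2 * ((x2 - x1) + (y2 - y1)))|].
      + lra.
      + lra.
      + intros z Hz. destruct (Hsub z Hz) as [p Hp], (Haff z Hz) as [q Hq].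
        eexists; apply cdiff_plus; eassumption.
      + intros z [Hz1 Hz2].
        assert (Hzd : Cmod (z - (u, v)) <= (x2 - x1) + (y2 - y1)).
        { eapply Rle_trans; [apply Cmod_le_sum|].
          change (Re (z - (u, v))) with (Re z - u). change (Im (z - (u, v))) with (Im z - v).
          apply Rplus_le_compat; apply Rabs_le; lra. }
        replace (f z + (k + - l * z))%C with (f z - f (u, v) - l * (z - (u, v)))%C
          by (unfold k; ring).
        eapply Rle_trans; [apply Hr'; lra|]. apply Rmult_le_compat_l; lra.
      + right; field. }
  apply Cmod_le_small; intros e He.
  set (L := ((b - a) + (d - c)) ^ 2). assert (HL : 0 <= L) by apply pow2_ge_0.
  eapply Rle_trans; [apply (Key (e / (L + 1))); apply Rdiv_lt_0_compat; lra|]. fold L.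
  apply Rle_trans with (e / (L + 1) * (L + 1)); [|right; field; lra].
  apply Rmult_le_compat_l; [apply Rlt_le, Rdiv_lt_0_compat|]; lra.
Qed.

(** * The identity theorem on half-planes *)

Definition diff_at (f : C -> C) (s : C) : Prop := exists l, cdiff f s l.

Lemma diff_at_mult (f g : C -> C) (s : C) :
  diff_at f s -> diff_at g s -> diff_at (fun z => f z * g z)%C s.
Proof. intros [l Hl] [k Hk]; eexists; apply cdiff_mult; eassumption. Qed.

Lemma diff_at_plus (f g : C -> C) (s : C) :
  diff_at f s -> diff_at g s -> diff_at (fun z => f z + g z)%C s.
Proof. intros [l Hl] [k Hk]; eexists; apply cdiff_plus; eassumption. Qed.

Lemma diff_at_const (c s : C) : diff_at (fun _ => c) s.
Proof. eexists; apply cdiff_const. Qed.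

Lemma diff_at_id (s : C) : diff_at (fun z => z) s.
Proof. eexists; apply cdiff_id. Qed.

Lemma diff_at_Cexp (f : C -> C) (s : C) : diff_at f s -> diff_at (fun z => Cexp (f z)) s.
Proof. intros [l Hl]; eexists; apply (cdiff_comp Cexp f); [apply cdiff_Cexp|exact Hl]. Qed.

Lemma diff_at_ext (f g : C -> C) (s : C) : (forall z, f z = g z) -> diff_at f s -> diff_at g s.
Proof.
  intros E [l H]; exists l; intros e He; destruct (H e He) as [d [Hd Hd']].
  exists d; split; [assumption|]; intros z Hz; rewrite <- !E; auto.
Qed.

Lemma diff_at_csum (F : nat -> C -> C) (N : nat) (s : C) :
  (forall n, diff_at (F n) s) -> diff_at (fun z => csum (fun n => F n z) N) s.
Proof.
  intros H; induction N as [|N IH]; [apply (diff_at_const (RtoC 0))|].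
  apply (diff_at_plus (fun z => csum (fun n => F n z) N) (F N)); auto.
Qed.

Lemma diff_at_npow (n : nat) (s : C) : diff_at (npow n) s.
Proof.
  apply diff_at_ext with (fun z => Cexp (RtoC (- freq n) * z)%C).
  - intros z; rewrite npow_Cexp, RtoC_opp; f_equal; ring.
  - apply diff_at_Cexp, (diff_at_mult (fun _ => RtoC (- freq n)) (fun z => z));
    [apply diff_at_const|apply diff_at_id].
Qed.

Lemma diff_at_npow_opp (n : nat) (s : C) : diff_at (fun z => npow n (- z)) s.
Proof.
  apply diff_at_ext with (fun z => Cexp (RtoC (freq n) * z)%C).
  - intros z; rewrite npow_Cexp; f_equal; ring.
  - apply diff_at_Cexp, (diff_at_mult (fun _ => RtoC (freq n)) (fun z => z));
    [apply diff_at_const|apply diff_at_id].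
Qed.

Lemma cc_on_bounded (F : R -> C) (a b : R) : cc_on F a b ->
  exists M, forall t, a <= t <= b -> Cmod (F t) <= M.
Proof.
  intros H.
  destruct (bounded_continuity (V := R_NormedModule) (fun t => Re (F t)) a b) as [M1 H1].
  { intros t Ht; apply (proj1 (H t Ht)). }
  destruct (bounded_continuity (V := R_NormedModule) (fun t => Im (F t)) a b) as [M2 H2].
  { intros t Ht; apply (proj2 (H t Ht)). }
  exists (M1 + M2); intros t Ht. eapply Rle_trans; [apply Cmod_le_sum|].
  specialize (H1 t Ht); specialize (H2 t Ht).
  change (Rabs (Re (F t)) < M1) in H1. change (Rabs (Im (F t)) < M2) in H2. lra.
Qed.

(** Weight [h] by the Gaussian [Cexp (lam (z - z0)^2)] and integrate around a
    rectangle whose left side passes through [z0] and whose right side lies where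
    [h] vanishes.  The horizontal sides are far enough from [z0] for the weight to
    be at most [exp (- lam)] on them, whereas the left side is concentrated
    near [z0] and would have size [|h z0|] times a much larger weight. *)
Lemma half_plane_vanish (h : C -> C) (sg p : R) :
  (forall z, sg < Re z -> diff_at h z) -> (forall z, p < Re z -> h z = 0%C) ->
  forall z, sg < Re z -> h z = 0%C.
Proof.
  intros Hd Hp [x0 y0] Hz; simpl in Hz.
  destruct (Rlt_le_dec p x0) as [Hx|Hx]; [apply Hp, Hx|].
  apply NNPP; intros Hne.
  set (h0 := h (x0, y0)) in *. set (eta := Cmod h0).
  assert (Heta : 0 < eta) by (apply Cmod_gt_0, Hne).
  set (d := p - x0 + 1). set (Y := d + 1).
  assert (Hd0 : 1 <= d) by (unfold d; lra).
  set (x1 := x0 + d). assert (Hx1 : p < x1) by (unfold x1, d; lra).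
  assert (Hr : forall a b c e, x0 <= a -> diff_on_rect h a b c e).
  { intros a b c e Ha z [Hz1 _]; apply Hd; lra. }
  destruct (cc_on_bounded (fun x => h (x, y0 - Y)) x0 x1) as [K1 HK1].
  { apply (cc_on_horizontal h x0 x1 (y0 - Y) (y0 + Y)); [apply Hr; lra|unfold Y; lra]. }
  destruct (cc_on_bounded (fun x => h (x, y0 + Y)) x0 x1) as [K2 HK2].
  { apply (cc_on_horizontal h x0 x1 (y0 - Y) (y0 + Y)); [apply Hr; lra|unfold Y; lra]. }
  assert (Hver : cc_on (fun y => h (x0, y)) (y0 - Y) (y0 + Y)).
  { apply (cc_on_vertical h x0 x1 (y0 - Y) (y0 + Y)); [apply Hr; lra|unfold x1; lra]. }
  destruct (cc_on_bounded _ _ _ Hver) as [K3 HK3].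
  set (K := Rabs K1 + Rabs K2 + Rabs K3).
  assert (HK : 0 <= K /\ K1 <= K /\ K2 <= K /\ K3 <= K).
  { unfold K; pose proof (Rle_abs K1); pose proof (Rle_abs K2); pose proof (Rle_abs K3).
    pose proof (Rabs_pos K1); pose proof (Rabs_pos K2); pose proof (Rabs_pos K3); lra. }
  assert (Hc : cc_at (fun y => h (x0, y)) y0) by (apply Hver; unfold Y; lra).
  destruct (proj2 (cc_at_eps _ _) Hc (eta / 2) ltac:(lra)) as [dl [Hdl Hdl']].
  set (kp := Rmin (dl / 4) (/ 2)).
  assert (Hkp : 0 < kp) by (apply Rmin_pos; lra).
  assert (Hkp1 : kp <= dl / 4) by apply Rmin_l.
  assert (Hkp2 : kp <= / 2) by apply Rmin_r.
  set (M := (2 * Y + 2 * d) * K).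
  assert (HM : 0 <= M) by (apply Rmult_le_pos; unfold Y; lra).
  set (lam := M / (kp * eta) / (3 * kp ^ 2)).
  assert (Hke : 0 < kp * eta) by (apply Rmult_lt_0_compat; assumption).
  assert (Hkk : 0 < kp ^ 2) by (apply pow_lt; assumption).
  assert (Hkk4 : 4 * kp ^ 2 <= 1) by nra.
  assert (Hlam : 0 <= lam).
  { unfold lam; apply Rle_mult_inv_pos; [apply Rle_mult_inv_pos|]; lra. }
  set (w := fun z : C => Cexp (RtoC lam * ((z - (x0, y0)) * (z - (x0, y0))))%C).
  set (k := fun z => (h z * w z)%C).
  assert (Hw : forall z, diff_at w z).
  { intros z; apply diff_at_Cexp.
    assert (Hs : diff_at (fun z => z - (x0, y0))%C z)
      by (apply (diff_at_plus (fun z => z) (fun _ => (- (x0, y0))%C));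
          [apply diff_at_id|apply diff_at_const]).
    apply (diff_at_mult (fun _ => RtoC lam)); [apply diff_at_const|].
    apply (diff_at_mult (fun z => z - (x0, y0))%C); assumption. }
  assert (Hk : diff_on_rect k x0 x1 (y0 - Y) (y0 + Y)).
  { intros z Hzr; apply (diff_at_mult h w); [apply (Hr x0 x1 (y0 - Y) (y0 + Y)); auto; lra|auto]. }
  assert (Hwm : forall x y, Cmod (w (x, y)) = exp (lam * ((x - x0) ^ 2 - (y - y0) ^ 2))).
  { intros x y; unfold w; rewrite Cmod_Cexp; f_equal; simpl; ring. }
  pose proof (goursat k x0 x1 (y0 - Y) (y0 + Y) ltac:(unfold x1; lra) ltac:(unfold Y; lra) Hk) as G.
  unfold boundary in G.
  assert (E1 : CInt (fun y => k (x1, y)) (y0 - Y) (y0 + Y) = 0%C).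
  { rewrite (CInt_ext _ (fun _ => 0%C)); [rewrite CInt_const; ring|unfold Y; lra|].
    intros t _; unfold k; rewrite Hp by (simpl; lra); ring. }
  rewrite E1 in G.
  set (V := CInt (fun y => k (x0, y)) (y0 - Y) (y0 + Y)) in *.
  assert (Hhor : forall y K', (y = y0 - Y \/ y = y0 + Y) -> K' <= K ->
    (forall x, x0 <= x <= x1 -> Cmod (h (x, y)) <= K') ->
    Cmod (CInt (fun x => k (x, y)) x0 x1) <= d * (K * exp (- lam))).
  { intros y K' Hy HK' Hb. replace d with (x1 - x0) by (unfold x1; ring).
    apply Cmod_CInt_le; [unfold x1; lra| |].
    - apply (cc_on_horizontal k x0 x1 (y0 - Y) (y0 + Y)); [assumption|]. unfold Y; destruct Hy; subst y; unfold Y; lra.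
    - intros x Hxx. unfold k; rewrite Cmod_mult, Hwm.
      apply Rmult_le_compat; [apply Cmod_ge_0|apply Rlt_le, exp_pos| |].
      + eapply Rle_trans; [apply Hb, Hxx|assumption].
      + apply exp_le_exp.
        assert ((x - x0) ^ 2 <= d ^ 2) by (unfold x1 in Hxx; apply pow_incr; lra).
        replace ((y - y0) ^ 2) with (Y ^ 2) by (destruct Hy; subst y; ring).
        assert (Y ^ 2 = d ^ 2 + 2 * d + 1) by (unfold Y; ring). nra. }
  assert (HV : Cmod V <= 2 * d * (K * exp (- lam))).
  { set (A := CInt (fun x => k (x, y0 - Y)) x0 x1) in *.
    set (B := CInt (fun x => k (x, y0 + Y)) x0 x1) in *.
    assert (EV : (Ci * V = A - B)%C).
    { replace (Ci * V)%C with ((A - B) - (A - B + Ci * (0 - V)))%C by ring. rewrite G; ring. }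
    replace (Cmod V) with (Cmod (Ci * V)) by (rewrite Cmod_mult, Cmod_Ci; ring).
    rewrite EV. unfold Cminus. eapply Rle_trans; [apply Cmod_triangle|]. rewrite Cmod_opp.
    assert (Cmod A <= d * (K * exp (- lam))) by (apply (Hhor (y0 - Y) K1); auto; lra).
    assert (Cmod B <= d * (K * exp (- lam))) by (apply (Hhor (y0 + Y) K2); auto; lra). lra. }
  (* [conj h0 * h] has positive real part near z0, so testing against [conj h0]
     turns the concentration of the weight into a lower bound for [V] *)
  set (g := fun y => (Cconj h0 * k (x0, y))%C).
  assert (Hg : forall y, Re (g y) = Re (Cconj h0 * h (x0, y))%C * exp (- (lam * (y - y0) ^ 2))).
  { intros y; unfold g, k.
    assert (Ew : w (x0, y) = RtoC (exp (- (lam * (y - y0) ^ 2)))).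
    { unfold w, Cexp; apply C_eq; simpl.
      - replace (lam * ((x0 + - x0) * (y + - y0) + (y + - y0) * (x0 + - x0)) +
          0 * ((x0 + - x0) * (x0 + - x0) - (y + - y0) * (y + - y0))) with 0 by ring.
        rewrite cos_0, Rmult_1_r; f_equal; ring.
      - replace (lam * ((x0 + - x0) * (y + - y0) + (y + - y0) * (x0 + - x0)) +
          0 * ((x0 + - x0) * (x0 + - x0) - (y + - y0) * (y + - y0))) with 0 by ring.
        rewrite sin_0; ring. }
    rewrite Ew, Cmult_assoc, Cmult_comm, re_scal_l; ring. }
  assert (Hgc : cc_on g (y0 - Y) (y0 + Y)).
  { intros t Ht; apply cc_at_mult; [apply cc_at_const|].
    apply (cc_on_vertical k x0 x1 (y0 - Y) (y0 + Y)); auto; unfold x1; lra. }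
  assert (Hnear : forall y, Rabs (y - y0) < dl -> eta ^ 2 / 2 <= Re (Cconj h0 * h (x0, y))%C).
  { intros y Hy; specialize (Hdl' y Hy).
    replace (Cconj h0 * h (x0, y))%C with (Cconj h0 * h0 + Cconj h0 * (h (x0, y) - h0))%C by ring.
    change (Re (Cconj h0 * h0 + Cconj h0 * (h (x0, y) - h0)))
      with (Re (Cconj h0 * h0) + Re (Cconj h0 * (h (x0, y) - h0))).
    rewrite Re_Cconj_mult. fold eta.
    pose proof (re_le_Cmod (Cconj h0 * (h (x0, y) - h0))%C) as Hre.
    rewrite Cmod_mult, Cmod_conj in Hre. fold eta in Hre. fold h0 in Hdl'.
    assert (eta * Cmod (h (x0, y) - h0) <= eta * (eta / 2)) by (apply Rmult_le_compat_l; lra).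
    pose proof (Rle_abs (- Re (Cconj h0 * (h (x0, y) - h0))%C)) as Ha. rewrite Rabs_Ropp in Ha.
    simpl pow. lra. }
  assert (Hlow : forall y, Rabs (y - y0) <= Y -> - (eta * K) <= Re (Cconj h0 * h (x0, y))%C).
  { intros y Hy. apply Rabs_le_between in Hy.
    pose proof (re_le_Cmod (Cconj h0 * h (x0, y))%C) as Hre.
    rewrite Cmod_mult, Cmod_conj in Hre. fold eta in Hre.
    pose proof (HK3 y ltac:(lra)) as HK3'; simpl in HK3'.
    assert (eta * Cmod (h (x0, y)) <= eta * K) by (apply Rmult_le_compat_l; lra).
    pose proof (Rle_abs (- Re (Cconj h0 * h (x0, y))%C)) as Ha. rewrite Rabs_Ropp in Ha. lra. }
  set (u := exp (- (lam * kp ^ 2))). set (v := exp (- (lam * (4 * kp ^ 2)))).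
  assert (Hv : 0 < v) by apply exp_pos.
  assert (HekK : 0 <= eta * K) by (apply Rmult_le_pos; lra).
  assert (Hout : forall y, kp <= Rabs (y - y0) <= Y -> - (eta * K * v) <= Re (g y)).
  { intros y Hy. rewrite Hg. pose proof (exp_pos (- (lam * (y - y0) ^ 2))) as Hpos.
    destruct (Rlt_le_dec (Rabs (y - y0)) (2 * kp)) as [Hyk|Hyk].
    - pose proof (Hnear y ltac:(lra)). assert (0 <= eta ^ 2) by apply pow2_ge_0.
      assert (0 <= Re (Cconj h0 * h (x0, y))%C * exp (- (lam * (y - y0) ^ 2)))
        by (apply Rmult_le_pos; lra).
      assert (0 <= eta * K * v) by (apply Rmult_le_pos; lra). lra.
    - pose proof (Hlow y ltac:(lra)).
      assert (exp (- (lam * (y - y0) ^ 2)) <= v).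
      { apply exp_le_exp, Ropp_le_contravar, Rmult_le_compat_l; [assumption|].
        rewrite <- (pow2_abs (y - y0)). nra. }
      assert (- (eta * K) * exp (- (lam * (y - y0) ^ 2))
              <= Re (Cconj h0 * h (x0, y))%C * exp (- (lam * (y - y0) ^ 2)))
        by (apply Rmult_le_compat_r; lra).
      assert (eta * K * exp (- (lam * (y - y0) ^ 2)) <= eta * K * v)
        by (apply Rmult_le_compat_l; lra). lra. }
  assert (Hin : forall y, Rabs (y - y0) <= kp -> eta ^ 2 / 2 * u <= Re (g y)).
  { intros y Hy. rewrite Hg. apply Rmult_le_compat.
    - assert (0 <= eta ^ 2) by apply pow2_ge_0; lra.
    - apply Rlt_le, exp_pos.
    - apply Hnear; lra.
    - apply exp_le_exp, Ropp_le_contravar, Rmult_le_compat_l; [assumption|].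
      rewrite <- (pow2_abs (y - y0)). apply pow_incr; split; [apply Rabs_pos|assumption]. }
  assert (HkY : kp <= Y) by (unfold Y; lra).
  assert (Cint_low : forall a b m, y0 - Y <= a -> a <= b -> b <= y0 + Y ->
     (forall y, a <= y <= b -> m <= Re (g y)) -> (b - a) * m <= Re (CInt g a b)).
  { intros a b m Ha Hab Hb Hm.
    replace ((b - a) * m) with (Re (CInt (fun _ => RtoC m) a b))
      by (rewrite CInt_const; simpl; ring).
    apply Re_CInt_le; auto.
    - intros t _; apply cc_at_const.
    - apply cc_on_sub with (3 := Hgc); lra. }
  assert (Hlower : kp * eta ^ 2 * u - 2 * Y * (eta * K * v) <= Re (CInt g (y0 - Y) (y0 + Y))).
  { rewrite (CInt_Chasles g (y0 - Y) (y0 - kp) (y0 + Y)) by (auto; lra).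
    rewrite (CInt_Chasles g (y0 - kp) (y0 + kp) (y0 + Y))
      by (try lra; apply cc_on_sub with (3 := Hgc); lra).
    match goal with |- _ <= Re (?A + (?B + ?D))%C =>
      change (Re (A + (B + D))%C) with (Re A + (Re B + Re D)) end.
    pose proof (Cint_low (y0 - Y) (y0 - kp) (- (eta * K * v)) ltac:(lra) ltac:(lra) ltac:(lra)) as L1.
    pose proof (Cint_low (y0 - kp) (y0 + kp) (eta ^ 2 / 2 * u) ltac:(lra) ltac:(lra) ltac:(lra)) as L2.
    pose proof (Cint_low (y0 + kp) (y0 + Y) (- (eta * K * v)) ltac:(lra) ltac:(lra) ltac:(lra)) as L3.
    assert (A1 : forall y, y0 - Y <= y <= y0 - kp -> - (eta * K * v) <= Re (g y)).
    { intros y Hy; apply Hout; rewrite Rabs_left1; lra. }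
    assert (A2 : forall y, y0 - kp <= y <= y0 + kp -> eta ^ 2 / 2 * u <= Re (g y)).
    { intros y Hy; apply Hin, Rabs_le; lra. }
    assert (A3 : forall y, y0 + kp <= y <= y0 + Y -> - (eta * K * v) <= Re (g y)).
    { intros y Hy; apply Hout; rewrite Rabs_pos_eq; lra. }
    specialize (L1 A1); specialize (L2 A2); specialize (L3 A3).
    assert (0 <= kp * (eta * K * v)) by (repeat apply Rmult_le_pos; lra). lra. }
  assert (Hupper : Re (CInt g (y0 - Y) (y0 + Y)) <= eta * (2 * d * (K * exp (- lam)))).
  { unfold g. rewrite (CInt_scal (Cconj h0) (fun y => k (x0, y))).
    - fold V. eapply Rle_trans; [eapply Rle_trans; [apply Rle_abs|apply re_le_Cmod]|].
      rewrite Cmod_mult, Cmod_conj. fold eta. apply Rmult_le_compat_l; lra.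
    - lra.
    - apply (cc_on_vertical k x0 x1 (y0 - Y) (y0 + Y)); [assumption|unfold x1; lra]. }
  assert (Hev : exp (- lam) <= v) by (apply exp_le_exp; nra).
  assert (Hfin : kp * eta ^ 2 * u <= eta * M * v).
  { assert (eta * (2 * d * (K * exp (- lam))) <= eta * (2 * d * (K * v))).
    { apply Rmult_le_compat_l; [lra|]. apply Rmult_le_compat_l; [lra|].
      apply Rmult_le_compat_l; lra. }
    replace (eta * M * v) with (2 * Y * (eta * K * v) + eta * (2 * d * (K * v)))
      by (unfold M; ring). lra. }
  assert (Hu : u = v * exp (3 * kp ^ 2 * lam)) by (unfold u, v; rewrite <- exp_plus; f_equal; ring).
  assert (Hbig : 1 + M / (kp * eta) <= exp (3 * kp ^ 2 * lam)).
  { replace (3 * kp ^ 2 * lam) with (M / (kp * eta)).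
    - apply exp_ineq1_le.
    - unfold lam; field; repeat split; lra. }
  assert (Hc1 : eta * v * (kp * eta * (1 + M / (kp * eta))) <= eta * v * M).
  { apply Rle_trans with (kp * eta ^ 2 * u); [|lra].
    rewrite Hu. replace (kp * eta ^ 2 * (v * exp (3 * kp ^ 2 * lam)))
      with (eta * v * (kp * eta * exp (3 * kp ^ 2 * lam))) by ring.
    apply Rmult_le_compat_l; [apply Rmult_le_pos; lra|].
    apply Rmult_le_compat_l; lra. }
  apply Rmult_le_reg_l in Hc1; [|apply Rmult_lt_0_compat; assumption].
  replace (kp * eta * (1 + M / (kp * eta))) with (kp * eta + M) in Hc1 by (field; split; lra).
  lra.
Qed.

Lemma identity_theorem (f g : C -> C) (sg p : R) :
  (forall z, sg < Re z -> diff_at f z) -> (forall z, sg < Re z -> diff_at g z) ->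
  (forall z, p < Re z -> f z = g z) -> forall z, sg < Re z -> f z = g z.
Proof.
  intros Hf Hg H z Hz.
  assert (E : (f z + (-1) * g z = 0)%C).
  { apply (half_plane_vanish (fun z => f z + (-1) * g z)%C sg p); auto.
    - intros s Hs; apply diff_at_plus; [auto|].
      apply (diff_at_mult (fun _ => RtoC (-1)) g); [apply diff_at_const|auto].
    - intros s Hs; rewrite H by assumption; ring. }
  replace (f z) with ((f z + (-1) * g z) + g z)%C by ring. rewrite E; ring.
Qed.

(** * Dirichlet series *)

Lemma sum_n_csum (f : nat -> C) (n : nat) : sum_n f n = csum f (S n).
Proof.
  induction n as [|n IH]; [rewrite sum_O; simpl; ring|].
  rewrite sum_Sn, IH; reflexivity.
Qed.

Lemma is_series_cseries (f : nat -> C) (l : C) :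
  @is_series C_AbsRing C_NormedModule f l <-> cseries f l.
Proof.
  split.
  - intros H e He.
    assert (He2 : 0 < e / 2) by lra.
    assert (H' := proj1 (filterlim_locally (F := eventually) (sum_n f) l) H (mkposreal _ He2)).
    destruct H' as [N HN]; exists (S N); intros n Hn.
    destruct n as [|n]; [lia|]. specialize (HN n ltac:(lia)).
    rewrite sum_n_csum in HN.
    apply (C_NormedModule_mixin_compat2 l (csum f (S n)) (mkposreal _ He2)) in HN.
    pose proof sqrt_2_le as S2.
    simpl in HN. change (Cmod (csum f (S n) - l) < sqrt 2 * (e / 2)) in HN.
    assert (sqrt 2 * (e / 2) <= 2 * (e / 2)) by (apply Rmult_le_compat_r; lra). lra.
  - intros H. apply (proj2 (filterlim_locally (F := eventually) (sum_n f) l)).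
    intros e. destruct (H (e / 2)) as [N HN]; [destruct e; simpl; lra|].
    exists N; intros n Hn. rewrite sum_n_csum.
    apply C_NormedModule_mixin_compat1.
    specialize (HN (S n) ltac:(lia)). pose proof (cond_pos e).
    change (Cmod (csum f (S n) - l) < e). lra.
Qed.

Lemma dirichlet_on_iff (sg : R) (a : nat -> C) (f : C -> C) :
  dirichlet_on sg a f <-> forall s, sg < Re s -> cseries (dirichlet_term a s) (f s).
Proof.
  split; intros H s Hs; apply is_series_cseries; apply (H s Hs).
Qed.

Lemma Cmod_dirichlet_term (a : nat -> C) (s : C) (n : nat) :
  Cmod (dirichlet_term a s n) = Cmod (a n) * rpow n (Re s).
Proof. unfold dirichlet_term; rewrite Cmod_mult; f_equal; apply Cmod_npow. Qed.

Definition abs_conv (a : nat -> C) (x : R) : Prop := summable (fun n => Cmod (a n) * rpow n x).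

Lemma abs_conv_term (a : nat -> C) (x : R) (s : C) :
  abs_conv a x -> x <= Re s -> abs_summable (dirichlet_term a s).
Proof.
  intros H Hs; eapply summable_le; [|exact H]. intros n; simpl.
  rewrite Cmod_dirichlet_term. apply Rmult_le_compat_l; [apply Cmod_ge_0|apply rpow_antimono, Hs].
Qed.

Lemma dirichlet_term_conv (a b : nat -> C) (s : C) (n : nat) :
  conv (dirichlet_term a s) (dirichlet_term b s) n = dirichlet_term (conv a b) s n.
Proof. apply (conv_twist (fun n => npow n s)); intros; apply npow_mult. Qed.

Lemma dirichlet_conv (a b : nat -> C) (s A B : C) :
  cseries (dirichlet_term a s) A -> abs_summable (dirichlet_term b s) ->
  cseries (dirichlet_term b s) B ->
  cseries (dirichlet_term (conv a b) s) (A * B)%C.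
Proof.
  intros Ha Hb HB. apply cseries_ext with (1 := dirichlet_term_conv a b s).
  apply cseries_conv; assumption.
Qed.

Lemma abs_conv_conv (a b : nat -> C) (x : R) :
  abs_conv a x -> abs_conv b x -> abs_conv (conv a b) x.
Proof.
  intros Ha Hb.
  assert (H : abs_summable (dirichlet_term (conv a b) (RtoC x))).
  { apply summable_le with (fun n => Cmod (conv (dirichlet_term a (RtoC x)) (dirichlet_term b (RtoC x)) n)).
    - intros n; rewrite dirichlet_term_conv; lra.
    - apply abs_summable_conv; apply abs_conv_term with x; auto; simpl; lra. }
  eapply summable_le; [|exact H]. intros n; simpl; rewrite Cmod_dirichlet_term; simpl; lra.
Qed.

(** Convergence bounds the terms at [s], and a shift by two multiplies them by the
    summable (n+1)^(-2). *)
Lemma cseries_abs_conv (a : nat -> C) (s l : C) :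
  cseries (dirichlet_term a s) l -> abs_conv a (Re s + 2).
Proof.
  intros H. destruct (clim_bounded _ _ H) as [M [_ HM]].
  apply summable_le with (fun n => 2 * M * rpow n 2).
  - intros n. rewrite rpow_plus, <- Rmult_assoc, <- Cmod_dirichlet_term.
    apply Rmult_le_compat_r; [apply Rlt_le, rpow_pos|].
    replace (dirichlet_term a s n)
      with (csum (dirichlet_term a s) (S n) - csum (dirichlet_term a s) n)%C
      by (rewrite csum_S; ring).
    unfold Cminus; eapply Rle_trans; [apply Cmod_triangle|]. rewrite Cmod_opp.
    pose proof (HM (S n)); pose proof (HM n); lra.
  - apply summable_scal; [|apply summable_rpow; lra].
    pose proof (HM 0%nat) as H0; simpl in H0; rewrite Cmod_0 in H0; lra.
Qed.

Definition trunc (N : nat) (b : nat -> C) (k : nat) : C := if (k <? N)%nat then b k else RtoC 0.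

Lemma trunc_lt (N : nat) (b : nat -> C) (k : nat) : (k < N)%nat -> trunc N b k = b k.
Proof. intros H; unfold trunc; destruct (Nat.ltb_spec k N); [reflexivity|lia]. Qed.

Lemma trunc_ge (N : nat) (b : nat -> C) (k : nat) : (N <= k)%nat -> trunc N b k = 0%C.
Proof. intros H; unfold trunc; destruct (Nat.ltb_spec k N); [lia|reflexivity]. Qed.

Definition dpoly (b : nat -> C) (N : nat) (s : C) : C := csum (fun k => b k * npow k s)%C N.

Lemma cseries_trunc (b : nat -> C) (N : nat) (s : C) :
  cseries (dirichlet_term (trunc N b) s) (dpoly b N s).
Proof.
  intros e He; exists N; intros M HM.
  rewrite (csum_extend _ N M HM).
  - unfold dpoly. rewrite (csum_ext (dirichlet_term (trunc N b) s) (fun k => b k * npow k s)%C).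
    + replace (_ - _)%C with (RtoC 0) by ring. rewrite Cmod_0; lra.
    + intros k Hk; unfold dirichlet_term; rewrite trunc_lt by assumption; reflexivity.
  - intros k Hk; unfold dirichlet_term; rewrite trunc_ge by lia; ring.
Qed.

Lemma abs_conv_trunc (b : nat -> C) (N : nat) (x : R) : abs_conv (trunc N b) x.
Proof.
  exists (rsum (fun n => Cmod (trunc N b n) * rpow n x) N); intros M.
  assert (P : forall n, 0 <= Cmod (trunc N b n) * rpow n x)
    by (intros; apply abs_term_nonneg).
  destruct (le_lt_dec M N) as [H|H]; [apply rsum_mono; auto|].
  right; apply rsum_extend; [lia|]. intros n Hn; rewrite trunc_ge by lia; rewrite Cmod_0; ring.
Qed.

Lemma mean_lim_dpoly (b : nat -> C) (N n : nat) (x : R) : (n < N)%nat ->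
  mean_lim (fun t => dpoly b N (x, t) * npow n (- (x, t)))%C (b n).
Proof.
  intros Hn; rewrite <- (trunc_lt N b n Hn).
  apply (mean_lim_coeff (trunc N b) x (dpoly b N)).
  - apply abs_conv_trunc.
  - intros t; apply cseries_trunc.
Qed.

Lemma Cconj_npow (n : nat) (x t : R) :
  Cconj (npow n (x, t)) = (RtoC (rpow n (2 * x)) * npow n (- (x, t)))%C.
Proof.
  replace (- (x, t))%C with (- x, - t) by reflexivity.
  rewrite !npow_line, !char_Cexp.
  replace (RtoC (rpow n (2 * x)) * (RtoC (rpow n (- x)) * Cexp (0, (- freq n * - t)%R)))%C
    with (RtoC (rpow n (2 * x) * rpow n (- x)) * Cexp (0, (- freq n * - t)%R))%C
    by (rewrite RtoC_mult; ring).
  rewrite <- rpow_plus. replace (2 * x + - x) with x by ring.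
  rewrite Cmult_conj, Cconj_Cexp. f_equal.
  - apply C_eq; simpl; ring.
  - f_equal; apply C_eq; simpl; ring.
Qed.

Lemma Cconj_csum (f : nat -> C) (N : nat) :
  Cconj (csum f N) = csum (fun n => Cconj (f n)) N.
Proof.
  induction N as [|N IH]; [apply C_eq; simpl; ring|].
  rewrite !csum_S, Cplus_conj, IH; reflexivity.
Qed.

(** On a vertical line the conjugate of (n+1)^(-s) is a multiple of (n+1)^s, so only
    the generalized Fourier coefficients of [F] enter. *)
Lemma mean_lim_hermitian (F : R -> C) (c q : nat -> C) (N : nat) (x : R) :
  (forall n, (n < N)%nat -> mean_lim (fun t => F t * npow n (- (x, t)))%C (c n)) ->
  mean_lim (fun t => F t * Cconj (dpoly q N (x, t)))%C
    (csum (fun n => (Cconj (q n) * RtoC (rpow n (2 * x))) * c n)%C N).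
Proof.
  intros H.
  apply mean_lim_ext with (fun t => csum (fun n =>
    (Cconj (q n) * RtoC (rpow n (2 * x))) * (F t * npow n (- (x, t))))%C N).
  - intros t; unfold dpoly; rewrite Cconj_csum, <- csum_scal.
    apply csum_ext; intros n _. rewrite Cmult_conj, Cconj_npow; ring.
  - apply mean_lim_csum; intros n Hn; apply mean_lim_scal, H, Hn.
Qed.

Lemma csum_hermitian (c : nat -> C) (N : nat) (x : R) :
  Re (csum (fun n => (Cconj (c n) * RtoC (rpow n (2 * x))) * c n)%C N)
  = rsum (fun n => Cmod (c n) ^ 2 * rpow n (2 * x)) N.
Proof.
  rewrite Re_csum; apply rsum_ext; intros n _.
  rewrite Cmod2_alt; destruct (c n); simpl; ring.
Qed.

(** * Bounded analytic functions act boundedly on coefficients *)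

(** The lower-triangular structure of the convolution makes it enough to compare
    initial segments, so that no convergence enters the definition. *)
Definition conv_bounded (a : nat -> C) (B : R) : Prop :=
  forall b N, rsum (fun n => Cmod (conv a b n) ^ 2) N <= B ^ 2 * rsum (fun n => Cmod (b n) ^ 2) N.

(** Cauchy's theorem on tall rectangles: the horizontal sides stay bounded, so
    they disappear from the mean value, which is thus the same on all lines. *)
Lemma mean_lim_shift (G : C -> C) (B x x1 : R) (n : nat) (c : C) :
  (forall z, 0 < Re z -> diff_at G z) -> (forall z, 0 < Re z -> Cmod (G z) <= B) ->
  0 < x <= x1 ->
  mean_lim (fun t => G (x1, t) * npow n (- (x1, t)))%C c ->
  mean_lim (fun t => G (x, t) * npow n (- (x, t)))%C c.
Proof.
  intros HG HB Hx [_ HL].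
  set (H := fun z => (G z * npow n (- z))%C).
  assert (HH : forall z, 0 < Re z -> diff_at H z)
    by (intros z Hz; apply diff_at_mult; [auto|apply diff_at_npow_opp]).
  assert (Hc : forall t, cc_at (fun t => G (x, t) * npow n (- (x, t)))%C t).
  { intros t; destruct (HH (x, t) ltac:(simpl; lra)) as [l Hl].
    apply (cc_at_vertical H x t l Hl). }
  assert (HB0 : 0 <= B).
  { eapply Rle_trans; [apply Cmod_ge_0|apply (HB (x, 0)); simpl; lra]. }
  split; [assumption|]. intros e He.
  destruct (HL (e / 2) ltac:(lra)) as [T0 [HT0 HT]].
  set (K := B * rpow n (- x1)).
  assert (HK : 0 <= K) by (apply Rmult_le_pos; [assumption|apply Rlt_le, rpow_pos]).
  set (W := (x1 - x) * K). assert (HW : 0 <= W) by (apply Rmult_le_pos; lra).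
  exists (Rmax T0 (2 * W / e + 1)); split; [eapply Rlt_le_trans; [apply HT0|apply Rmax_l]|].
  intros T HTT.
  assert (HT1 : T0 <= T) by (eapply Rle_trans; [apply Rmax_l|apply HTT]).
  assert (HT2 : 2 * W / e + 1 <= T) by (eapply Rle_trans; [apply Rmax_r|apply HTT]).
  specialize (HT T HT1).
  assert (HTp : 0 < T) by lra.
  assert (Hrect : diff_on_rect H x x1 (- T) T) by (intros z [Hz _]; apply HH; lra).
  pose proof (goursat H x x1 (- T) T ltac:(lra) ltac:(lra) Hrect) as G0.
  unfold boundary in G0.
  assert (Hhor : forall y, - T <= y <= T -> Cmod (CInt (fun x => H (x, y)) x x1) <= W).
  { intros y Hy; unfold W; apply Cmod_CInt_le; [lra| |].
    - apply (cc_on_horizontal H x x1 (- T) T); auto.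
    - intros u Hu. unfold H; rewrite Cmod_mult, Cmod_npow.
      apply Rmult_le_compat; [apply Cmod_ge_0|apply Rlt_le, rpow_pos|apply HB; simpl; lra|].
      apply rpow_antimono; simpl; lra. }
  pose proof (Hhor (- T) ltac:(lra)) as H1. pose proof (Hhor T ltac:(lra)) as H2.
  set (V1 := CInt (fun y => H (x1, y)) (- T) T) in *.
  set (V0 := CInt (fun y => H (x, y)) (- T) T) in *.
  set (A := CInt (fun x => H (x, - T)) x x1) in *.
  set (A' := CInt (fun x => H (x, T)) x x1) in *.
  assert (EV : Cmod (V0 - V1) <= 2 * W).
  { replace (Cmod (V0 - V1)) with (Cmod (Ci * (V0 - V1))) by (rewrite Cmod_mult, Cmod_Ci; ring).
    replace (Ci * (V0 - V1))%C with ((A - A') - (A - A' + Ci * (V1 - V0)))%C by ring.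
    rewrite G0. replace (A - A' - 0)%C with (A + - A')%C by ring.
    eapply Rle_trans; [apply Cmod_triangle|]. rewrite Cmod_opp; lra. }
  change (Cmod (RtoC (/ (2 * T)) * V1 - c) <= e / 2) in HT.
  change (Cmod (RtoC (/ (2 * T)) * V0 - c) <= e).
  replace (RtoC (/ (2 * T)) * V0 - c)%C
    with (RtoC (/ (2 * T)) * (V0 - V1) + (RtoC (/ (2 * T)) * V1 - c))%C by ring.
  eapply Rle_trans; [apply Cmod_triangle|].
  assert (Cmod (RtoC (/ (2 * T)) * (V0 - V1)) <= e / 2); [|lra].
  rewrite Cmod_mult, Cmod_R, Rabs_pos_eq by (apply Rlt_le, Rinv_0_lt_compat; lra).
  apply Rmult_le_reg_l with (2 * T); [lra|]. rewrite <- Rmult_assoc, Rinv_r, Rmult_1_l by lra.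
  assert (2 * W <= T * e).
  { apply Rle_trans with ((2 * W / e + 1) * e); [|apply Rmult_le_compat_r; lra].
    replace ((2 * W / e + 1) * e) with (2 * W + e) by (field; lra). lra. }
  lra.
Qed.

Lemma conv_trunc (a b : nat -> C) (N n : nat) : (n < N)%nat ->
  conv a (trunc N b) n = conv a b n.
Proof. intros H; apply conv_ext; intros k Hk; [reflexivity|apply trunc_lt; lia]. Qed.

(** On the line Re s = x, the pointwise inequality
    [2 Re (G conj Q) <= B^2 |f|^2 + |Q|^2], for G = g f with f a Dirichlet
    polynomial and Q a partial sum of the series of G, becomes after taking mean
    values the estimate of [bounded_conv_bounded] weighted by (n+1)^(-2x). *)
Lemma bounded_conv_bounded_line (a : nat -> C) (g : C -> C) (B sg x : R) :
  (forall z, 0 < Re z -> diff_at g z) -> (forall z, 0 < Re z -> Cmod (g z) <= B) ->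
  dirichlet_on sg a g -> 0 < x -> forall b N,
  rsum (fun n => Cmod (conv a b n) ^ 2 * rpow n (2 * x)) N
  <= B ^ 2 * rsum (fun n => Cmod (b n) ^ 2 * rpow n (2 * x)) N.
Proof.
  intros Hg HB Hser Hx b N. rewrite dirichlet_on_iff in Hser.
  set (s0 := Rmax sg x + 1).
  assert (Hs0 : sg < s0 /\ x < s0)
    by (unfold s0; pose proof (Rmax_l sg x); pose proof (Rmax_r sg x); lra).
  set (x1 := s0 + 2).
  assert (Ha : abs_conv a x1) by (apply (cseries_abs_conv a (RtoC s0) (g (RtoC s0))), Hser; simpl; lra).
  set (c := conv a (trunc N b)).
  set (G := fun z => (g z * dpoly b N z)%C).
  assert (HGd : forall z, 0 < Re z -> diff_at G z).
  { intros z Hz; apply diff_at_mult; [auto|]. unfold dpoly.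
    apply (diff_at_csum (fun k z => b k * npow k z)%C); intros k.
    apply (diff_at_mult (fun _ => b k)); [apply diff_at_const|apply diff_at_npow]. }
  set (Bf := rsum (fun n => Cmod (b n)) N).
  assert (HGb : forall z, 0 < Re z -> Cmod (G z) <= B * Bf).
  { intros z Hz; unfold G; rewrite Cmod_mult.
    apply Rmult_le_compat; try apply Cmod_ge_0; [auto|].
    unfold dpoly; eapply Rle_trans; [apply Cmod_csum_le|]. apply rsum_le; intros k _.
    rewrite Cmod_mult, Cmod_npow. rewrite <- (Rmult_1_r (Cmod (b k))) at 2.
    apply Rmult_le_compat_l; [apply Cmod_ge_0|apply rpow_le_1; lra]. }
  assert (HGm : forall n, mean_lim (fun t => G (x, t) * npow n (- (x, t)))%C (c n)).
  { intros n; apply mean_lim_shift with (B * Bf) x1; auto; [unfold x1; lra|].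
    apply (mean_lim_coeff c x1 G n).
    - apply abs_conv_conv; [assumption|apply abs_conv_trunc].
    - intros t; apply dirichlet_conv; [apply Hser; unfold x1; simpl; lra| |apply cseries_trunc].
      apply abs_conv_term with x1; [apply abs_conv_trunc|simpl; lra]. }
  pose proof (mean_lim_hermitian (fun t => G (x, t)) c c N x (fun n _ => HGm n)) as M1.
  pose proof (mean_lim_hermitian (fun t => dpoly b N (x, t)) b b N x
    (fun n Hn => mean_lim_dpoly b N n x Hn)) as M2.
  pose proof (mean_lim_hermitian (fun t => dpoly c N (x, t)) c c N x
    (fun n Hn => mean_lim_dpoly c N n x Hn)) as M3.
  pose proof (mean_lim_plus _ _ _ _ (mean_lim_plus _ _ _ _ (mean_lim_scal (RtoC (B ^ 2)) _ _ M2) M3)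
    (mean_lim_scal (RtoC (-2)) _ _ M1)) as M.
  apply mean_lim_Re_nonneg in M.
  - rewrite !re_plus, !re_scal_l, !csum_hermitian in M.
    rewrite (rsum_ext _ (fun n => Cmod (c n) ^ 2 * rpow n (2 * x))).
    2:{ intros n Hn; unfold c; rewrite conv_trunc by assumption; reflexivity. }
    lra.
  - intros t. set (f := dpoly b N (x, t)). set (Q := dpoly c N (x, t)).
    rewrite !re_plus, !re_scal_l.
    unfold G; fold f. set (w := g (x, t)).
    assert (Hw : Cmod w <= B) by (apply HB; simpl; lra).
    assert (Hw2 : Re w ^ 2 + Im w ^ 2 <= B ^ 2).
    { rewrite <- Cmod2_alt; apply pow_incr; split; [apply Cmod_ge_0|assumption]. }
    assert (E1 : Re (f * Cconj f) = Re f ^ 2 + Im f ^ 2) by (destruct f; simpl; ring).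
    assert (E2 : Re (Q * Cconj Q) = Re Q ^ 2 + Im Q ^ 2) by (destruct Q; simpl; ring).
    assert (E3 : Re (w * f * Cconj Q)
      = (Re w * Re f - Im w * Im f) * Re Q + (Re w * Im f + Im w * Re f) * Im Q)
      by (destruct w, f, Q; simpl; ring).
    rewrite E1, E2, E3.
    assert (E4 : (Re w ^ 2 + Im w ^ 2) * (Re f ^ 2 + Im f ^ 2) <= B ^ 2 * (Re f ^ 2 + Im f ^ 2)).
    { apply Rmult_le_compat_r; [|assumption]. pose proof (pow2_ge_0 (Re f)); pose proof (pow2_ge_0 (Im f)); lra. }
    pose proof (pow2_ge_0 ((Re w * Re f - Im w * Im f) - Re Q)).
    pose proof (pow2_ge_0 ((Re w * Im f + Im w * Re f) - Im Q)).
    lra.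
Qed.

(** Let the line approach Re s = 0: on finitely many indices the weights tend to 1. *)
Theorem bounded_conv_bounded (a : nat -> C) (g : C -> C) (B sg : R) :
  (forall z, 0 < Re z -> diff_at g z) -> (forall z, 0 < Re z -> Cmod (g z) <= B) ->
  dirichlet_on sg a g -> conv_bounded a B.
Proof.
  intros Hg HB Hser b N.
  set (Sc := rsum (fun n => Cmod (conv a b n) ^ 2) N).
  set (Sb := rsum (fun n => Cmod (b n) ^ 2) N).
  assert (HSc : 0 <= Sc) by (apply rsum_nonneg; intros; apply pow2_ge_0).
  pose proof (freq_nonneg N) as HfN.
  apply Rnot_lt_le; intros Hlt.
  set (D := Sc - B ^ 2 * Sb). assert (HD : 0 < D) by (unfold D; lra).
  set (Lc := 2 * freq N * Sc + 1).
  assert (HLc : 0 < Lc) by (unfold Lc; assert (0 <= freq N * Sc) by (apply Rmult_le_pos; lra); lra).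
  set (x := D / (2 * Lc)). assert (Hx : 0 < x) by (apply Rdiv_lt_0_compat; lra).
  pose proof (bounded_conv_bounded_line a g B sg x Hg HB Hser Hx b N) as H.
  assert (Hlo : Sc * (1 - 2 * x * freq N) <= rsum (fun n => Cmod (conv a b n) ^ 2 * rpow n (2 * x)) N).
  { unfold Sc; rewrite Rmult_comm, <- rsum_scal; apply rsum_le; intros n Hn.
    rewrite Rmult_comm; apply Rmult_le_compat_l; [apply pow2_ge_0|].
    unfold rpow. pose proof (exp_ineq1_le (- (2 * x * freq n))).
    assert (freq n <= freq N).
    { unfold freq; apply ln_le; [apply INR_S_pos|apply le_INR; lia]. }
    assert (2 * x * freq n <= 2 * x * freq N) by (apply Rmult_le_compat_l; lra). lra. }
  assert (Hhi : rsum (fun n => Cmod (b n) ^ 2 * rpow n (2 * x)) N <= Sb).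
  { apply rsum_le; intros n _. rewrite <- (Rmult_1_r (Cmod (b n) ^ 2)) at 2.
    apply Rmult_le_compat_l; [apply pow2_ge_0|apply rpow_le_1; lra]. }
  assert (B ^ 2 * rsum (fun n => Cmod (b n) ^ 2 * rpow n (2 * x)) N <= B ^ 2 * Sb)
    by (apply Rmult_le_compat_l; [apply pow2_ge_0|assumption]).
  assert (D <= x * (2 * freq N * Sc)) by (unfold D; lra).
  assert (x * (2 * freq N * Sc) <= x * Lc) by (apply Rmult_le_compat_l; unfold Lc; lra).
  assert (x * Lc = D / 2) by (unfold x; field; lra).
  lra.
Qed.

(** * Convergence of bounded Dirichlet polynomials *)

Lemma clim_plus (u v : nat -> C) (l k : C) :
  clim u l -> clim v k -> clim (fun n => u n + v n)%C (l + k)%C.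
Proof.
  intros Hu Hv e He.
  destruct (Hu (e / 2) ltac:(lra)) as [N HN], (Hv (e / 2) ltac:(lra)) as [N' HN'].
  exists (N + N')%nat; intros n Hn.
  replace (u n + v n - (l + k))%C with ((u n - l) + (v n - k))%C by ring.
  eapply Rle_trans; [apply Cmod_triangle|].
  specialize (HN n ltac:(lia)); specialize (HN' n ltac:(lia)); lra.
Qed.

Lemma clim_scal (c : C) (u : nat -> C) (l : C) :
  clim u l -> clim (fun n => c * u n)%C (c * l)%C.
Proof.
  intros H; apply clim_scaled with (Cmod c); [apply Cmod_ge_0|]; intros e He.
  destruct (H e He) as [N HN]; exists N; intros n Hn.
  replace (c * u n - c * l)%C with (c * (u n - l))%C by ring. rewrite Cmod_mult.
  apply Rmult_le_compat_l; [apply Cmod_ge_0|auto].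
Qed.

Definition taylor (f : C -> C) (z0 : C) (c : nat -> C) : Prop :=
  forall r e, 0 < r -> 0 < e -> exists J0, forall J w, (J0 <= J)%nat -> Cmod w <= r ->
    Cmod (f (z0 + w) - csum (fun k => c k * w ^ k) J)%C <= e.

Lemma taylor_scal (a : C) (f : C -> C) (z0 : C) (c : nat -> C) :
  taylor f z0 c -> taylor (fun z => a * f z)%C z0 (fun k => a * c k)%C.
Proof.
  intros H r e Hr He. pose proof (Cmod_ge_0 a).
  destruct (H r (e / (Cmod a + 1)) Hr) as [J0 HJ]; [apply Rdiv_lt_0_compat; lra|].
  exists J0; intros J w HJJ Hw. specialize (HJ J w HJJ Hw).
  rewrite (csum_ext _ (fun k => a * (c k * w ^ k))%C) by (intros; ring).
  rewrite csum_scal.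
  replace (a * f (z0 + w) - a * csum (fun k => c k * w ^ k) J)%C
    with (a * (f (z0 + w) - csum (fun k => c k * w ^ k) J))%C by ring.
  rewrite Cmod_mult. apply Rle_trans with ((Cmod a + 1) * (e / (Cmod a + 1))).
  - apply Rmult_le_compat; try lra; apply Cmod_ge_0.
  - right; field; lra.
Qed.

Lemma taylor_plus (f g : C -> C) (z0 : C) (c d : nat -> C) :
  taylor f z0 c -> taylor g z0 d -> taylor (fun z => f z + g z)%C z0 (fun k => c k + d k)%C.
Proof.
  intros Hf Hg r e Hr He.
  destruct (Hf r (e / 2) Hr ltac:(lra)) as [J1 H1], (Hg r (e / 2) Hr ltac:(lra)) as [J2 H2].
  exists (J1 + J2)%nat; intros J w HJ Hw.
  specialize (H1 J w ltac:(lia) Hw); specialize (H2 J w ltac:(lia) Hw).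
  rewrite (csum_ext _ (fun k => c k * w ^ k + d k * w ^ k)%C) by (intros; ring).
  rewrite csum_plus.
  replace (f (z0 + w) + g (z0 + w) - (csum (fun k => c k * w ^ k) J + csum (fun k => d k * w ^ k) J))%C
    with ((f (z0 + w) - csum (fun k => c k * w ^ k) J)
          + (g (z0 + w) - csum (fun k => d k * w ^ k) J))%C by ring.
  eapply Rle_trans; [apply Cmod_triangle|]; lra.
Qed.

Lemma Cpow_mult (a b : C) (k : nat) : ((a * b) ^ k = a ^ k * b ^ k)%C.
Proof. induction k as [|k IH]; [simpl; ring|]. rewrite !Cpow_S, IH; ring. Qed.

Lemma taylor_npow (n : nat) (z0 : C) :
  exists c, taylor (npow n) z0 c.
Proof.
  set (l := (- RtoC (freq n))%C).
  exists (fun k => npow n z0 * (RtoC (/ INR (fact k)) * l ^ k))%C.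
  intros r e Hr He.
  set (x := r * freq n). set (A := Cmod (npow n z0) * exp x).
  assert (HA : 0 <= A) by (apply Rmult_le_pos; [apply Cmod_ge_0|apply Rlt_le, exp_pos]).
  destruct (cv_speed_pow_fact x (e / (A + 1))) as [J0 HJ]; [apply Rdiv_lt_0_compat; lra|].
  exists J0; intros J w HJJ Hw. specialize (HJ J HJJ).
  unfold Rdist in HJ; rewrite Rminus_0_r in HJ.
  assert (Hx : 0 <= x) by (apply Rmult_le_pos; [lra|apply freq_nonneg]).
  rewrite (csum_ext _ (fun k => npow n z0 * exp_term (l * w)%C k)%C).
  2:{ intros k _; unfold exp_term; rewrite Cpow_mult; ring. }
  rewrite csum_scal, npow_plus.
  replace (npow n w) with (Cexp (l * w)) by (rewrite npow_Cexp; f_equal; unfold l; ring).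
  replace (npow n z0 * Cexp (l * w) - npow n z0 * csum (exp_term (l * w)) J)%C
    with (npow n z0 * (Cexp (l * w) - csum (exp_term (l * w)) J))%C by ring.
  assert (Hlw : Cmod (l * w) <= x).
  { rewrite Cmod_mult. unfold l; rewrite Cmod_opp, Cmod_R, Rabs_pos_eq by apply freq_nonneg.
    unfold x; rewrite Rmult_comm; apply Rmult_le_compat_r; [apply freq_nonneg|assumption]. }
  rewrite Cmod_mult.
  apply Rle_trans with (Cmod (npow n z0) * (x ^ J / INR (fact J) * exp x)).
  - apply Rmult_le_compat_l; [apply Cmod_ge_0|].
    eapply Rle_trans; [apply Cexp_taylor|].
    pose proof (INR_fact_lt_0 J) as Hf.
    apply Rmult_le_compat; [apply Rle_mult_inv_pos; [apply pow_le, Cmod_ge_0|lra]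
      |apply Rlt_le, exp_pos| |apply exp_le_exp, Hlw].
    apply Rmult_le_compat_r; [apply Rlt_le, Rinv_0_lt_compat, Hf|].
    apply pow_incr; split; [apply Cmod_ge_0|assumption].
  - replace (Cmod (npow n z0) * (x ^ J / INR (fact J) * exp x)) with (A * (x ^ J / INR (fact J)))
      by (unfold A; ring).
    pose proof (Rle_abs (x ^ J / INR (fact J))).
    assert (0 <= x ^ J / INR (fact J))
      by (apply Rle_mult_inv_pos; [apply pow_le, Hx|apply INR_fact_lt_0]).
    apply Rle_trans with ((A + 1) * (e / (A + 1))); [|right; field; lra].
    apply Rmult_le_compat; lra.
Qed.

Lemma taylor_dpoly (b : nat -> C) (N : nat) (z0 : C) : exists c, taylor (dpoly b N) z0 c.
Proof.
  unfold dpoly; induction N as [|N [c Hc]].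
  - exists (fun _ => RtoC 0); intros r e Hr He; exists 0%nat; intros J w _ _.
    simpl. rewrite csum_zero by (intros; ring).
    replace (0 - 0)%C with (RtoC 0) by ring. rewrite Cmod_0; lra.
  - destruct (taylor_npow N z0) as [d Hd]. eexists.
    apply (taylor_plus _ (fun s => b N * npow N s)%C z0 c (fun k => b N * d k)%C); [exact Hc|].
    apply taylor_scal, Hd.
Qed.

Lemma char_pow (t : R) (i : nat) : (char 1 t ^ i = char (INR i) t)%C.
Proof.
  induction i as [|i IH]; [simpl; rewrite char_0; reflexivity|].
  rewrite Cpow_S, IH, S_INR, !char_Cexp, <- Cexp_plus; f_equal; apply C_eq; simpl; ring.
Qed.

(** Cauchy's estimate: the k-th Taylor coefficient, times r^k, is the mean value
    over the circle of radius r of the function rotated by the k-th character. *)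
Lemma taylor_cauchy (f : C -> C) (z0 : C) (c : nat -> C) (r B : R) (k : nat) :
  taylor f z0 c -> 0 < r ->
  (forall w, Cmod w = r -> Cmod (f (z0 + w)%C) <= B) -> Cmod (c k) * r ^ k <= B.
Proof.
  intros Hf Hr HB.
  set (F := fun t => (f (z0 + RtoC r * char 1 t) * char (- INR k) t)%C).
  assert (Hcirc : forall t, Cmod (RtoC r * char 1 t) = r)
    by (intros t; rewrite Cmod_mult, Cmod_char, Cmod_R, Rabs_pos_eq; lra).
  assert (HM : mean_lim F (c k * RtoC r ^ k)%C).
  { apply mean_lim_uniform; intros e He.
    destruct (Hf r e Hr He) as [J0 HJ].
    exists (fun t => csum (fun i => (c i * RtoC r ^ i) * char (INR i - INR k) t)%C (J0 + S k)).
    exists (c k * RtoC r ^ k)%C. split; [|split].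
    - assert (E : csum (fun i => (c i * RtoC r ^ i) * (if Nat.eq_dec i k then 1 else 0))%C (J0 + S k)
                  = (c k * RtoC r ^ k)%C).
      { apply (csum_select (fun i => c i * RtoC r ^ i)%C); lia. }
      rewrite <- E.
      apply mean_lim_csum; intros i _; apply mean_lim_scal.
      destruct (Nat.eq_dec i k) as [->|Hik].
      + apply mean_lim_ext with (fun _ => RtoC 1); [|apply mean_lim_const].
        intros t; unfold Rminus; rewrite Rplus_opp_r, char_0; reflexivity.
      + apply mean_lim_char. intros E'; apply Hik, INR_eq; lra.
    - intros t.
      rewrite (csum_ext _ (fun i => char (- INR k) t * (c i * (RtoC r * char 1 t) ^ i))%C).
      2:{ intros i _; rewrite Cpow_mult, char_pow.
          replace (char (INR i - INR k) t) with (char (INR i) t * char (- INR k) t)%C; [ring|].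
          rewrite !char_Cexp, <- Cexp_plus; f_equal; apply C_eq; simpl; ring. }
      rewrite csum_scal. unfold F.
      match goal with |- Cmod (?p * ?q - ?q * ?s)%C <= _ =>
        replace (p * q - q * s)%C with (q * (p - s))%C by ring end.
      rewrite Cmod_mult, Cmod_char, Rmult_1_l.
      apply HJ; [lia|]. rewrite Hcirc; lra.
    - replace (c k * RtoC r ^ k - c k * RtoC r ^ k)%C with (RtoC 0) by ring. rewrite Cmod_0; lra. }
  assert (HF : forall t, Cmod (F t) <= B)
    by (intros t; unfold F; rewrite Cmod_mult, Cmod_char, Rmult_1_r; apply HB, Hcirc).
  pose proof (mean_lim_bound _ _ B HM HF) as H.
  rewrite Cmod_mult, Cmod_pow, Cmod_R, Rabs_pos_eq in H by lra. exact H.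
Qed.

Lemma rsum_geom (q : R) (N : nat) : q <> 1 -> rsum (fun k => q ^ k) N = (1 - q ^ N) / (1 - q).
Proof.
  intros Hq; induction N as [|N IH]; [simpl; field; lra|].
  rewrite rsum_S, IH; simpl; field; lra.
Qed.

(** The tail of a Taylor expansion, by Cauchy's estimate and a geometric series. *)
Lemma taylor_tail (f : C -> C) (z0 : C) (c : nat -> C) (r B : R) (J : nat) (w : C) :
  taylor f z0 c -> 0 < r -> (forall w, Cmod w = r -> Cmod (f (z0 + w)%C) <= B) ->
  Cmod w < r ->
  Cmod (f (z0 + w) - csum (fun k => c k * w ^ k) J)%C
  <= B * ((Cmod w / r) ^ J / (1 - Cmod w / r)).
Proof.
  intros Hf Hr HB Hw. pose proof (Cmod_ge_0 w) as Hw0.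
  assert (HB0 : 0 <= B).
  { eapply Rle_trans; [apply Cmod_ge_0|apply (HB (RtoC r))]. rewrite Cmod_R, Rabs_pos_eq; lra. }
  set (q := Cmod w / r).
  assert (Hq : 0 <= q < 1).
  { unfold q; split; [apply Rle_mult_inv_pos; lra|].
    apply Rmult_lt_reg_r with r; [assumption|]. unfold Rdiv; rewrite Rmult_assoc, Rinv_l; lra. }
  assert (Hc : forall k, Cmod (c k * w ^ k) <= B * q ^ k).
  { intros k. pose proof (taylor_cauchy f z0 c r B k Hf Hr HB) as H.
    rewrite Cmod_mult, Cmod_pow. replace (Cmod w) with (r * q) by (unfold q; field; lra).
    rewrite Rpow_mult_distr, <- Rmult_assoc.
    apply Rmult_le_compat_r; [apply pow_le; lra|assumption]. }
  apply le_epsilon; intros e He.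
  destruct (Hf r e Hr He) as [J0 HJ].
  set (S1 := csum (fun k => c k * w ^ k)%C (J + J0)).
  set (S0 := csum (fun k => c k * w ^ k)%C J).
  pose proof (Cmod_triangle_3 (f (z0 + w)%C) S1 S0) as T.
  pose proof (HJ (J + J0)%nat w ltac:(lia) ltac:(lra)) as H1. fold S1 in H1.
  assert (H2 : Cmod (S1 - S0) <= B * (q ^ J / (1 - q))); [|fold q; lra].
  unfold S1, S0; eapply Rle_trans; [apply csum_tail_le; lia|].
  apply Rle_trans with (B * (rsum (fun k => q ^ k) (J + J0) - rsum (fun k => q ^ k) J)).
  - apply rsum_tail_le; [lia|exact Hc].
  - apply Rmult_le_compat_l; [assumption|].
    rewrite !rsum_geom by lra.
    assert (0 <= q ^ (J + J0) / (1 - q)) by (apply Rle_mult_inv_pos; [apply pow_le|]; lra).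
    replace ((1 - q ^ (J + J0)) / (1 - q) - (1 - q ^ J) / (1 - q))
      with (q ^ J / (1 - q) - q ^ (J + J0) / (1 - q)) by (field; lra). lra.
Qed.

(** Smallness on the small circle is passed on by the first J Taylor
    coefficients; the bound on the large circle takes care of the others. *)
Lemma taylor_two_circles (f : C -> C) (z0 : C) (c : nat -> C) (r1 r2 eta B : R) (J : nat) (w : C) :
  taylor f z0 c -> 0 < r1 -> 0 < r2 ->
  (forall w, Cmod w = r1 -> Cmod (f (z0 + w)%C) <= eta) ->
  (forall w, Cmod w = r2 -> Cmod (f (z0 + w)%C) <= B) ->
  Cmod w < r2 ->
  Cmod (f (z0 + w)%C)
  <= eta * rsum (fun k => (Cmod w / r1) ^ k) J + B * ((Cmod w / r2) ^ J / (1 - Cmod w / r2)).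
Proof.
  intros Hf Hr1 Hr2 H1 H2 Hw.
  pose proof (taylor_tail f z0 c r2 B J w Hf Hr2 H2 Hw) as T.
  replace (f (z0 + w)%C) with (csum (fun k => c k * w ^ k) J
    + (f (z0 + w) - csum (fun k => c k * w ^ k) J))%C by ring.
  eapply Rle_trans; [apply Cmod_triangle|]. apply Rplus_le_compat; [|assumption].
  eapply Rle_trans; [apply Cmod_csum_le|]. rewrite <- rsum_scal.
  apply rsum_le; intros k _.
  pose proof (taylor_cauchy f z0 c r1 eta k Hf Hr1 H1) as H.
  rewrite Cmod_mult, Cmod_pow. replace (Cmod w) with (r1 * (Cmod w / r1)) at 1 by (field; lra).
  rewrite Rpow_mult_distr, <- Rmult_assoc.
  apply Rmult_le_compat_r; [|assumption].
  apply pow_le, Rle_mult_inv_pos; [apply Cmod_ge_0|assumption].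
Qed.

Lemma taylor_second_order (f : C -> C) (z0 : C) (c : nat -> C) (r B : R) (w : C) :
  taylor f z0 c -> 0 < r -> (forall w, Cmod w = r -> Cmod (f (z0 + w)%C) <= B) ->
  Cmod w <= r / 2 ->
  Cmod (f (z0 + w) - f z0 - c 1%nat * w)%C <= 2 * B / r ^ 2 * Cmod w ^ 2.
Proof.
  intros Hf Hr HB Hw. pose proof (Cmod_ge_0 w) as Hw0.
  assert (HB0 : 0 <= B).
  { eapply Rle_trans; [apply Cmod_ge_0|apply (HB (RtoC r))]. rewrite Cmod_R, Rabs_pos_eq; lra. }
  assert (E : (f z0 - c 0%nat = 0)%C).
  { apply Cmod_le_small; intros e He. destruct (Hf r e Hr He) as [J0 HJ].
    specialize (HJ (S J0) (RtoC 0) ltac:(lia)). rewrite Cmod_0 in HJ.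
    specialize (HJ ltac:(lra)). replace (z0 + RtoC 0)%C with z0 in HJ by ring.
    rewrite (csum_single _ 0) in HJ; [|lia|].
    - simpl in HJ. replace (c 0%nat * 1)%C with (c 0%nat) in HJ by ring. exact HJ.
    - intros k _ Hk; destruct k; [congruence|]. rewrite Cpow_S; ring. }
  pose proof (taylor_tail f z0 c r B 2 w Hf Hr HB ltac:(lra)) as T.
  replace (f (z0 + w) - f z0 - c 1%nat * w)%C
    with (f (z0 + w) - csum (fun k => c k * w ^ k) 2)%C.
  2:{ replace (f z0) with ((f z0 - c 0%nat) + c 0%nat)%C by ring. rewrite E. simpl; ring. }
  eapply Rle_trans; [apply T|].
  set (q := Cmod w / r).
  assert (Hq : 0 <= q <= / 2).
  { unfold q; split; [apply Rle_mult_inv_pos; lra|].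
    apply Rmult_le_reg_r with r; [assumption|]. unfold Rdiv; rewrite Rmult_assoc, Rinv_l; lra. }
  replace (2 * B / r ^ 2 * Cmod w ^ 2) with (B * (2 * q ^ 2)) by (unfold q; field; lra).
  apply Rmult_le_compat_l; [assumption|].
  apply Rmult_le_reg_r with (1 - q); [lra|].
  unfold Rdiv; rewrite Rmult_assoc, Rinv_l by lra.
  assert (0 <= q ^ 2) by apply pow2_ge_0. nra.
Qed.

Lemma dpoly_minus (b b' : nat -> C) (N N' : nat) :
  forall z0, exists c, taylor (fun s => dpoly b N s + (-1) * dpoly b' N' s)%C z0 c.
Proof.
  intros z0. destruct (taylor_dpoly b N z0) as [c Hc], (taylor_dpoly b' N' z0) as [d Hd].
  eexists. apply (taylor_plus _ (fun s => (-1) * dpoly b' N' s)%C z0 c (fun k => (-1) * d k)%C);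
    [exact Hc|]. apply taylor_scal, Hd.
Qed.

Lemma inv_S_small (e : R) : 0 < e -> exists N, forall j, (N <= j)%nat -> / INR (S j) <= e.
Proof.
  intros He. destruct (archimed_cor1 e He) as [N [HN HN0]].
  exists N; intros j Hj. apply Rlt_le, Rle_lt_trans with (/ INR N); [|assumption].
  apply Rinv_le_contravar; [apply lt_0_INR; lia|apply le_INR; lia].
Qed.

Lemma Re_circle (z w : C) : Re z - Cmod w <= Re (z + w)%C.
Proof.
  rewrite re_plus. pose proof (re_le_Cmod w); pose proof (Rle_abs (- Re w)) as H'.
  rewrite Rabs_Ropp in H'. lra.
Qed.

(** Vitali's theorem for Dirichlet polynomials.  The discs centred at z + 2 and
    passing through z lie in the half-plane, so convergence on Re s >= 2 reaches z;
    the uniform second-order estimates let the derivatives converge as well. *)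
Theorem dpoly_vitali (b : nat -> nat -> C) (L : nat -> nat) (B : R) : 0 <= B ->
  (forall j s, / INR (S j) <= Re s -> Cmod (dpoly (b j) (L j) s) <= B + / INR (S j)) ->
  (forall e, 0 < e -> exists J, forall i j s, (J <= i)%nat -> (J <= j)%nat -> 2 <= Re s ->
     Cmod (dpoly (b i) (L i) s - dpoly (b j) (L j) s) <= e) ->
  exists g, (forall s, 0 < Re s -> diff_at g s) /\ (forall s, 0 < Re s -> Cmod (g s) <= B) /\
    (forall s, 0 < Re s -> clim (fun j => dpoly (b j) (L j) s) (g s)).
Proof.
  intros HB0 HB HC. set (P := fun j => dpoly (b j) (L j)).
  assert (HB1 : forall d, 0 < d -> exists J, forall j s, (J <= j)%nat -> d <= Re s ->
            Cmod (P j s) <= B + 1).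
  { intros d Hd. destruct (inv_S_small (Rmin d 1)) as [J HJ]; [apply Rmin_pos; lra|].
    exists J; intros j s Hj Hs. specialize (HJ j Hj).
    pose proof (Rmin_l d 1); pose proof (Rmin_r d 1).
    eapply Rle_trans; [apply HB; lra|lra]. }
  assert (Hconv : forall s, 0 < Re s -> exists l, clim (fun j => P j s) l).
  { intros s Hs; apply ccauchy_clim; intros e He.
    destruct (HB1 (Re s / 2) ltac:(lra)) as [J1 HJ1].
    set (q := 2 / (2 + Re s / 2)).
    assert (Hq : 0 < q < 1).
    { unfold q; split; [apply Rdiv_lt_0_compat; lra|].
      apply Rmult_lt_reg_r with (2 + Re s / 2); [lra|].
      unfold Rdiv; rewrite Rmult_assoc, Rinv_l; lra. }
    set (A := 2 * (B + 1) / (1 - q)).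
    assert (HA : 0 < A) by (apply Rdiv_lt_0_compat; lra).
    destruct (pow_lt_1_zero q) with (y := e / (2 * A)) as [K HK].
    { rewrite Rabs_pos_eq; lra. } { apply Rdiv_lt_0_compat; lra. }
    specialize (HK K (le_n K)). rewrite Rabs_pos_eq in HK by (apply pow_le; lra).
    set (G := rsum (fun k => (2 / Re s) ^ k) K).
    assert (HG : 0 <= G)
      by (apply rsum_nonneg; intros; apply pow_le, Rle_mult_inv_pos; lra).
    destruct (HC (e / (2 * (G + 1)))) as [J2 HJ2]; [apply Rdiv_lt_0_compat; lra|].
    exists (J1 + J2)%nat; intros m n Hm Hn.
    destruct (dpoly_minus (b m) (b n) (L m) (L n) (s + 2)%C) as [c Hc].
    replace (P m s - P n s)%C with (P m s + (-1) * P n s)%C by ring.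
    assert (Ew : Cmod (RtoC (-2)) = 2) by (rewrite Cmod_R, Rabs_left; lra).
    pose proof (taylor_two_circles _ (s + 2)%C c (Re s) (2 + Re s / 2)
      (e / (2 * (G + 1))) (2 * (B + 1)) K (RtoC (-2)) Hc ltac:(lra) ltac:(lra)) as T.
    rewrite Ew in T. fold q G in T.
    replace (s + 2 + RtoC (-2))%C with s in T by (destruct s; apply C_eq; simpl; ring).
    eapply Rle_trans; [apply T|].
    - intros w Hw. pose proof (Re_circle (s + 2)%C w) as Hre. rewrite Hw, re_plus in Hre.
      simpl (Re 2) in Hre.
      replace (dpoly (b m) (L m) (s + 2 + w) + (-1) * dpoly (b n) (L n) (s + 2 + w))%C
        with (dpoly (b m) (L m) (s + 2 + w) - dpoly (b n) (L n) (s + 2 + w))%C by ring.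
      apply HJ2; try lia; lra.
    - intros w Hw. pose proof (Re_circle (s + 2)%C w) as Hre. rewrite Hw, re_plus in Hre.
      simpl (Re 2) in Hre.
      replace (dpoly (b m) (L m) (s + 2 + w) + (-1) * dpoly (b n) (L n) (s + 2 + w))%C
        with (P m (s + 2 + w) + - P n (s + 2 + w))%C by (unfold P; ring).
      eapply Rle_trans; [apply Cmod_triangle|]. rewrite Cmod_opp.
      pose proof (HJ1 m (s + 2 + w)%C ltac:(lia) ltac:(lra)).
      pose proof (HJ1 n (s + 2 + w)%C ltac:(lia) ltac:(lra)). lra.
    - lra.
    - assert (e / (2 * (G + 1)) * G <= e / 2).
      { apply Rle_trans with (e / (2 * (G + 1)) * (G + 1)); [|right; field; lra].
        apply Rmult_le_compat_l; [apply Rlt_le, Rdiv_lt_0_compat; lra|lra]. }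
      replace (2 * (B + 1) * (q ^ K / (1 - q))) with (A * q ^ K) by (unfold A; field; lra).
      assert (A * q ^ K <= A * (e / (2 * A))) by (apply Rmult_le_compat_l; lra).
      replace (A * (e / (2 * A))) with (e / 2) in * by (field; lra). lra. }
  set (g := fun s => epsilon (inhabits (RtoC 0)) (fun l => clim (fun j => P j s) l)).
  assert (Hg : forall s, 0 < Re s -> clim (fun j => P j s) (g s))
    by (intros s Hs; apply epsilon_spec, Hconv, Hs).
  exists g; split; [|split; [|exact Hg]].
  2:{ intros s Hs; apply clim_bounded_by with (1 := Hg s Hs); intros e He.
      destruct (inv_S_small (Rmin (Re s) e)) as [J HJ]; [apply Rmin_pos; assumption|].
      exists J; intros j Hj; specialize (HJ j Hj).
      pose proof (Rmin_l (Re s) e); pose proof (Rmin_r (Re s) e).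
      eapply Rle_trans; [apply HB; lra|lra]. }
  intros z Hz. set (r := Re z / 2). assert (Hr : 0 < r) by (unfold r; lra).
  destruct (HB1 r Hr) as [J1 HJ1].
  set (K := 2 * (B + 1) / r ^ 2).
  assert (HK : 0 < K) by (apply Rdiv_lt_0_compat; [lra|apply pow_lt, Hr]).
  assert (Hc : forall j, exists c, taylor (P j) z c) by (intros j; apply taylor_dpoly).
  set (D := fun j => epsilon (inhabits (fun _ : nat => RtoC 0)) (taylor (P j) z) 1%nat).
  assert (HD : forall j w, (J1 <= j)%nat -> Cmod w <= r / 2 ->
            Cmod (P j (z + w) - P j z - D j * w)%C <= K * Cmod w ^ 2).
  { intros j w Hj Hw; unfold D, K.
    apply taylor_second_order; auto; [apply epsilon_spec, Hc|].
    intros w' Hw'. apply HJ1; [assumption|].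
    pose proof (Re_circle z w') as Hre; rewrite Hw' in Hre. unfold r in *; lra. }
  assert (HDc : exists d, clim D d).
  { apply ccauchy_clim; intros e He.
    set (h := Rmin (r / 2) (e / (4 * K))).
    assert (Hh : 0 < h) by (apply Rmin_pos; [|apply Rdiv_lt_0_compat]; lra).
    assert (Hh1 : h <= r / 2) by apply Rmin_l. assert (Hh2 : h <= e / (4 * K)) by apply Rmin_r.
    assert (HhC : Cmod (RtoC h) = h) by (rewrite Cmod_R, Rabs_pos_eq; lra).
    assert (Hzh : 0 < Re (z + RtoC h)%C) by (change (0 < Re z + h); lra).
    assert (Heh : 0 < e * h / 8) by (apply Rdiv_lt_0_compat; [apply Rmult_lt_0_compat|]; lra).
    destruct (Hg z Hz (e * h / 8) Heh) as [N1 HN1].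
    destruct (Hg _ Hzh (e * h / 8) Heh) as [N2 HN2].
    exists (J1 + N1 + N2)%nat; intros m n Hm Hn.
    pose proof (HD m (RtoC h) ltac:(lia) ltac:(lra)) as E1.
    pose proof (HD n (RtoC h) ltac:(lia) ltac:(lra)) as E2.
    pose proof (HN1 m ltac:(lia)) as A1. pose proof (HN1 n ltac:(lia)) as A2.
    pose proof (HN2 m ltac:(lia)) as A3. pose proof (HN2 n ltac:(lia)) as A4.
    rewrite HhC in E1, E2.
    set (zh := (z + RtoC h)%C) in *.
    assert (T : Cmod ((D m - D n) * RtoC h) <= 2 * K * h ^ 2 + e * h / 2).
    { replace ((D m - D n) * RtoC h)%C with
        ((- (P m zh - P m z - D m * RtoC h) + (P n zh - P n z - D n * RtoC h))
         + (((P m zh - g zh) + - (P n zh - g zh))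
            + (- (P m z - g z) + (P n z - g z))))%C by ring.
      pose proof (Cmod_triangle (- (P m zh - P m z - D m * RtoC h))
                   (P n zh - P n z - D n * RtoC h)) as T1.
      pose proof (Cmod_triangle (P m zh - g zh)
                   (- (P n zh - g zh))) as T2.
      pose proof (Cmod_triangle (- (P m z - g z)) (P n z - g z)) as T3.
      rewrite Cmod_opp in T1, T2, T3.
      eapply Rle_trans; [apply Cmod_triangle|].
      eapply Rle_trans; [apply Rplus_le_compat_l, Cmod_triangle|]. lra. }
    rewrite Cmod_mult, HhC in T.
    apply Rmult_le_reg_r with h; [assumption|].
    assert (2 * K * h ^ 2 <= e * h / 2).
    { replace (2 * K * h ^ 2) with (2 * K * h * h) by ring.
      replace (e * h / 2) with (2 * K * (e / (4 * K)) * h) by (field; lra).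
      apply Rmult_le_compat_r; [lra|]. apply Rmult_le_compat_l; lra. }
    lra. }
  destruct HDc as [d Hd]. exists d. intros e He.
  exists (Rmin (r / 2) (e / K)); split; [apply Rmin_pos; [|apply Rdiv_lt_0_compat]; lra|].
  intros z' Hz'.
  assert (Hw1 : Cmod (z' - z) <= r / 2)
    by (apply Rlt_le; eapply Rlt_le_trans; [apply Hz'|apply Rmin_l]).
  assert (Hw2 : Cmod (z' - z) <= e / K)
    by (apply Rlt_le; eapply Rlt_le_trans; [apply Hz'|apply Rmin_r]).
  pose proof (Cmod_ge_0 (z' - z)) as Hw0.
  assert (Hz'0 : 0 < Re z').
  { pose proof (Re_circle z (z' - z)%C) as Hre.
    replace (z + (z' - z))%C with z' in Hre by ring. unfold r in *; lra. }
  assert (HL : clim (fun j => (P j z' + (-1) * P j z) + (- (z' - z)) * D j)%C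
                 ((g z' + (-1) * g z) + (- (z' - z)) * d)%C).
  { apply clim_plus; [apply clim_plus; [auto|apply clim_scal; auto]|apply clim_scal; auto]. }
  apply Rle_trans with (K * Cmod (z' - z) ^ 2).
  - replace (g z' - g z - d * (z' - z))%C with ((g z' + (-1) * g z) + (- (z' - z)) * d)%C by ring.
    apply clim_bounded_by with (1 := HL); intros e' He'. exists J1; intros j Hj.
    specialize (HD j (z' - z)%C Hj Hw1). replace (z + (z' - z))%C with z' in HD by ring.
    replace (P j z' + (-1) * P j z + - (z' - z) * D j)%C
      with (P j z' - P j z - D j * (z' - z))%C by ring. lra.
  - replace (K * Cmod (z' - z) ^ 2) with (K * Cmod (z' - z) * Cmod (z' - z)) by ring.
    apply Rmult_le_compat_r; [assumption|].
    replace e with (K * (e / K)) by (field; lra). apply Rmult_le_compat_l; lra.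
Qed.

(** * Smooth numbers *)

Definition smooth (y n : nat) : Prop :=
  forall p : nat, prime (Z.of_nat p) -> Nat.divide p n -> (p <= y)%nat.

Definition ind (y k : nat) : R :=
  if excluded_middle_informative (smooth y (S k)) then 1 else 0.

Lemma ind_bounds (y k : nat) : 0 <= ind y k <= 1.
Proof. unfold ind; destruct (excluded_middle_informative _); lra. Qed.

Lemma ind_lt (y k : nat) : (k < y)%nat -> ind y k = 1.
Proof.
  intros H; unfold ind; destruct (excluded_middle_informative _) as [|Hn]; [reflexivity|].
  exfalso; apply Hn; intros p _ Hp. apply Nat.divide_pos_le in Hp; lia.
Qed.

Lemma prime_divide_mult (p a b : nat) : prime (Z.of_nat p) -> Nat.divide p (a * b) ->
  Nat.divide p a \/ Nat.divide p b.
Proof.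
  intros Hp [q Hq].
  assert (H : (Z.of_nat p | Z.of_nat a * Z.of_nat b)%Z) by (exists (Z.of_nat q); lia).
  assert (Back : forall c, (Z.of_nat p | Z.of_nat c)%Z -> Nat.divide p c).
  { intros c [k Hk]. exists (Z.to_nat k). destruct Hp as [Hp1 _]. nia. }
  destruct (prime_mult _ Hp _ _ H); auto.
Qed.

Lemma smooth_mult (y a b : nat) : smooth y (a * b) <-> smooth y a /\ smooth y b.
Proof.
  split.
  - intros H; split; intros p Hp Hd; apply (H p Hp).
    + apply Nat.divide_mul_l, Hd.
    + apply Nat.divide_mul_r, Hd.
  - intros [Ha Hb] p Hp Hd. destruct (prime_divide_mult p a b Hp Hd); auto.
Qed.

(** One implication is Euclid's lemma, the other closure under divisors; both are
    needed for the smooth part of a convolution to be the convolution of the smooth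
    parts. *)
Lemma ind_mult (y j k : nat) : ind y (S j * S k - 1) = ind y j * ind y k.
Proof.
  unfold ind. replace (S (S j * S k - 1)) with (S j * S k)%nat by nia.
  pose proof (smooth_mult y (S j) (S k)).
  destruct (excluded_middle_informative (smooth y (S j * S k)));
  destruct (excluded_middle_informative (smooth y (S j)));
  destruct (excluded_middle_informative (smooth y (S k))); try ring; tauto.
Qed.

Lemma prime_divisor (n : nat) : (1 < n)%nat -> exists p, prime (Z.of_nat p) /\ Nat.divide p n.
Proof.
  induction n as [n IH] using lt_wf_ind; intros Hn.
  destruct (prime_dec (Z.of_nat n)) as [Hp|Hp]; [exists n; split; [assumption|exists 1%nat; lia]|].
  destruct (not_prime_divide (Z.of_nat n) ltac:(lia) Hp) as [d [Hd [q Hq]]].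
  destruct (IH (Z.to_nat d) ltac:(lia) ltac:(lia)) as [p [Hp1 [k Hk]]].
  exists p; split; [assumption|]. exists (Z.to_nat q * k)%nat.
  rewrite <- Nat.mul_assoc, <- Hk. nia.
Qed.

Lemma ind_1 (k : nat) : ind 1 k = if Nat.eq_dec k 0 then 1 else 0.
Proof.
  destruct (Nat.eq_dec k 0) as [->|Hk]; [apply ind_lt; lia|].
  unfold ind; destruct (excluded_middle_informative _) as [H|]; [|reflexivity].
  destruct (prime_divisor (S k) ltac:(lia)) as [p [Hp Hd]].
  specialize (H p Hp Hd). destruct Hp as [Hp1 _]. lia.
Qed.

(** The only prime factor beyond y allowed on the left is y+1 itself. *)
Lemma ind_step (y k : nat) :
  ind (S y) k <= ind y k + (if (S k mod S y =? 0)%nat then ind (S y) (S k / S y - 1) else 0).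
Proof.
  destruct (excluded_middle_informative (smooth y (S k))) as [Hs|Hs].
  { assert (E : ind y k = 1) by (unfold ind; destruct (excluded_middle_informative _); tauto).
    rewrite E. pose proof (ind_bounds (S y) k); pose proof (ind_bounds (S y) (S k / S y - 1)).
    destruct (S k mod S y =? 0)%nat; lra. }
  destruct (excluded_middle_informative (smooth (S y) (S k))) as [Hs'|Hs'].
  2:{ assert (E : ind (S y) k = 0) by (unfold ind; destruct (excluded_middle_informative _); tauto).
      rewrite E. pose proof (ind_bounds y k); pose proof (ind_bounds (S y) (S k / S y - 1)).
      destruct (S k mod S y =? 0)%nat; lra. }
  assert (Hd : Nat.divide (S y) (S k)).
  { apply NNPP; intros Hnd; apply Hs; intros p Hp Hpd.
    specialize (Hs' p Hp Hpd). destruct (Nat.eq_dec p (S y)) as [->|]; [contradiction|lia]. }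
  destruct Hd as [q Hq].
  assert (Hm : (S k mod S y = 0)%nat) by (rewrite Hq; apply Nat.Div0.mod_mul).
  assert (Hdiv : (S k / S y = q)%nat) by (rewrite Hq; apply Nat.div_mul; lia).
  rewrite Hm, Hdiv. rewrite Nat.eqb_refl.
  assert (Hq0 : q <> 0%nat) by (intros ->; simpl in Hq; lia).
  assert (E : ind (S y) (q - 1) = 1).
  { unfold ind; destruct (excluded_middle_informative _) as [|Hn]; [reflexivity|].
    exfalso; apply Hn. replace (S (q - 1)) with q by lia.
    rewrite Hq in Hs'. apply smooth_mult in Hs'; tauto. }
  rewrite E. pose proof (ind_bounds y k); pose proof (ind_bounds (S y) k); lra.
Qed.

Lemma rpow_mult (x : R) (j k : nat) : rpow (S j * S k - 1) x = rpow j x * rpow k x.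
Proof. unfold rpow; rewrite <- exp_plus, freq_mult; f_equal; ring. Qed.

Lemma rsum_multiples (a : nat -> R) (k N : nat) :
  rsum (fun n => if (S n mod S k =? 0)%nat then a (S n / S k - 1)%nat else 0) N
  = rsum a (N / S k).
Proof.
  apply RtoC_inj. rewrite <- !csum_RtoC, <- csum_multiples.
  apply csum_ext; intros n _; destruct (S n mod S k =? 0)%nat; reflexivity.
Qed.

(** Partial Euler products: by the previous decomposition, the sum over
    (y+1)-smooth numbers is at most the one over y-smooth numbers divided by
    1 - (y+1)^(-x). *)
Lemma summable_smooth (x : R) (y : nat) : 0 < x -> summable (fun k => ind (S y) k * rpow k x).
Proof.
  intros Hx; induction y as [|y [M HM]].
  - exists 1; intros N.
    destruct N as [|N]; [simpl; lra|].
    rewrite (rsum_extend _ 1 (S N)); [|lia|].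
    + simpl; rewrite ind_1; simpl; unfold rpow; rewrite freq_0, Rmult_0_r, Ropp_0, exp_0; lra.
    + intros n Hn; rewrite ind_1; destruct (Nat.eq_dec n 0); [lia|ring].
  - set (q := rpow (S y) x).
    assert (Hq : q < 1).
    { unfold q, rpow; rewrite <- exp_0; apply exp_increasing.
      assert (0 < freq (S y)).
      { unfold freq; rewrite <- ln_1; apply ln_increasing; [lra|].
        rewrite !S_INR; pose proof (pos_INR y); lra. }
      assert (0 < x * freq (S y)) by (apply Rmult_lt_0_compat; assumption). lra. }
    assert (Hq0 : 0 < q) by apply rpow_pos.
    set (u := fun k => ind (S (S y)) k * rpow k x).
    assert (Hu : forall k, 0 <= u k)
      by (intros k; apply Rmult_le_pos; [apply ind_bounds|apply Rlt_le, rpow_pos]).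
    exists (M / (1 - q)); intros N. fold u.
    assert (H : rsum u N <= M + q * rsum u N).
    { apply Rle_trans with (rsum (fun k => ind (S y) k * rpow k x) N
        + rsum (fun n => if (S n mod S (S y) =? 0)%nat then (fun j => q * u j) (S n / S (S y) - 1)%nat else 0) N).
      - rewrite <- rsum_plus; apply rsum_le; intros k _; unfold u.
        pose proof (ind_step (S y) k) as Hs. pose proof (rpow_pos k x) as Hp.
        apply Rle_trans with ((ind (S y) k + (if (S k mod S (S y) =? 0)%nat
              then ind (S (S y)) (S k / S (S y) - 1) else 0)) * rpow k x).
        + apply Rmult_le_compat_r; lra.
        + destruct (Nat.eqb_spec (S k mod S (S y)) 0) as [H0|H0]; [|lra].
          assert (E : rpow k x = q * rpow (S k / S (S y) - 1) x).
          { unfold q; rewrite Rmult_comm, <- rpow_mult; f_equal; apply multiple_index, H0. }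
          rewrite Rmult_plus_distr_r; apply Rplus_le_compat_l. rewrite E; right; ring.
      - rewrite (rsum_multiples (fun j => q * u j)), rsum_scal.
        apply Rplus_le_compat; [apply HM|]. apply Rmult_le_compat_l; [lra|].
        apply rsum_mono; [assumption|]. apply Nat.Div0.div_le_upper_bound; nia. }
    apply Rmult_le_reg_r with (1 - q); [lra|]. unfold Rdiv; rewrite Rmult_assoc, Rinv_l; lra.
Qed.

(** * From bounded convolution to bounded analytic functions *)

Definition delta (k : nat) : C := if (k =? 0)%nat then RtoC 1 else RtoC 0.

Lemma conv_delta (a : nat -> C) (n : nat) : conv a delta n = a n.
Proof.
  unfold conv; rewrite (csum_single _ 0); [|lia|].
  - rewrite Nat.mod_1_r, Nat.div_1_r. simpl. rewrite Nat.sub_0_r. unfold delta; simpl; ring.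
  - intros k _ Hk; unfold delta; destruct (Nat.eqb_spec k 0); [contradiction|].
    destruct (S n mod S k =? 0)%nat; ring.
Qed.

Lemma conv_bounded_square_sum (a : nat -> C) (B : R) : conv_bounded a B ->
  forall N, rsum (fun n => Cmod (a n) ^ 2) N <= B ^ 2.
Proof.
  intros H N. specialize (H delta N).
  rewrite (rsum_ext _ (fun n => Cmod (a n) ^ 2)) in H by (intros; rewrite conv_delta; reflexivity).
  eapply Rle_trans; [exact H|].
  rewrite <- (Rmult_1_r (B ^ 2)) at 2. apply Rmult_le_compat_l; [apply pow2_ge_0|].
  destruct N as [|N]; [simpl; lra|].
  rewrite (rsum_extend _ 1 (S N)); [|lia|].
  - unfold delta; simpl; rewrite Cmod_1; lra.
  - intros n Hn; unfold delta; destruct (Nat.eqb_spec n 0); [lia|]. rewrite Cmod_0; ring.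
Qed.

Lemma abs_conv_square_summable (a : nat -> C) (x : R) : / 2 < x ->
  summable (fun n => Cmod (a n) ^ 2) -> abs_conv a x.
Proof.
  intros Hx H.
  apply summable_le with (fun n => Cmod (a n) ^ 2 + rpow n (2 * x)).
  - intros n. replace (2 * x) with (x + x) by ring. rewrite rpow_plus.
    pose proof (pow2_ge_0 (Cmod (a n) - rpow n x)).
    generalize dependent (Cmod (a n)); generalize (rpow n x); intros; nra.
  - apply summable_plus; [assumption|apply summable_rpow; lra].
Qed.

Lemma conv_bounded_coeff (a : nat -> C) (B : R) (n : nat) : 0 <= B ->
  conv_bounded a B -> Cmod (a n) <= B.
Proof.
  intros HB H. pose proof (conv_bounded_square_sum a B H (S n)) as E. rewrite rsum_S in E.
  assert (0 <= rsum (fun n => Cmod (a n) ^ 2) n) by (apply rsum_nonneg; intros; apply pow2_ge_0).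
  apply Rsqr_incr_0; [unfold Rsqr; nra|apply Cmod_ge_0|assumption].
Qed.

Lemma Cauchy_Schwarz_weighted (u v : nat -> C) (B : R) (N : nat) : 0 < B ->
  rsum (fun n => Cmod (v n) ^ 2) N <= B ^ 2 * rsum (fun n => Cmod (u n) ^ 2) N ->
  rsum (fun n => Cmod (u n) * Cmod (v n)) N <= B * rsum (fun n => Cmod (u n) ^ 2) N.
Proof.
  intros HB H.
  apply Rle_trans with (rsum (fun n => B / 2 * Cmod (u n) ^ 2 + / (2 * B) * Cmod (v n) ^ 2) N).
  - apply rsum_le; intros n _.
    pose proof (pow2_ge_0 (B * Cmod (u n) - Cmod (v n))).
    apply Rmult_le_reg_l with (2 * B); [lra|]. field_simplify; [|lra]. simpl in *; lra.
  - rewrite rsum_plus, !rsum_scal.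
    apply Rle_trans with (B / 2 * rsum (fun n => Cmod (u n) ^ 2) N
      + / (2 * B) * (B ^ 2 * rsum (fun n => Cmod (u n) ^ 2) N)).
    + apply Rplus_le_compat_l, Rmult_le_compat_l; [apply Rlt_le, Rinv_0_lt_compat; lra|assumption].
    + right; field; lra.
Qed.

(** Test the bound against the vector u with entries conj (k^(-s)) on smooth k.
    As smooth numbers form a multiplicative set closed under divisors, the form
    sum_n conj (u_n) (a*u)_n is itself the convolution of the smooth part of the
    series at s with the positive series of the |u_k|^2, so it tends to the product
    of the two sums. *)
Lemma smooth_part_bound (a : nat -> C) (B : R) (y : nat) (s A : C) :
  0 <= B -> conv_bounded a B -> 0 < Re s ->
  cseries (dirichlet_term (fun k => RtoC (ind (S y) k) * a k)%C s) A -> Cmod A <= B.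
Proof.
  intros HB0 HB Hs HA.
  set (w := fun k => RtoC (ind (S y) k)).
  set (al := dirichlet_term (fun k => w k * a k)%C s) in *.
  set (u := fun k => (w k * Cconj (npow k s))%C).
  set (kp := fun k => RtoC (ind (S y) k * rpow k (2 * Re s))).
  assert (Hw : forall j k, w (S j * S k - 1)%nat = (w j * w k)%C)
    by (intros; unfold w; rewrite ind_mult, RtoC_mult; reflexivity).
  assert (Hww : forall k, (w k * w k)%C = w k).
  { intros k; unfold w; rewrite <- RtoC_mult; f_equal; unfold ind.
    destruct (excluded_middle_informative _); ring. }
  assert (Hnn : forall k, (npow k s * Cconj (npow k s))%C = RtoC (rpow k (2 * Re s))).
  { intros k. rewrite <- Cmod2_conj, Cmod_npow. f_equal.
    replace (2 * Re s) with (Re s + Re s) by ring. rewrite rpow_plus; ring. }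
  assert (Hkp : forall k, Cmod (kp k) = ind (S y) k * rpow k (2 * Re s)).
  { intros k; unfold kp; rewrite Cmod_R, Rabs_pos_eq; [reflexivity|].
    apply Rmult_le_pos; [apply ind_bounds|apply Rlt_le, rpow_pos]. }
  assert (Hu2 : forall k, Cmod (u k) ^ 2 = ind (S y) k * rpow k (2 * Re s)).
  { intros k. apply RtoC_inj. rewrite Cmod2_conj. unfold u.
    rewrite Cmult_conj, Cconj_conj.
    replace (Cconj (w k)) with (w k) by (unfold w; apply C_eq; simpl; ring).
    rewrite RtoC_mult, <- Hnn. fold (w k). rewrite <- (Hww k) at 3. ring. }
  assert (Hconv : forall n, conv al kp n = (Cconj (u n) * conv a u n)%C).
  { intros n. unfold conv at 2. rewrite <- csum_scal. unfold conv; apply csum_ext; intros k Hk.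
    destruct (Nat.eqb_spec (S n mod S k) 0) as [H0|H0]; [|ring].
    pose proof (multiple_index n k H0) as En. set (j := (S n / S k - 1)%nat) in *.
    rewrite En. unfold al, kp, u, dirichlet_term. fold (npow j s).
    rewrite Cmult_conj, Cconj_conj, npow_mult, Hw, RtoC_mult, <- Hnn. fold (w k).
    replace (Cconj (w j * w k)) with (w j * w k)%C by (unfold w; apply C_eq; simpl; ring).
    rewrite <- (Hww k) at 1. ring. }
  destruct (summable_smooth (2 * Re s) y ltac:(lra)) as [M HM].
  assert (Hsum : abs_summable kp).
  { exists M; intros N. rewrite (rsum_ext _ (fun k => ind (S y) k * rpow k (2 * Re s))) by auto.
    apply HM. }
  destruct (abs_summable_cseries kp Hsum) as [Z HZ].
  pose proof (cseries_conv al kp A Z HA Hsum HZ) as HAZ.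
  set (z := fun N => rsum (fun k => ind (S y) k * rpow k (2 * Re s)) N).
  assert (Hz : forall N, csum kp N = RtoC (z N)) by (intros N; unfold kp; apply csum_RtoC).
  assert (Hz1 : forall N, (1 <= N)%nat -> 1 <= z N).
  { intros N HN. unfold z.
    apply Rle_trans with (rsum (fun k => ind (S y) k * rpow k (2 * Re s)) 1).
    - simpl. rewrite ind_lt by lia. unfold rpow; rewrite freq_0, Rmult_0_r, Ropp_0, exp_0; lra.
    - apply rsum_mono; [|assumption]. intros k; apply Rmult_le_pos; [apply ind_bounds|apply Rlt_le, rpow_pos]. }
  assert (HZ1 : 1 <= Cmod Z).
  { apply Rnot_lt_le; intros Hlt. destruct (HZ ((1 - Cmod Z) / 2) ltac:(lra)) as [N HN].
    specialize (HN (S N) ltac:(lia)). rewrite Hz in HN.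
    pose proof (Cmod_triangle (RtoC (z (S N)) - Z) Z) as T.
    replace (RtoC (z (S N)) - Z + Z)%C with (RtoC (z (S N))) in T by ring.
    pose proof (Hz1 (S N) ltac:(lia)). rewrite Cmod_R, Rabs_pos_eq in T by lra. lra. }
  apply le_epsilon; intros e He.
  assert (HBe : conv_bounded a (B + e)).
  { intros b N; eapply Rle_trans; [apply HB|]. apply Rmult_le_compat_r.
    - apply rsum_nonneg; intros; apply pow2_ge_0.
    - apply pow_incr; lra. }
  apply Rmult_le_reg_r with (Cmod Z); [lra|]. rewrite <- Cmod_mult.
  apply clim_bounded_by with (1 := HAZ); intros e' He'.
  destruct (HZ (e' / (B + e)) ltac:(apply Rdiv_lt_0_compat; lra)) as [N0 HN0].
  exists (S N0); intros N HN.
  rewrite (csum_ext _ _ N (fun n _ => Hconv n)).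
  apply Rle_trans with ((B + e) * z N).
  - eapply Rle_trans; [apply Cmod_csum_le|].
    rewrite (rsum_ext _ (fun n => Cmod (u n) * Cmod (conv a u n)))
      by (intros; rewrite Cmod_mult, Cmod_conj; reflexivity).
    unfold z; rewrite <- (rsum_ext (fun n => Cmod (u n) ^ 2)
      (fun k => ind (S y) k * rpow k (2 * Re s))) by (intros; apply Hu2).
    apply Cauchy_Schwarz_weighted; [lra|apply HBe].
  - specialize (HN0 N ltac:(lia)). rewrite Hz in HN0.
    pose proof (Cmod_triangle (RtoC (z N) - Z) Z) as T.
    replace (RtoC (z N) - Z + Z)%C with (RtoC (z N)) in T by ring.
    pose proof (Hz1 N ltac:(lia)). rewrite Cmod_R, Rabs_pos_eq in T by lra.
    replace ((B + e) * Cmod Z + e') with ((B + e) * (Cmod Z + e' / (B + e))) by (field; lra).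
    apply Rmult_le_compat_l; lra.
Qed.

(** The parts of the series over (j+1)-smooth indices converge for Re s > 0 and are
    bounded there by [B].  Cutting them off far enough gives Dirichlet polynomials
    which converge, far to the right, to the sum of the series. *)
Theorem conv_bounded_extension (a : nat -> C) (B : R) : 0 <= B -> conv_bounded a B ->
  exists g, (forall s, 0 < Re s -> diff_at g s) /\ (forall s, 0 < Re s -> Cmod (g s) <= B) /\
    dirichlet_on (1 / 2) a g.
Proof.
  intros HB0 HB.
  set (b := fun j k => (RtoC (ind (S j) k) * a k)%C).
  assert (Hb : forall j k, Cmod (b j k) <= Cmod (a k)).
  { intros j k; unfold b; rewrite Cmod_mult, Cmod_R. pose proof (ind_bounds (S j) k).
    rewrite Rabs_pos_eq by lra. rewrite <- (Rmult_1_l (Cmod (a k))) at 2.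
    apply Rmult_le_compat_r; [apply Cmod_ge_0|lra]. }
  assert (Hbs : forall j x, 0 < x -> abs_conv (b j) x).
  { intros j x Hx.
    apply summable_le with (fun k => B * (ind (S j) k * rpow k x));
      [|apply summable_scal; [assumption|apply summable_smooth, Hx]].
    intros k; unfold b; rewrite Cmod_mult, Cmod_R. pose proof (ind_bounds (S j) k).
    rewrite Rabs_pos_eq by lra.
    replace (B * (ind (S j) k * rpow k x)) with (ind (S j) k * B * rpow k x) by ring.
    apply Rmult_le_compat_r; [apply Rlt_le, rpow_pos|]. apply Rmult_le_compat_l; [lra|].
    apply conv_bounded_coeff; assumption. }
  assert (Hinv : forall j, 0 < / INR (S j)) by (intros; apply Rinv_0_lt_compat, INR_S_pos).
  assert (HL : forall j, exists L, (j <= L)%nat /\ forall N, (L <= N)%nat ->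
     rsum (fun k => Cmod (b j k) * rpow k (/ INR (S j))) N
     - rsum (fun k => Cmod (b j k) * rpow k (/ INR (S j))) L <= / INR (S j)).
  { intros j.
    assert (Hpos : forall k, 0 <= Cmod (b j k) * rpow k (/ INR (S j)))
      by (intros; apply abs_term_nonneg).
    destruct (summable_tail _ Hpos (Hbs j _ (Hinv j)) _ (Hinv j)) as [L HL].
    exists (L + j)%nat; split; [lia|]. intros N HN. specialize (HL N ltac:(lia)).
    pose proof (rsum_mono _ L (L + j) Hpos ltac:(lia)); lra. }
  set (L := fun j => epsilon (inhabits 0%nat) (fun L => (j <= L)%nat /\ forall N, (L <= N)%nat ->
     rsum (fun k => Cmod (b j k) * rpow k (/ INR (S j))) N
     - rsum (fun k => Cmod (b j k) * rpow k (/ INR (S j))) L <= / INR (S j))).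
  assert (HL' : forall j, (j <= L j)%nat /\ forall N, (L j <= N)%nat ->
     rsum (fun k => Cmod (b j k) * rpow k (/ INR (S j))) N
     - rsum (fun k => Cmod (b j k) * rpow k (/ INR (S j))) (L j) <= / INR (S j))
    by (intros j; apply (epsilon_spec (inhabits 0%nat) _ (HL j))).
  clearbody L. clear HL.
  assert (HP : forall j s N, dpoly (b j) N s = csum (dirichlet_term (b j) s) N) by reflexivity.
  (* indices up to j are smooth, so the j-th polynomial contains the first j terms *)
  assert (Happ : forall x, abs_conv a x -> forall e, 0 < e -> exists J,
     (forall N, (J <= N)%nat -> rsum (fun k => Cmod (a k) * rpow k x) N
        - rsum (fun k => Cmod (a k) * rpow k x) J <= e) /\
     forall j s, (J <= j)%nat -> x <= Re s ->
     Cmod (dpoly (b j) (L j) s - csum (dirichlet_term a s) J) <= e).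
  { intros x Hx e He.
    assert (Hpos : forall k, 0 <= Cmod (a k) * rpow k x)
      by (intros; apply abs_term_nonneg).
    destruct (summable_tail _ Hpos Hx e He) as [J HJ].
    exists J; split; [exact HJ|]; intros j s Hj Hsx. rewrite HP.
    rewrite (csum_ext (dirichlet_term a s) (dirichlet_term (b j) s)).
    2:{ intros n Hn; unfold dirichlet_term, b. rewrite ind_lt by lia. ring. }
    destruct (HL' j) as [HLj _].
    eapply Rle_trans; [apply csum_tail_le; lia|].
    apply Rle_trans with (2 := HJ (L j) ltac:(lia)). rewrite <- Rmult_1_l.
    apply rsum_tail_le; [lia|]. intros k; rewrite Rmult_1_l, Cmod_dirichlet_term.
    apply Rmult_le_compat; [apply Cmod_ge_0|apply Rlt_le, rpow_pos|apply Hb|apply rpow_antimono, Hsx]. }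
  assert (Hsq : summable (fun n => Cmod (a n) ^ 2))
    by (exists (B ^ 2); apply conv_bounded_square_sum, HB).
  destruct (dpoly_vitali b L B HB0) as [g [Hg1 [Hg2 Hg3]]].
  - intros j s Hs.
    assert (Hs0 : 0 < Re s) by (specialize (Hinv j); lra).
    destruct (abs_summable_cseries (dirichlet_term (b j) s)) as [A HA].
    { apply abs_conv_term with (Re s); [apply Hbs, Hs0|lra]. }
    pose proof (smooth_part_bound a B j s A HB0 HB Hs0 HA) as HAB.
    rewrite HP.
    assert (T : Cmod (A - csum (dirichlet_term (b j) s) (L j)) <= / INR (S j)).
    { apply cseries_tail_le; [assumption|]. intros N HN.
      apply Rle_trans with (2 := proj2 (HL' j) N HN). rewrite <- Rmult_1_l.
      apply rsum_tail_le; [assumption|]. intros k; rewrite Rmult_1_l, Cmod_dirichlet_term.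
      apply Rmult_le_compat_l; [apply Cmod_ge_0|apply rpow_antimono, Hs]. }
    rewrite Cmod_minus_sym in T.
    pose proof (Cmod_triangle (csum (dirichlet_term (b j) s) (L j) - A) A) as T'.
    replace (csum (dirichlet_term (b j) s) (L j) - A + A)%C
      with (csum (dirichlet_term (b j) s) (L j)) in T' by ring. lra.
  - intros e He.
    assert (H2 : abs_conv a 2) by (apply abs_conv_square_summable; [lra|assumption]).
    destruct (Happ 2 H2 (e / 2) ltac:(lra)) as [J [_ HJ]].
    exists J; intros i j s Hi Hj Hs.
    pose proof (Cmod_triangle_3 (dpoly (b i) (L i) s) (csum (dirichlet_term a s) J) (dpoly (b j) (L j) s)) as T.
    pose proof (HJ i s Hi Hs). pose proof (HJ j s Hj Hs) as H4. rewrite Cmod_minus_sym in H4. lra.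
  - exists g; split; [assumption|]; split; [assumption|].
    apply dirichlet_on_iff; intros s Hs.
    assert (Hx : abs_conv a (Re s)) by (apply abs_conv_square_summable; [lra|assumption]).
    destruct (abs_summable_cseries (dirichlet_term a s)) as [f Hf];
      [apply abs_conv_term with (Re s); [assumption|lra]|].
    replace (g s) with f; [assumption|].
    apply clim_unique with (fun j => dpoly (b j) (L j) s); [|apply Hg3; lra].
    intros e He.
    destruct (Happ _ Hx (e / 2) ltac:(lra)) as [J [HJ1 HJ2]].
    exists J; intros j Hj.
    eapply Rle_trans; [apply (Cmod_triangle_3 _ (csum (dirichlet_term a s) J))|].
    specialize (HJ2 j s Hj ltac:(lra)).
    assert (T : Cmod (f - csum (dirichlet_term a s) J) <= e / 2).
    { apply cseries_tail_le; [assumption|]. intros N HN.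
      rewrite !(rsum_ext (fun n => Cmod (dirichlet_term a s n))
        (fun k => Cmod (a k) * rpow k (Re s))) by (intros; apply Cmod_dirichlet_term).
      apply HJ1, HN. }
    rewrite Cmod_minus_sym in T. lra.
Qed.

(** * Multiplication operators are bounded *)

Definition energy (b : nat -> C) (N : nat) : R := rsum (fun n => Cmod (b n) ^ 2) N.

Lemma energy_nonneg (b : nat -> C) (N : nat) : 0 <= energy b N.
Proof. apply rsum_nonneg; intros; apply pow2_ge_0. Qed.

Lemma energy_ext (b b' : nat -> C) (N : nat) :
  (forall n, (n < N)%nat -> b n = b' n) -> energy b N = energy b' N.
Proof. intros H; apply rsum_ext; intros n Hn; rewrite H; auto. Qed.

Lemma energy_scal (c : C) (b : nat -> C) (N : nat) :
  energy (fun n => c * b n)%C N = Cmod c ^ 2 * energy b N.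
Proof.
  unfold energy; rewrite <- rsum_scal; apply rsum_ext; intros n _.
  rewrite Cmod_mult, Rpow_mult_distr; reflexivity.
Qed.

Lemma energy_mono (b : nat -> C) (M N : nat) : (M <= N)%nat -> energy b M <= energy b N.
Proof. apply rsum_mono; intros; apply pow2_ge_0. Qed.

Lemma energy_term (b : nat -> C) (N n : nat) : (n < N)%nat -> Cmod (b n) ^ 2 <= energy b N.
Proof.
  intros H. apply Rle_trans with (energy b (S n)); [|apply energy_mono; lia].
  unfold energy; rewrite rsum_S. pose proof (energy_nonneg b n) as E; unfold energy in E; lra.
Qed.

Lemma conv_zero (a b : nat -> C) (n : nat) :
  (forall k, (k <= n)%nat -> b k = 0%C) -> conv a b n = 0%C.
Proof.
  intros H; unfold conv; apply csum_zero; intros k Hk.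
  destruct (S n mod S k =? 0)%nat; [rewrite H by lia; ring|reflexivity].
Qed.

(** By homogeneity; cutting off entries beyond [N] changes neither side. *)
Lemma conv_bounded_normalized (a : nat -> C) (B : R) :
  (forall (h : nat -> C) N, (forall n, (N <= n)%nat -> h n = 0%C) -> energy h N <= 1 ->
     energy (conv a h) N <= B ^ 2) ->
  conv_bounded a B.
Proof.
  intros H b N. fold (energy b N). fold (energy (conv a b) N).
  destruct (Rle_lt_or_eq_dec 0 (energy b N) (energy_nonneg b N)) as [Hp|He].
  - set (t := / sqrt (energy b N)).
    assert (Ht : Cmod (RtoC t) ^ 2 = / energy b N).
    { rewrite Cmod_R, pow2_abs. unfold t. rewrite pow_inv. f_equal.
      apply pow2_sqrt; lra. }
    set (h := fun n => (RtoC t * trunc N b n)%C).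
    assert (Eh : energy h N = 1).
    { unfold h; rewrite energy_scal, (energy_ext _ b) by (intros; apply trunc_lt; assumption).
      rewrite Ht; field; lra. }
    assert (Ec : energy (conv a h) N = / energy b N * energy (conv a b) N).
    { rewrite <- Ht, <- energy_scal. apply energy_ext; intros n Hn; unfold h.
      rewrite conv_scal_r, conv_trunc by assumption. reflexivity. }
    specialize (H h N). rewrite Ec, Eh in H.
    assert (H' : / energy b N * energy (conv a b) N <= B ^ 2).
    { apply H; [|lra]. intros n Hn; unfold h; rewrite trunc_ge by assumption; ring. }
    apply Rmult_le_reg_l with (/ energy b N); [apply Rinv_0_lt_compat; assumption|].
    rewrite (Rmult_comm (B ^ 2)), <- (Rmult_assoc (/ energy b N)), Rinv_l, Rmult_1_l by lra.
    assumption.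
  - rewrite <- He, Rmult_0_r. right.
    unfold energy; rewrite (rsum_ext _ (fun _ => 0)); [rewrite rsum_const; ring|].
    intros n Hn; rewrite conv_zero; [rewrite Cmod_0; ring|].
    intros k Hk. pose proof (energy_term b N k ltac:(lia)) as Hk'.
    apply Cmod_eq_0. pose proof (Cmod_ge_0 (b k)). simpl in Hk'. nra.
Qed.

(** The coefficients of the product by (L+1)^(-s): this is an isometry that
    commutes with convolution by a fixed sequence. *)
Definition dilate (L : nat) (h : nat -> C) (n : nat) : C :=
  if (S n mod S L =? 0)%nat then h (S n / S L - 1)%nat else RtoC 0.

Lemma conv_dilate (a h : nat -> C) (L j : nat) :
  conv a (dilate L h) (S L * S j - 1) = conv a h j.
Proof.
  unfold conv at 1.
  set (G := fun i => if (S j mod S i =? 0)%nat then (a (S j / S i - 1)%nat * h i)%C else RtoC 0).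
  replace (S (S L * S j - 1)) with (S L * S j)%nat by nia.
  rewrite (csum_ext _ (fun k => if (S k mod S L =? 0)%nat then G (S k / S L - 1)%nat else RtoC 0)).
  - rewrite csum_multiples. rewrite Nat.mul_comm, Nat.div_mul by lia. reflexivity.
  - intros k Hk. unfold dilate.
    destruct (Nat.eqb_spec (S k mod S L) 0) as [H0|H0].
    2:{ destruct (_ =? 0)%nat; ring. }
    pose proof (Nat.div_mod_eq (S k) (S L)) as E. rewrite H0, Nat.add_0_r in E.
    assert (Hq : (S k / S L)%nat <> 0%nat) by (intros E0; rewrite E0 in E; lia).
    set (i := (S k / S L - 1)%nat). unfold G.
    replace (S k) with (S L * S i)%nat
      by (unfold i; replace (S (S k / S L - 1)) with (S k / S L)%nat by lia; lia).
    rewrite Nat.Div0.mul_mod_distr_l, Nat.Div0.div_mul_cancel_l by lia.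
    destruct (Nat.eqb_spec (S j mod S i) 0) as [H1|H1].
    + rewrite H1, Nat.mul_0_r. reflexivity.
    + destruct (Nat.eqb_spec (S L * (S j mod S i)) 0); [nia|reflexivity].
Qed.

Lemma energy_multiples (b h : nat -> C) (L N : nat) :
  (forall j, b (S L * S j - 1)%nat = h j) -> energy h N <= energy b (S L * N).
Proof.
  intros H. unfold energy at 1.
  replace N with (S L * N / S L)%nat at 1 by (rewrite Nat.mul_comm; apply Nat.div_mul; lia).
  rewrite <- rsum_multiples. apply rsum_le; intros n _.
  destruct (Nat.eqb_spec (S n mod S L) 0) as [H0|H0]; [|apply pow2_ge_0].
  rewrite <- H, Nat.mul_comm, <- multiple_index by assumption. lra.
Qed.

Lemma energy_dilate (h : nat -> C) (L N : nat) : energy (dilate L h) (S L * N) = energy h N.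
Proof.
  unfold energy at 2. replace N with (S L * N / S L)%nat at 2 by (rewrite Nat.mul_comm; apply Nat.div_mul; lia).
  rewrite <- rsum_multiples. apply rsum_ext; intros n _; unfold dilate.
  destruct (S n mod S L =? 0)%nat; [reflexivity|rewrite Cmod_0; ring].
Qed.

Lemma dilate_support_low (h : nat -> C) (L n : nat) : (n < L)%nat -> dilate L h n = 0%C.
Proof. intros H; unfold dilate; rewrite Nat.mod_small by lia; reflexivity. Qed.

Lemma dilate_support_high (h : nat -> C) (L N n : nat) :
  (forall k, (N <= k)%nat -> h k = 0%C) -> (S L * N <= n)%nat -> dilate L h n = 0%C.
Proof.
  intros H Hn; unfold dilate. destruct (Nat.eqb_spec (S n mod S L) 0) as [H0|H0]; [|reflexivity].
  pose proof (Nat.div_mod_eq (S n) (S L)) as E. rewrite H0, Nat.add_0_r in E.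
  apply H. nia.
Qed.

Definition finite_seq : Type := {p : (nat -> C) * nat | forall n, (snd p <= n)%nat -> fst p n = 0%C}.
Definition fs_seq (p : finite_seq) : nat -> C := fst (proj1_sig p).
Definition fs_len (p : finite_seq) : nat := snd (proj1_sig p).

(** A hump dilated beyond the current support leaves the earlier entries alone,
    and by the parallelogram identity it can be added with a sign for which the
    convolution does not get smaller than that of the hump. *)
Lemma add_hump (a : nat -> C) (p : finite_seq) (K e : R) :
  (forall B, 0 <= B -> ~ conv_bounded a B) -> 0 <= K -> 0 < e ->
  exists p' : finite_seq, (fs_len p < fs_len p')%nat /\
    (forall n, (n < fs_len p)%nat -> fs_seq p' n = fs_seq p n) /\
    energy (fs_seq p') (fs_len p') <= energy (fs_seq p) (fs_len p) + e /\
    K <= energy (conv a (fs_seq p')) (fs_len p').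
Proof.
  intros Hunb HK He. destruct p as [[b L] Hb]; unfold fs_seq, fs_len; simpl in *.
  set (B := K / e + 1).
  assert (HB : 1 <= B) by (unfold B; pose proof (Rle_mult_inv_pos K e HK He); unfold Rdiv; lra).
  assert (HBe : K <= e * B ^ 2).
  { assert (K <= e * B) by (unfold B; replace (e * (K / e + 1)) with (K + e) by (field; lra); lra).
    simpl. rewrite Rmult_1_r, <- Rmult_assoc. nra. }
  assert (Hh : exists (h : nat -> C) N, (forall n, (N <= n)%nat -> h n = 0%C) /\ energy h N <= 1 /\
                 B ^ 2 < energy (conv a h) N).
  { apply NNPP; intros Hn. apply (Hunb B); [lra|]. apply conv_bounded_normalized.
    intros h N Hs H1. apply Rnot_lt_le; intros Hlt; apply Hn; exists h, N; auto. }
  destruct Hh as [h0 [N [Hs0 [H10 Hbig0]]]].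
  set (t := RtoC (sqrt e)).
  assert (Ht : Cmod t ^ 2 = e) by (unfold t; rewrite Cmod_R, pow2_abs; apply pow2_sqrt; lra).
  set (h := fun n => (t * h0 n)%C).
  assert (Hs : forall n, (N <= n)%nat -> h n = 0%C) by (intros n Hn; unfold h; rewrite Hs0 by assumption; ring).
  assert (H1 : energy h N <= e).
  { unfold h; rewrite energy_scal, Ht. rewrite <- (Rmult_1_r e) at 2.
    apply Rmult_le_compat_l; lra. }
  assert (Hbig : K <= energy (conv a h) N).
  { rewrite (energy_ext _ (fun n => t * conv a h0 n)%C) by (intros; apply conv_scal_r).
    rewrite energy_scal, Ht. assert (e * B ^ 2 <= e * energy (conv a h0) N)
      by (apply Rmult_le_compat_l; lra). lra. }
  assert (HN : (1 <= N)%nat).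
  { destruct N; [|lia]. unfold energy in Hbig0; simpl in Hbig0. nra. }
  set (L' := (S L * N)%nat). assert (HL' : (L < L')%nat) by (unfold L'; nia).
  set (d := dilate L h).
  set (y := conv a d). set (x := conv a b).
  assert (Hy : K <= energy y L').
  { eapply Rle_trans; [exact Hbig|]. apply energy_multiples. intros j; apply conv_dilate. }
  assert (Hpar : energy (fun n => x n + y n)%C L' + energy (fun n => x n + (-1) * y n)%C L'
                 = 2 * energy x L' + 2 * energy y L').
  { unfold energy; rewrite <- !rsum_scal, <- !rsum_plus. apply rsum_ext; intros n _.
    rewrite !Cmod2_alt. destruct (x n), (y n); simpl; ring. }
  pose proof (energy_nonneg x L') as Hx0.
  assert (Hsg : exists sg : C, Cmod sg = 1 /\ K <= energy (fun n => x n + sg * y n)%C L').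
  { destruct (Rle_lt_dec K (energy (fun n => x n + y n)%C L')) as [Hle|Hlt].
    - exists (RtoC 1); split; [apply Cmod_1|].
      rewrite (energy_ext _ (fun n => x n + y n)%C) by (intros; ring). assumption.
    - exists (RtoC (-1)); split; [rewrite Cmod_R, Rabs_left; lra|]. lra. }
  destruct Hsg as [sg [Hsg1 HsgK]].
  assert (Hsupp : forall n, (snd ((fun n => b n + sg * d n)%C, L') <= n)%nat ->
            fst ((fun n => b n + sg * d n)%C, L') n = 0%C).
  { intros n Hn; simpl in *. rewrite Hb by lia. unfold d; rewrite (dilate_support_high h L N) by assumption.
    ring. }
  exists (exist _ ((fun n => b n + sg * d n)%C, L') Hsupp); simpl.
  split; [assumption|]. split; [|split].
  - intros n Hn; unfold d; rewrite dilate_support_low by assumption; ring.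
  - assert (Es : energy (fun n => b n + sg * d n)%C L' = energy b L' + energy d L').
    { unfold energy; rewrite <- rsum_plus; apply rsum_ext; intros n _.
      destruct (le_lt_dec L n) as [Hn|Hn].
      - rewrite Hb by assumption. replace (0 + sg * d n)%C with (sg * d n)%C by ring.
        rewrite Cmod_mult, Hsg1, Cmod_0; ring.
      - unfold d; rewrite dilate_support_low by assumption.
        replace (b n + sg * 0)%C with (b n) by ring. rewrite Cmod_0; ring. }
    rewrite Es. unfold d, L' at 2. rewrite energy_dilate.
    assert (energy b L' = energy b L).
    { apply rsum_extend; [lia|]. intros n Hn; rewrite Hb by lia; rewrite Cmod_0; ring. }
    lra.
  - rewrite (energy_ext _ (fun n => x n + sg * y n)%C); [assumption|].
    intros n _. rewrite conv_plus_r, conv_scal_r. reflexivity.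
Qed.

(** Gliding hump: if no bound existed, the sequence accumulating successive humps
    of summable energies would be square-summable with a convolution that is not. *)
Theorem conv_bounded_exists (a : nat -> C) :
  (forall b, summable (fun n => Cmod (b n) ^ 2) -> summable (fun n => Cmod (conv a b n) ^ 2)) ->
  exists B, 0 <= B /\ conv_bounded a B.
Proof.
  intros Hpres. apply NNPP; intros Hno.
  assert (Hunb : forall B, 0 <= B -> ~ conv_bounded a B) by (intros B HB Hc; apply Hno; exists B; auto).
  assert (Hhalf : forall k, 0 < (/ 2) ^ k) by (intros; apply pow_lt; lra).
  set (next := fun k p => proj1_sig (constructive_indefinite_description _
     (add_hump a p (INR k) ((/ 2) ^ k) Hunb (pos_INR k) (Hhalf k)))).
  assert (Hnext : forall k p, (fs_len p < fs_len (next k p))%nat /\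
    (forall n, (n < fs_len p)%nat -> fs_seq (next k p) n = fs_seq p n) /\
    energy (fs_seq (next k p)) (fs_len (next k p)) <= energy (fs_seq p) (fs_len p) + (/ 2) ^ k /\
    INR k <= energy (conv a (fs_seq (next k p))) (fs_len (next k p))).
  { intros k p; apply (proj2_sig (constructive_indefinite_description _
     (add_hump a p (INR k) ((/ 2) ^ k) Hunb (pos_INR k) (Hhalf k)))). }
  assert (H0 : forall n, (snd ((fun _ : nat => RtoC 0), 0%nat) <= n)%nat ->
            fst ((fun _ : nat => RtoC 0), 0%nat) n = 0%C) by reflexivity.
  set (q := fix q k := match k with O => (exist _ ((fun _ => RtoC 0), 0%nat) H0 : finite_seq)
                                  | S k => next k (q k) end).
  assert (Hq : forall k, q (S k) = next k (q k)) by reflexivity.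
  assert (Hlen : forall k, (k <= fs_len (q k))%nat).
  { induction k as [|k IH]; [lia|]. rewrite Hq. pose proof (proj1 (Hnext k (q k))); lia. }
  assert (Hagree : forall j k n, (n < fs_len (q k))%nat -> fs_seq (q (k + j)%nat) n = fs_seq (q k) n).
  { induction j as [|j IH]; intros k n Hn; [rewrite Nat.add_0_r; reflexivity|].
    rewrite Nat.add_succ_r, Hq.
    rewrite (proj1 (proj2 (Hnext _ _))); [apply IH, Hn|].
    clear IH; induction j as [|j IHj]; [rewrite Nat.add_0_r; assumption|].
    rewrite Nat.add_succ_r, Hq. pose proof (proj1 (Hnext (k + j)%nat (q (k + j)%nat))); lia. }
  assert (Hen : forall k, energy (fs_seq (q k)) (fs_len (q k)) <= 2 - 2 * (/ 2) ^ k).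
  { induction k as [|k IH]; [unfold energy; simpl; lra|].
    rewrite Hq. pose proof (proj1 (proj2 (proj2 (Hnext k (q k))))) as E.
    change ((/ 2) ^ S k) with (/ 2 * (/ 2) ^ k). lra. }
  set (b := fun n => fs_seq (q (S n)) n).
  assert (Hb : forall k n, (n < fs_len (q k))%nat -> b n = fs_seq (q k) n).
  { intros k n Hn; unfold b. pose proof (Hlen (S n)).
    rewrite <- (Hagree k (S n) n) by lia. rewrite <- (Hagree (S n) k n) by assumption.
    rewrite Nat.add_comm; reflexivity. }
  assert (Hsum : summable (fun n => Cmod (b n) ^ 2)).
  { exists 2; intros N. fold (energy b N).
    eapply Rle_trans; [apply (energy_mono b N (fs_len (q N))), Hlen|].
    rewrite (energy_ext b (fs_seq (q N))) by (intros; apply Hb; assumption).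
    specialize (Hen N); pose proof (Hhalf N); lra. }
  destruct (Hpres b Hsum) as [M HM].
  destruct (INR_unbounded M) as [k Hk].
  specialize (HM (fs_len (q (S k)))). fold (energy (conv a b) (fs_len (q (S k)))) in HM.
  rewrite (energy_ext _ (conv a (fs_seq (q (S k))))) in HM.
  - rewrite Hq in HM. pose proof (proj2 (proj2 (proj2 (Hnext k (q k))))). lra.
  - intros n Hn; apply conv_ext; intros i Hi; [reflexivity|apply Hb; lia].
Qed.

(** * The Hilbert space of Dirichlet series *)

Lemma sum_n_rsum (u : nat -> R) (n : nat) : sum_n u n = rsum u (S n).
Proof.
  induction n as [|n IH]; [rewrite sum_O; simpl; ring|].
  rewrite sum_Sn, IH; reflexivity.
Qed.

Lemma rsum_le_Series (u : nat -> R) (N : nat) : (forall n, 0 <= u n) -> ex_series u ->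
  rsum u N <= Series u.
Proof.
  intros Hu Hex. apply Rle_trans with (rsum u (S N)); [rewrite rsum_S; specialize (Hu N); lra|].
  rewrite <- sum_n_rsum.
  apply (is_lim_seq_incr_compare (sum_n u) (Series u)).
  - apply (Series_correct u Hex).
  - intros n; rewrite !sum_n_rsum, (rsum_S u (S n)); specialize (Hu (S n)); lra.
Qed.

Lemma summable_ex_series (u : nat -> R) (M : R) : (forall n, 0 <= u n) ->
  (forall N, rsum u N <= M) -> ex_series u /\ Series u <= M.
Proof.
  intros Hu HM.
  assert (Hex : ex_series u).
  { destruct (ex_finite_lim_seq_incr (sum_n u) M) as [l Hl].
    - intros n; rewrite !sum_n_rsum, (rsum_S u (S n)); specialize (Hu (S n)); lra.
    - intros n; rewrite sum_n_rsum; apply HM.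
    - exists l; exact Hl. }
  split; [assumption|].
  apply (is_lim_seq_le (sum_n u) (fun _ => M) (Series u) M).
  - intros n; rewrite sum_n_rsum; apply HM.
  - apply (Series_correct u Hex).
  - apply is_lim_seq_const.
Qed.

Lemma square_summable_iff (a : nat -> C) :
  square_summable a <-> summable (fun n => Cmod (a n) ^ 2).
Proof.
  split.
  - intros H; exists (Series (fun n => Cmod (a n) ^ 2)); intros N.
    apply rsum_le_Series; [intros; apply pow2_ge_0|exact H].
  - intros [M HM]; apply (summable_ex_series _ M); [intros; apply pow2_ge_0|assumption].
Qed.

Lemma square_summable_abs_conv (a : nat -> C) (x : R) :
  square_summable a -> / 2 < x -> abs_conv a x.
Proof. intros H Hx; apply abs_conv_square_summable; [assumption|apply square_summable_iff, H]. Qed.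

Lemma H_expansion_unique (f : C -> C) (a b : nat -> C) :
  H_expansion f a -> H_expansion f b -> forall n, a n = b n.
Proof.
  intros [Ha Hfa] [Hb Hfb]. rewrite dirichlet_on_iff in Hfa, Hfb.
  apply (dirichlet_coeff_unique a b 1 f).
  - apply square_summable_abs_conv; [assumption|lra].
  - apply square_summable_abs_conv; [assumption|lra].
  - intros t; apply Hfa; simpl; lra.
  - intros t; apply Hfb; simpl; lra.
Qed.

Lemma H_norm_expansion (f : C -> C) (a : nat -> C) : H_expansion f a ->
  H_norm f = sqrt (Series (fun n => Cmod (a n) ^ 2)).
Proof.
  intros H. unfold H_norm. f_equal. apply Series_ext; intros n.
  rewrite (H_expansion_unique f (H_coeff f) a); [reflexivity| |assumption].
  apply (epsilon_spec _ (H_expansion f)). exists a; assumption.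
Qed.

Lemma H_expansion_ext (f g : C -> C) (a b : nat -> C) :
  (forall s, 1 / 2 < Re s -> f s = g s) -> (forall n, a n = b n) ->
  H_expansion f a -> H_expansion g b.
Proof.
  intros Hfg Hab [Ha Hf]; split.
  - apply (ex_series_ext (fun n => Cmod (a n) ^ 2)); [intros; rewrite Hab; reflexivity|exact Ha].
  - rewrite dirichlet_on_iff in *. intros s Hs. rewrite <- Hfg by assumption.
    apply cseries_ext with (2 := Hf s Hs). intros n; unfold dirichlet_term; rewrite Hab; reflexivity.
Qed.

Lemma square_summable_expansion (b : nat -> C) : square_summable b -> exists f, H_expansion f b.
Proof.
  intros H. exists (fun s => epsilon (inhabits (RtoC 0)) (cseries (dirichlet_term b s))).
  split; [assumption|]. apply dirichlet_on_iff; intros s Hs.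
  apply epsilon_spec, abs_summable_cseries, abs_conv_term with (Re s); [|lra].
  apply square_summable_abs_conv; [assumption|lra].
Qed.

Lemma H_expansion_mult (m f : C -> C) (a b : nat -> C) :
  H_expansion m a -> H_expansion f b -> forall s, 1 / 2 < Re s ->
  cseries (dirichlet_term (conv a b) s) (m s * f s)%C.
Proof.
  intros [Ha Hm] [Hb Hf] s Hs. rewrite dirichlet_on_iff in Hm, Hf.
  apply dirichlet_conv; auto. apply abs_conv_term with (Re s); [|lra].
  apply square_summable_abs_conv; [assumption|lra].
Qed.

Lemma conv_bounded_square_summable (a b : nat -> C) (B : R) :
  conv_bounded a B -> square_summable b ->
  square_summable (conv a b) /\
  Series (fun n => Cmod (conv a b n) ^ 2) <= B ^ 2 * Series (fun n => Cmod (b n) ^ 2).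
Proof.
  intros HB Hb. apply summable_ex_series; [intros; apply pow2_ge_0|].
  intros N; eapply Rle_trans; [apply HB|]. apply Rmult_le_compat_l; [apply pow2_ge_0|].
  apply rsum_le_Series; [intros; apply pow2_ge_0|exact Hb].
Qed.

Lemma conv_bounded_expansion (a : nat -> C) (B : R) (m : C -> C) :
  conv_bounded a B -> dirichlet_on (1 / 2) a m -> H_expansion m a.
Proof.
  intros HB Hm; split; [|assumption]. apply square_summable_iff.
  exists (B ^ 2); apply conv_bounded_square_sum, HB.
Qed.

Lemma H_expansion_one : H_expansion (fun _ => RtoC 1) delta.
Proof.
  split.
  - apply square_summable_iff. exists 1; intros N. destruct N as [|N]; [simpl; lra|].
    rewrite (rsum_extend _ 1 (S N)); [|lia|].
    + unfold delta; simpl; rewrite Cmod_1; lra.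
    + intros n Hn; unfold delta; destruct (Nat.eqb_spec n 0); [lia|]. rewrite Cmod_0; ring.
  - apply dirichlet_on_iff; intros s _ e He. exists 1%nat; intros N HN.
    rewrite (csum_single _ 0) by
      (lia || (intros n _ Hn; unfold dirichlet_term, delta;
               destruct (Nat.eqb_spec n 0); [contradiction|ring])).
    unfold dirichlet_term. fold (npow 0 s). rewrite npow_Cexp, freq_0.
    replace (- (s * RtoC 0))%C with (RtoC 0) by ring. rewrite Cexp_0. unfold delta; simpl.
    replace (1 * 1 - 1)%C with (RtoC 0) by ring. rewrite Cmod_0; lra.
Qed.

(** Since 1 belongs to H, a multiplier is the sum of a Dirichlet series, and it acts
    on coefficients by convolution. *)
Lemma multiplier_coefficients (m : C -> C) : is_multiplier m ->
  exists a, H_expansion m a /\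
    (forall f b, H_expansion f b -> H_expansion (fun s => m s * f s)%C (conv a b)) /\
    exists B, 0 <= B /\ conv_bounded a B.
Proof.
  intros [_ Hm].
  destruct (Hm (fun _ => RtoC 1)) as [a Ha]; [exists delta; apply H_expansion_one|].
  assert (Hma : H_expansion m a).
  { apply H_expansion_ext with (3 := Ha); [intros; ring|reflexivity]. }
  assert (Hact : forall f b, H_expansion f b -> H_expansion (fun s => m s * f s)%C (conv a b)).
  { intros f b Hf. destruct (Hm f) as [c Hc]; [exists b; assumption|].
    apply H_expansion_ext with (3 := Hc); [reflexivity|].
    assert (Habs : forall d, square_summable d -> abs_conv d 1)
      by (intros d Hd; apply square_summable_abs_conv; [assumption|lra]).
    destruct Hc as [Hc1 Hc2]. rewrite dirichlet_on_iff in Hc2.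
    apply (dirichlet_coeff_unique c (conv a b) 1 (fun s => m s * f s)%C).
    - apply Habs, Hc1.
    - apply abs_conv_conv; apply Habs; [apply Hma|apply Hf].
    - intros t; apply (Hc2 (1, t)); simpl; lra.
    - intros t; apply (H_expansion_mult m f a b); auto; simpl; lra. }
  exists a; split; [assumption|]; split; [assumption|].
  apply conv_bounded_exists. intros b Hb. apply square_summable_iff in Hb.
  destruct (square_summable_expansion b Hb) as [f Hf].
  apply square_summable_iff, (Hact f b Hf).
Qed.

Lemma half_plane_diff_at (f : C -> C) (sg : R) :
  holomorphic_on (half_plane sg) f <-> forall s, sg < Re s -> diff_at f s.
Proof.
  split; intros H s Hs; [apply ex_derive_cdiff, H, Hs|apply ex_derive_cdiff, H, Hs].
Qed.

Lemma dirichlet_on_agree (sg tau : R) (a : nat -> C) (f g : C -> C) (s : C) :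
  dirichlet_on sg a f -> dirichlet_on tau a g -> sg < Re s -> tau < Re s -> f s = g s.
Proof.
  rewrite !dirichlet_on_iff; intros Hf Hg H1 H2.
  eapply clim_unique; [apply Hf, H1|apply Hg, H2].
Qed.

(** Both functions are the sum of the series further right; the identity theorem
    carries the equality back to the whole half-plane. *)
Lemma dirichlet_identity (sg p : R) (a : nat -> C) (f g : C -> C) :
  (forall s, sg < Re s -> diff_at f s) -> (forall s, sg < Re s -> diff_at g s) ->
  dirichlet_on p a f -> dirichlet_on p a g -> forall s, sg < Re s -> f s = g s.
Proof.
  intros Hf Hg Hfa Hga. apply identity_theorem with p; auto.
  intros z Hz. apply (dirichlet_on_agree p p a f g); auto.
Qed.

Lemma dirichlet_on_sub (sg tau : R) (a : nat -> C) (f g : C -> C) :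
  (forall s, tau < Re s -> sg < Re s /\ f s = g s) ->
  dirichlet_on sg a f -> dirichlet_on tau a g.
Proof.
  rewrite !dirichlet_on_iff; intros H Hf s Hs. destruct (H s Hs) as [H1 H2].
  rewrite <- H2; apply Hf, H1.
Qed.

Lemma Lub_Rbar_eq (E1 E2 : R -> Prop) : (exists x, E1 x) -> (exists x, E2 x) ->
  (forall B : R, (forall x, E1 x -> x <= B) <-> (forall x, E2 x -> x <= B)) ->
  Lub_Rbar E1 = Lub_Rbar E2.
Proof.
  intros [x1 H1] [x2 H2] H. apply is_lub_Rbar_unique.
  destruct (Lub_Rbar_correct E2) as [U L]. split.
  - intros x Hx. destruct (Lub_Rbar E2) as [l| |] eqn:El; simpl; auto.
    + apply (proj2 (H l)); [|assumption]. intros y Hy; apply (U y Hy).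
    + apply (U x2 H2).
  - intros l Hl. apply L. intros x Hx. destruct l as [l| |]; simpl; auto.
    + apply (proj1 (H l)); [|assumption]. intros y Hy; apply (Hl y Hy).
    + apply (Hl x1 H1).
Qed.

(** A bound for the operator on the unit ball of H is a bound for the convolution,
    since finite sequences are coefficient sequences of elements of H. *)
Lemma operator_bound_conv_bounded (m : C -> C) (a : nat -> C) (B : R) : 0 <= B ->
  (forall f b, H_expansion f b -> H_expansion (fun s => m s * f s)%C (conv a b)) ->
  (forall f, in_H f -> H_norm f <= 1 -> H_norm (fun s => m s * f s)%C <= B) ->
  conv_bounded a B.
Proof.
  intros HB0 Hact HB. apply conv_bounded_normalized; intros h N Hs H1.
  assert (Hbd : forall M, rsum (fun n => Cmod (h n) ^ 2) M <= 1).
  { intros M. fold (energy h M). destruct (le_lt_dec M N) as [HMN|HMN].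
    - eapply Rle_trans; [apply energy_mono, HMN|assumption].
    - unfold energy in *. rewrite (rsum_extend _ N M); [assumption|lia|].
      intros n Hn; rewrite Hs by lia. rewrite Cmod_0; ring. }
  destruct (summable_ex_series (fun n => Cmod (h n) ^ 2) 1 (fun n => pow2_ge_0 _) Hbd) as [Hex Hle].
  destruct (square_summable_expansion h Hex) as [f Hf].
  specialize (HB f (ex_intro _ h Hf)).
  rewrite (H_norm_expansion f h Hf), (H_norm_expansion _ _ (Hact f h Hf)) in HB.
  assert (Hn : sqrt (Series (fun n => Cmod (h n) ^ 2)) <= 1)
    by (rewrite <- sqrt_1; apply sqrt_le_1_alt, Hle).
  specialize (HB Hn). destruct (Hact f h Hf) as [Hc _].
  apply Rle_trans with (Series (fun n => Cmod (conv a h n) ^ 2)).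
  - apply rsum_le_Series; [intros; apply pow2_ge_0|exact Hc].
  - assert (H0 : 0 <= Series (fun n => Cmod (conv a h n) ^ 2)).
    { apply (rsum_le_Series _ 0); [intros; apply pow2_ge_0|exact Hc]. }
    rewrite <- (pow2_sqrt _ H0). apply pow_incr; split; [apply sqrt_pos|assumption].
Qed.

Lemma conv_bounded_operator_bound (m f : C -> C) (a b : nat -> C) (B : R) : 0 <= B ->
  conv_bounded a B -> H_expansion f b -> H_expansion (fun s => m s * f s)%C (conv a b) ->
  H_norm f <= 1 -> H_norm (fun s => m s * f s)%C <= B.
Proof.
  intros HB0 HB Hf Hmf. rewrite (H_norm_expansion f b Hf), (H_norm_expansion _ _ Hmf); intros H1.
  destruct (conv_bounded_square_summable a b B HB (proj1 Hf)) as [_ Hle].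
  assert (H0 : 0 <= Series (fun n => Cmod (b n) ^ 2)).
  { apply (rsum_le_Series _ 0); [intros; apply pow2_ge_0|apply Hf]. }
  rewrite <- (sqrt_pow2 B HB0). apply sqrt_le_1_alt. eapply Rle_trans; [exact Hle|].
  rewrite <- (Rmult_1_r (B ^ 2)) at 2. apply Rmult_le_compat_l; [apply pow2_ge_0|].
  rewrite <- (pow2_sqrt _ H0). replace 1 with (1 ^ 2) by ring.
  apply pow_incr; split; [apply sqrt_pos|assumption].
Qed.

Lemma Hinfty_bound_nonneg (g : C -> C) (B : R) :
  (forall s, half_plane 0 s -> Cmod (g s) <= B) -> 0 <= B.
Proof.
  intros H; eapply Rle_trans; [apply Cmod_ge_0|apply (H (RtoC 1))].
  unfold half_plane; simpl; lra.
Qed.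

Theorem theorem3p1 :
  (forall F : rhp_function, in_M F <-> in_D F /\ in_Hinfty F) /\
  (forall m g : C -> C,
     is_multiplier m -> is_Hinfty g -> identified (1 / 2)%R m 0%R g ->
     multiplier_norm m = Hinfty_norm g).
Proof.
  split.
  - intros F. pose proof (rhp_fun_holomorphic F) as HF. rewrite half_plane_diff_at in HF.
    split.
    + intros [m [Hm Hid]].
      destruct (multiplier_coefficients m Hm) as [a [[_ Hma] [_ [B [HB0 HB]]]]].
      pose proof (Rmax_l (abscissa F) (1 / 2)) as R1; pose proof (Rmax_r (abscissa F) (1 / 2)) as R2.
      assert (HFa : dirichlet_on (Rmax (abscissa F) (1 / 2)) a F).
      { apply dirichlet_on_sub with (2 := Hma). intros s Hs; split; [lra|].
        symmetry; apply Hid; unfold half_plane; lra. }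
      split; [exists (Rmax (abscissa F) (1 / 2)), a; split; [assumption|assumption]|].
      destruct (conv_bounded_extension a B HB0 HB) as [g [Hg [HgB Hga]]].
      exists g; split; [split; [apply half_plane_diff_at, Hg|exists B; exact HgB]|].
      intros s Hs1 Hs2. unfold half_plane in *.
      pose proof (Rmax_l (abscissa F) 0); pose proof (Rmax_r (abscissa F) 0).
      apply (dirichlet_identity (Rmax (abscissa F) 0) (Rmax (abscissa F) (1 / 2)) a F g).
      * intros z Hz; apply HF; lra.
      * intros z Hz; apply Hg; lra.
      * assumption.
      * apply dirichlet_on_sub with (2 := Hga). intros z Hz; split; [lra|reflexivity].
      * apply Rmax_lub_lt; assumption.
    + intros [[sg [a [Hsg HFa]]] [g [[Hg [B HgB]] Hid]]].
      rewrite half_plane_diff_at in Hg.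
      pose proof (Hinfty_bound_nonneg g B HgB) as HB0.
      pose proof (Rmax_l sg (1 / 2)); pose proof (Rmax_r sg (1 / 2)).
      assert (Hga : dirichlet_on (Rmax sg (1 / 2)) a g).
      { apply dirichlet_on_sub with (2 := HFa). intros s Hs; split; [lra|].
        apply Hid; unfold half_plane; lra. }
      pose proof (bounded_conv_bounded a g B _ Hg HgB Hga) as HB.
      destruct (conv_bounded_extension a B HB0 HB) as [g' [Hg' [_ Hg'a]]].
      assert (Hgg : forall s, 0 < Re s -> g' s = g s).
      { apply (dirichlet_identity 0 (Rmax sg (1 / 2)) a g' g); auto.
        apply dirichlet_on_sub with (2 := Hg'a). intros z Hz; split; [lra|reflexivity]. }
      assert (Hga2 : dirichlet_on (1 / 2) a g).
      { apply dirichlet_on_sub with (2 := Hg'a). intros s Hs; split; [lra|apply Hgg; lra]. }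
      pose proof (conv_bounded_expansion a B g HB Hga2) as HgH.
      exists g; split; [split|].
      * apply half_plane_diff_at. intros s Hs; apply Hg; lra.
      * intros f [b Hf]. exists (conv a b). split.
        -- apply (conv_bounded_square_summable a b B HB), Hf.
        -- apply dirichlet_on_iff; intros s Hs. apply (H_expansion_mult g f a b); auto.
      * intros s Hs1 Hs2. apply Hid; unfold half_plane in *; [assumption|lra].
  - intros m g Hm [Hg Hgb] Hid. rewrite half_plane_diff_at in Hg.
    destruct (multiplier_coefficients m Hm) as [a [[_ Hma] [Hact _]]].
    assert (Hga : dirichlet_on (1 / 2) a g).
    { apply dirichlet_on_sub with (2 := Hma). intros s Hs; split; [lra|].
      apply Hid; unfold half_plane; lra. }
    assert (Hz : H_expansion (fun _ => RtoC 0) (fun _ => RtoC 0) /\ H_norm (fun _ => RtoC 0) <= 1).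
    { assert (E : H_expansion (fun _ => RtoC 0) (fun _ => RtoC 0)).
      { split.
        - apply square_summable_iff; exists 0; intros N. rewrite rsum_const, Cmod_0.
          right; ring.
        - apply dirichlet_on_iff; intros s _ e He; exists 0%nat; intros N _.
          rewrite csum_zero by (intros; unfold dirichlet_term; ring).
          replace (0 - 0)%C with (RtoC 0) by ring. rewrite Cmod_0; lra. }
      split; [assumption|]. rewrite (H_norm_expansion _ _ E), Cmod_0.
      rewrite (Series_ext _ (fun _ => 0 * 0)) by (intros; ring).
      rewrite Series_scal_l, Rmult_0_l, sqrt_0; lra. }
    apply Lub_Rbar_eq.
    + eexists; exists (fun _ => RtoC 0); split; [eexists; apply Hz|split; [apply Hz|reflexivity]].
    + eexists; exists (RtoC 1); split; [unfold half_plane; simpl; lra|reflexivity].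
    + intros B; split.
      * intros HB r [s [Hs ->]].
        assert (HB0 : 0 <= B).
        { eapply Rle_trans; [|apply HB; exists (fun _ => RtoC 0);
            split; [eexists; apply Hz|split; [apply Hz|reflexivity]]]. apply sqrt_pos. }
        assert (HBc : conv_bounded a B).
        { apply (operator_bound_conv_bounded m a B HB0 Hact). intros f Hf H1.
          apply HB; exists f; auto. }
        destruct (conv_bounded_extension a B HB0 HBc) as [g' [Hg' [Hg'B Hg'a]]].
        rewrite <- (dirichlet_identity 0 (1 / 2) a g' g Hg' Hg Hg'a Hga s Hs).
        apply Hg'B, Hs.
      * intros HB r [f [[b Hf] [H1 ->]]].
        assert (HgB : forall s, half_plane 0 s -> Cmod (g s) <= B)
          by (intros s Hs; apply HB; exists s; auto).
        apply (conv_bounded_operator_bound m f a b B); auto.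
        -- apply (Hinfty_bound_nonneg g B HgB).
        -- apply (bounded_conv_bounded a g B (1 / 2)); auto.
Qed.
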